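(* Let $W$ be a complex reflection group acting irreducibly on a complex vector space $V$ of dimension $n$, with highest degree $d=d_n$. There is a natural map $$D\otimes S^W:\ \mathrm{Der}_{\mathbb{C}}(S,S)^W\longrightarrow \mathrm{Der}_{\mathbb{C}}(S^W,S^W)(d)$$ (the $S^W$-linear extension of the transpose $D$ of the duality pairing, as described in the context) which is an isomorphism if and only if $W$ is a duality group.
   Context: A complex reflection group is a finite subgroup of $GL(V)$ generated by elements whose fixed space is a hyperplane. $S=\mathbb{C}[V]=\mathrm{Sym}_{\mathbb{C}}(V^* )$ is graded with $V^*$ in degree $1$ (so $V$ is in degree $-1$), and $S^W$ is the algebra of invariants. $H\subseteq S$ is the space of harmonic polynomials, i.e. those killed by every non-constant invariant differential operator in $\mathrm{Sym}_{\mathbb{C}}(V)^W_+$; multiplication $H\otimes S^W\to S$ is an isomorphism. Graded shifts are defined by $M(k)_i=M_{i-k}$. $\mathrm{Hom}_W(V,H)\cong(V^*\otimes H)^W$ is graded so that a $W$-map $V\to H$ with image in polynomial degree $e$ has degree $e+1$; $\mathrm{Hom}_W(V^*,H)\cong(V\otimes H)^W$ is graded so that a $W$-map $V^*\to H$ with image in polynomial degree $e$ has degree $e-1$. The degrees $d_1\le\cdots\le d_n$ of $W$ are the degrees (with multiplicity) in which $\mathrm{Hom}_W(V,H)$ is nonzero, and the codegrees $d_1^*\ge\cdots\ge d_n^*$ are the degrees (with multiplicity) in which $\mathrm{Hom}_W(V^*,H)$ is nonzero. $W$ is a duality group if $d_i+d_i^*=d$ for all $i$, where $d=d_n$. Let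 $(v_i)$ be a basis of $V$ with dual basis $(v_i^* )$. Sending $\sigma\in\mathrm{Hom}_W(V,H)$ to $\tilde\sigma=\sum_i v_i^*\sigma(v_i)\in S^W$ induces an isomorphism of graded algebras $\mathrm{Sym}_{\mathbb{C}}(\mathrm{Hom}_W(V,H))\cong S^W$ (Chevalley–Shephard–Todd). Basic invariants $f_1,\dots,f_n$ of degrees $d_1,\dots,d_n$ are taken as the images of a homogeneous basis of $\mathrm{Hom}_W(V,H)$. The duality pairing $\mathrm{Hom}_W(V,H)\otimes\mathrm{Hom}_W(V^*,H)\to S^W\twoheadrightarrow\mathrm{Hom}_W(V,H)_d$ sends $\sigma\otimes\varphi$ to the invariant $\sum_i\sigma(v_i)\varphi(v_i^* )$ and then projects canonically to the degree $d$ part of $\mathrm{Hom}_W(V,H)\subseteq\mathrm{Sym}_{\mathbb{C}}(\mathrm{Hom}_W(V,H))\cong S^W$, that is, onto a highest degree basic invariant. Transposing this pairing, and reading its value as the coefficient of the highest degree basic invariant $f_n$, gives a degree-preserving map $D:\mathrm{Hom}_W(V^*,H)\to\mathrm{Hom}_W(V,H)^*(d)$. (For a duality group $\mathrm{Hom}_W(V,H)_d$ is one dimensional.) $\mathrm{Der}_{\mathbb{C}}(R,R)$ is the graded module of $\mathbb{C}$-linear derivations of $R$, and $\mathrm{Der}_{\mathbb{C}}(S,S)^W$ consists of those invariant under the natural $W$-action. One identifies $\mathrm{Der}_{\mathbb{C}}(S,S)^W\cong(V\otimes S)^W\cong\mathrm{Hom}_W(V^*,H)\otimes S^W$ and $\mathrm{Der}_{\mathbb{C}}(S^W,S^W)\cong\mathrm{Hom}_W(V,H)^*\otimes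 S^W$; the map $D\otimes S^W$ is the $S^W$-linear extension of $D$ under these identifications. *)

(* Defs.v *)
From HB Require Import structures.
From mathcomp Require Import all_boot all_order all_fingroup all_algebra.
From mathcomp Require Import mxrepresentation.
From mathcomp Require Import boolp classical_sets functions reals.
From mathcomp.real_closed Require Import complex.
From mathcomp.multinomials Require Import mpoly.

Set Implicit Arguments.
Unset Strict Implicit.
Unset Printing Implicit Defensive.

Import GRing.Theory.
Local Open Scope ring_scope.

(* Throughout, [V] is the space ['rV[F]_n] of row vectors and the group acts
   through a representation [W] by right multiplication, as is the convention
   for [mx_representation].  [V^*] is the space ['cV[F]_n] of column vectors,
   paired with [V] by [v *m xi], and [S = F[V]] is [{mpoly F[n]}], ['X_i] being
   the [i]-th coordinate function on [V]. *)

Section Actions.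

Variables (F : fieldType) (gT : finGroupType) (G : {group gT}) (n : nat).
Variable W : mx_representation F G n.

Definition reflection (g : gT) : bool :=
  (\rank (rfix_mx W [set g])).+1 == n.

Definition complex_reflection_group : Prop :=
  mx_faithful W /\ <<[set g in G | reflection g]>>%g = G :> {set gT}.

(* The left actions of the group on [V], [V^*], [S] and [Sym(V)]:
   g v = v g^-1, (g xi)(v) = xi (g^-1 v), (g p)(v) = p (g^-1 v).  [Sym(V)] is
   again encoded as [{mpoly F[n]}], where ['X_i] now stands for the [i]-th
   vector of the standard basis of [V]. *)
Definition actV (g : gT) (v : 'rV[F]_n) : 'rV[F]_n := v *m W g^-1%g.

Definition actVd (g : gT) (xi : 'cV[F]_n) : 'cV[F]_n := W g *m xi.

Definition actS (g : gT) (p : {mpoly F[n]}) : {mpoly F[n]} :=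
  p \mPo [tuple \sum_(j < n) W g j i *: 'X_j | i < n].

Definition actSymV (g : gT) (q : {mpoly F[n]}) : {mpoly F[n]} :=
  q \mPo [tuple \sum_(j < n) W g^-1%g i j *: 'X_j | i < n].

(* The constant coefficient differential operator attached to [q \in Sym(V)],
   a vector acting as the corresponding directional derivative. *)
Definition diffop (q p : {mpoly F[n]}) : {mpoly F[n]} :=
  \sum_(m <- msupp q) q@_m *: p^`M[m].

Definition harmonic (p : {mpoly F[n]}) : Prop :=
  forall q : {mpoly F[n]},
    (forall g, g \in G -> actSymV g q = q) -> q@_0%MM = 0 -> diffop q p = 0.

Definition S_ (k : int) (p : {mpoly F[n]}) : Prop :=
  if k is Posz e then p \is e.-homog else p = 0.

Lemma actS_is_linear g : linear (actS g).
Proof. by move=> c p q; rewrite /actS linearP. Qed.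

HB.instance Definition _ g :=
  GRing.isLinear.Build F {mpoly F[n]} {mpoly F[n]} _ (actS g)
    (actS_is_linear g).

Lemma actS_is_multiplicative g : monoid_morphism (actS g).
Proof. by split=> [|p q]; rewrite /actS ?rmorph1 ?rmorphM. Qed.

HB.instance Definition _ g :=
  GRing.isMonoidMorphism.Build {mpoly F[n]} {mpoly F[n]} (actS g)
    (actS_is_multiplicative g).

Definition invS_pred : {pred {mpoly F[n]}} :=
  [pred p | [forall g in G, actS g p == p]].

Lemma invS_predP p :
  reflect (forall g, g \in G -> actS g p = p) (p \in invS_pred).
Proof.
apply: (iffP forall_inP) => inv g Gg; [exact/eqP/inv | exact/eqP/inv].
Qed.

Lemma invS_subalg_closed : subalg_closed invS_pred.
Proof.
split=> [|a p q /invS_predP pI /invS_predP qI|p q /invS_predP pI /invS_predP qI].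
- by apply/invS_predP=> g _; rewrite rmorph1.
- by apply/invS_predP=> g Gg; rewrite linearP /= pI // qI.
- by apply/invS_predP=> g Gg; rewrite rmorphM /= pI // qI.
Qed.

HB.instance Definition _ :=
  GRing.isSubalgClosed.Build F {mpoly F[n]} invS_pred invS_subalg_closed.

Record invS := InvS { invS_val :> {mpoly F[n]}; _ : invS_val \in invS_pred }.

HB.instance Definition _ := [isSub for invS_val].
HB.instance Definition _ := [Choice of invS by <:].
HB.instance Definition _ := [SubChoice_isSubComNzRing of invS by <:].
HB.instance Definition _ := [SubZmodule_isSubLmodule of invS by <:].
HB.instance Definition _ := [SubNzRing_SubLmodule_isSubLalgebra of invS by <:].
HB.instance Definition _ := [SubLalgebra_isSubAlgebra of invS by <:].

End Actions.

Section HomWH.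

Variables (F : fieldType) (gT : finGroupType) (G : {group gT}) (n : nat).
Variable W : mx_representation F G n.
Variables (U : lmodType F) (aU : gT -> U -> U).

Definition is_homWH (s : U -> {mpoly F[n]}) : Prop :=
  [/\ linear s,
      forall g u, g \in G -> s (aU g u) = actS W g (s u)
    & forall u, harmonic W (s u)].

Definition homWH_pred : {pred (U -> {mpoly F[n]})} :=
  [pred s | `[< is_homWH s >]].

Lemma homWH_submod_closed : submod_closed homWH_pred.
Proof.
split=> [|c s t /asboolP[sL sW sH] /asboolP[tL tW tH]]; apply/asboolP; split.
- by move=> a x y; rewrite /= scaler0 addr0.
- by move=> g u _; rewrite /= raddf0.
- by move=> u q _ _; rewrite /diffop big1 // => m _; rewrite raddf0 scaler0.
- move=> a x y; have E z : (c *: s + t) z = c *: s z + t z by [].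
  by rewrite !E sL tL !scalerDr !scalerA (mulrC c) addrACA.
- move=> g u Gg; have E z : (c *: s + t) z = c *: s z + t z by [].
  by rewrite !E sW // tW // linearP.
- move=> u q qW q0; have E z : (c *: s + t) z = c *: s z + t z by [].
  have dL : linear (diffop q).
    move=> a x y; rewrite /diffop scaler_sumr -big_split /=.
    by apply: eq_bigr => m _; rewrite linearP /= scalerDr !scalerA mulrC.
  by rewrite E dL sH // tH // scaler0 addr0.
Qed.

HB.instance Definition _ :=
  GRing.isSubmodClosed.Build F (U -> {mpoly F[n]}) homWH_pred
    homWH_submod_closed.

Record homWH := HomWH { homWH_val :> U -> {mpoly F[n]};
                        _ : homWH_val \in homWH_pred }.

HB.instance Definition _ := [isSub for homWH_val].
HB.instance Definition _ := [Choice of homWH by <:].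
HB.instance Definition _ := [SubChoice_isSubZmodule of homWH by <:].
HB.instance Definition _ := [SubZmodule_isSubLmodule of homWH by <:].

Lemma homWH_P (s : homWH) : is_homWH s.
Proof. exact/asboolP/(valP s). Qed.

End HomWH.

Section Derivations.

Variables (F : fieldType) (A : comAlgType F).

Definition is_derivation (t : A -> A) : Prop :=
  linear t /\ forall a b, t (a * b) = a * t b + t a * b.

Definition der_pred : {pred (A -> A)} := [pred t | `[< is_derivation t >]].

Lemma der_zmod_closed : zmod_closed der_pred.
Proof.
split=> [|s t /asboolP[sL sM] /asboolP[tL tM]]; apply/asboolP; split.
- by move=> a x y; rewrite /= scaler0 addr0.
- by move=> a b; rewrite /= mulr0 mul0r addr0.
- move=> a x y; have E z : (s - t) z = s z - t z by [].
  by rewrite !E sL tL scalerBr opprD addrACA.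
- move=> a b; have E z : (s - t) z = s z - t z by [].
  by rewrite !E sM tM mulrBr mulrBl opprD addrACA.
Qed.

HB.instance Definition _ :=
  GRing.isZmodClosed.Build (A -> A) der_pred der_zmod_closed.

Record der := Der { der_val :> A -> A; _ : der_val \in der_pred }.

HB.instance Definition _ := [isSub for der_val].
HB.instance Definition _ := [Choice of der by <:].
HB.instance Definition _ := [SubChoice_isSubZmodule of der by <:].

Lemma derP (t : der) : is_derivation t.
Proof. exact/asboolP/(valP t). Qed.

Lemma der_scale_subproof (a : A) (t : der) : (fun x => a * t x) \in der_pred.
Proof.
have [tL tM] := derP t; apply/asboolP; split=> [c x y|x y].
  by rewrite tL mulrDr scalerAr.
by rewrite tM mulrDr mulrCA !mulrA.
Qed.

Definition der_scale (a : A) (t : der) : der := Der (der_scale_subproof a t).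

Lemma der_scaleA a b t : der_scale a (der_scale b t) = der_scale (a * b) t.
Proof. by apply/val_inj/funext=> x /=; rewrite mulrA. Qed.

Lemma der_scale1 : left_id 1 der_scale.
Proof. by move=> t; apply/val_inj/funext=> x /=; rewrite mul1r. Qed.

Lemma der_scaleDr : right_distributive der_scale +%R.
Proof. by move=> a s t; apply/val_inj/funext=> x; rewrite /= -mulrDr. Qed.

Lemma der_scaleDl t : {morph der_scale^~ t : a b / a + b}.
Proof. by move=> a b; apply/val_inj/funext=> x; rewrite /= mulrDl. Qed.

HB.instance Definition _ :=
  GRing.Zmodule_isLmodule.Build A der der_scaleA der_scale1 der_scaleDr
    der_scaleDl.

End Derivations.

Section InvariantDerivations.

Variables (F : fieldType) (gT : finGroupType) (G : {group gT}) (n : nat).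
Variable W : mx_representation F G n.

Definition is_invDer (t : {mpoly F[n]} -> {mpoly F[n]}) : Prop :=
  forall g, g \in G -> forall p, actS W g (t (actS W g^-1%g p)) = t p.

Definition invDer_pred : {pred (der {mpoly F[n]})} :=
  [pred t | `[< is_invDer (der_val t) >]].

Lemma invDer_zmod_closed : zmod_closed invDer_pred.
Proof.
split=> [|s t /asboolP sW /asboolP tW]; apply/asboolP=> g Gg p.
  by rewrite /= raddf0.
have E z : (s - t) z = s z - t z by [].
by rewrite !E raddfB /= sW // tW.
Qed.

HB.instance Definition _ :=
  GRing.isZmodClosed.Build (der {mpoly F[n]}) invDer_pred invDer_zmod_closed.

Record invDer := InvDer { invDer_val :> der {mpoly F[n]};
                          _ : invDer_val \in invDer_pred }.

HB.instance Definition _ := [isSub for invDer_val].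
HB.instance Definition _ := [Choice of invDer by <:].
HB.instance Definition _ := [SubChoice_isSubZmodule of invDer by <:].

Lemma invDerP (t : invDer) : is_invDer t.
Proof. exact/asboolP/(valP t). Qed.

Lemma invDer_scale_subproof (a : invS W) (t : invDer) :
  invS_val a *: invDer_val t \in invDer_pred.
Proof.
have tW := invDerP t; apply/asboolP=> g Gg p.
have E z : (invS_val a *: invDer_val t) z = invS_val a * t z by [].
by rewrite !E rmorphM /= tW // (invS_predP _ _ (valP a)).
Qed.

Definition invDer_scale (a : invS W) (t : invDer) : invDer :=
  InvDer (invDer_scale_subproof a t).

Lemma invDer_scaleA a b t :
  invDer_scale a (invDer_scale b t) = invDer_scale (a * b) t.
Proof. by apply/val_inj; rewrite /= scalerA. Qed.

Lemma invDer_scale1 : left_id 1 invDer_scale.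
Proof. by move=> t; apply/val_inj; rewrite /= scale1r. Qed.

Lemma invDer_scaleDr : right_distributive invDer_scale +%R.
Proof. by move=> a s t; apply/val_inj; rewrite /= scalerDr. Qed.

Lemma invDer_scaleDl t : {morph invDer_scale^~ t : a b / a + b}.
Proof. by move=> a b; apply/val_inj; rewrite /= scalerDl. Qed.

HB.instance Definition _ :=
  GRing.Zmodule_isLmodule.Build (invS W) invDer invDer_scaleA invDer_scale1
    invDer_scaleDr invDer_scaleDl.

(* The degree [k] parts of Der(S,S)^W and Der(S^W,S^W). *)
Definition invDer_deg (k : int) (t : invDer) : Prop :=
  forall i p, S_ i p -> S_ (i + k) (t p).

Definition derInv_deg (k : int) (t : der (invS W)) : Prop :=
  forall i (p : invS W), S_ i (invS_val p) -> S_ (i + k) (invS_val (t p)).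

End InvariantDerivations.

Section Duality.

Variables (F : fieldType) (gT : finGroupType) (G : {group gT}) (n : nat).
Variable W : mx_representation F G n.+1.

Definition homV := homWH W (actV W).

Definition homVd := homWH W (actVd W).

(* A map with image in polynomial degree [e] has degree [e + 1] in [homV] and
   degree [e - 1] in [homVd]. *)
Definition homV_deg (k : int) (s : homV) : Prop := forall v, S_ (k - 1) (s v).

Definition homVd_deg (k : int) (f : homVd) : Prop :=
  forall xi, S_ (k + 1) (f xi).

Definition is_basis (E : lmodType F) (P : E -> Prop) (m : nat)
    (b : 'I_m -> E) : Prop :=
  (forall i, P (b i)) /\
  (forall x, P x -> exists! c : 'rV[F]_m, x = \sum_(i < m) c 0 i *: b i).

Definition has_dim (E : lmodType F) (P : E -> Prop) (m : nat) : Prop :=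
  exists b : 'I_m -> E, is_basis P b.

Definition degrees (d : n.+1.-tuple int) : Prop :=
  sorted <=%R d /\ forall k : int, has_dim (homV_deg k) (count_mem k d).

Definition codegrees (d : n.+1.-tuple int) : Prop :=
  sorted >=%R d /\ forall k : int, has_dim (homVd_deg k) (count_mem k d).

Definition duality_group : Prop :=
  exists d dd : n.+1.-tuple int,
    [/\ degrees d, codegrees dd
      & forall i, tnth d i + tnth dd i = tnth d ord_max].

Definition vV (i : 'I_n.+1) : 'rV[F]_n.+1 := delta_mx 0 i.

Definition vVd (i : 'I_n.+1) : 'cV[F]_n.+1 := delta_mx i 0.

(* The inclusion of [V^*] in [S]. *)
Definition linform (xi : 'cV[F]_n.+1) : {mpoly F[n.+1]} :=
  \sum_i xi i 0 *: 'X_i.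

Lemma linform_vVd i : linform (vVd i) = 'X_i.
Proof.
rewrite /linform (bigD1 i) //= mxE !eqxx scale1r big1 ?addr0 // => j /negPf ji.
by rewrite mxE ji scale0r.
Qed.

Lemma tilde_subproof (s : homV) :
  \sum_i linform (vVd i) * s (vV i) \in invS_pred W.
Proof.
apply/invS_predP=> g Gg; have [sL sW _] := homWH_P s.
have sE (I : finType) (c : I -> F) (u : I -> 'rV[F]_n.+1) :
    s (\sum_i c i *: u i) = \sum_i c i *: s (u i).
  have s0 : s 0 = 0.
    by have := sL (-1) 0 0; rewrite scaleN1r addr0 oppr0 scaleN1r addNr.
  elim/big_rec2: _ => [//|i y x _ <-]; exact: sL.
rewrite rmorph_sum /=.
transitivity (\sum_i \sum_j 'X_j * (W g j i *: s (actV W g (vV i)))).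
  apply: eq_bigr => i _; rewrite rmorphM /= linform_vVd sW // {1}/actS.
  rewrite comp_mpolyXU -tnth_nth tnth_mktuple mulr_suml.
  by apply: eq_bigr => j _; rewrite -scalerAl scalerAr.
rewrite exchange_big /=; apply: eq_bigr => j _.
rewrite linform_vVd -mulr_sumr -sE; congr (_ * s _).
rewrite /actV; transitivity (row j (W g) *m W g^-1%g).
  rewrite (row_sum_delta (row j (W g))) mulmx_suml.
  by apply: eq_bigr => i _; rewrite -scalemxAl mxE.
by rewrite -row_mul -repr_mxM ?groupV // mulgV repr_mx1 row1.
Qed.

Definition tilde (s : homV) : invS W := InvS (tilde_subproof s).

(* An invariant [p] is written [P(f_1, ..., f_n)]; the linear part of [P] is its
   projection from Sym(homV) onto homV, with coefficient [P@_U_(i)] on [f_i].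
   [P] is unique when the [f_i] are algebraically independent. *)
Definition basic_coef (f : 'I_n.+1 -> {mpoly F[n.+1]}) (i : 'I_n.+1)
    (p : {mpoly F[n.+1]}) : F :=
  (xget 0 [set P : {mpoly F[n.+1]} |
            P \mPo [tuple f j | j < n.+1] = p]%classic)@_U_(i).

Definition duality_pairing (s : homV) (f : homVd) : {mpoly F[n.+1]} :=
  \sum_i s (vV i) * f (vVd i).

Definition dualityD (sigma : 'I_n.+1 -> homV) (f : homVd) (s : homV) : F :=
  basic_coef (fun j => tilde (sigma j)) ord_max (duality_pairing s f).

(* [D] tensored with [S^W] is the [S^W]-linear map with this property: a map
   [f : V^* -> H] is identified with the derivation of [S] restricting to [f] on
   [V^*], and a linear form on [homV] with the derivation of [S^W] taking it as
   its values on the image of [homV] in [S^W]. *)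
Definition extends_D (sigma : 'I_n.+1 -> homV)
    (Phi : {linear invDer W -> der (invS W)}) : Prop :=
  forall (f : homVd) (t : invDer W), (forall xi, t (linform xi) = f xi) ->
  forall s : homV, Phi t (tilde s) = (dualityD sigma f s)%:A.

(* The target is Der(S^W,S^W)(m), whose part of degree [k] is
   Der(S^W,S^W)_(k - m). *)
Definition degree_preserving (m : int)
    (Phi : invDer W -> der (invS W)) : Prop :=
  forall k t, invDer_deg k t -> derInv_deg (k - m) (Phi t).

Definition graded_iso (m : int)
    (Phi : {linear invDer W -> der (invS W)}) : Prop :=
  degree_preserving m Phi /\
  exists Psi : {linear der (invS W) -> invDer W},
    [/\ cancel Phi Psi, cancel Psi Phi
      & forall k u, derInv_deg (k - m) u -> invDer_deg k (Psi u)].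

End Duality.

(* Main.v *)
Require Import Defs.
From HB Require Import structures.
From mathcomp Require Import all_boot all_order all_fingroup all_algebra.
From mathcomp Require Import mxrepresentation sesquilinear spectral.
From mathcomp Require Import cyclic separable cyclotomic bigenough boolp reals.
From mathcomp Require Import ring zify.
From mathcomp.real_closed Require Import complex.
From mathcomp Require classical_sets.
From mathcomp.multinomials Require Import ssrcomplements mpoly.

Set Implicit Arguments.
Unset Strict Implicit.
Unset Printing Implicit Defensive.

Import BigEnough Order.TTheory GRing.Theory Num.Theory.
Local Open Scope ring_scope.

(* The harmonics are the orthogonal complement of the Hilbert ideal for a
   W-invariant hermitian form on S, so S = H.S^W and equivariant maps into S are
   S^W-combinations of equivariant maps into H.  Euler's identity then shows that
   the f_j generate S^W, the nonvanishing of their Jacobian that they are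
   algebraically independent, and Chevalley's lemma that a homogeneous basis
   (phi_i) of Hom_W(V^*,H) is free over S^W.  Hence Der(S,S)^W is free on the
   phi_i, Der(S^W,S^W) is free on the d/df_j, and D (x) S^W is given by the scalar
   matrix c of the duality pairing; it is an isomorphism iff c is invertible.

   If c is invertible, it pairs degrees with codegrees since c_ij <> 0 forces
   d_i^* + d_j = d, so W is a duality group.  Conversely let W be a duality group
   and v a point where f_n = 1 and the other f_j vanish.  For degree reasons, c is
   the product of the matrices of values at v of the phi_i and of the sigma_j, and
   these are invertible as soon as v has trivial stabilizer.  If g <> 1 fixed v,
   then along some vector u <> 0 all invariants would have zero derivative at v.
   An invariant vector field interpolating v at v with zero derivative along u,
   averaged over the scalars by d-th roots of unity, has all its coefficients on
   the phi_i zero at v except on the scalar multiples of the Euler field, the only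
   phi_i of codegree 0 by Schur's lemma: its derivative along u would be u. *)

(** * Polynomials and constant coefficient operators *)

(** The apolar pairing of S with Sym(V) is bilinear and has no positivity over the complex numbers.
    A semilinear identification of S with Sym(V) turns it into a definite form for which
    multiplication is adjoint to differentiation; orthogonality to the Hilbert ideal is then
    harmonicity.

    There are as many f_j as coordinates, so their Jacobian matrix is square. The rank m of
    Hom_W(V^*,H), however, is not known beforehand: c is rectangular and its invertibility means a
    two-sided inverse. For a duality group, m is read off from the number of codegrees.

    Scaling by d-th roots of unity suits the point v because f_n has degree d and the other f_j
    vanish there: no invariant changes its value at v. The coefficient on phi_i is thus multiplied
    by powers with exponent d_i^*, and in a duality group 0 <= d_i^* = d - d_j < d, so averaging
    kills it at v unless d_i^* = 0. Since the coefficients are invariant, their derivatives along u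
    vanish at v, and the averaged field agrees there, to first order along u, with a multiple of the
    Euler field. *)

Section PolynomialBasics.

Variables (F : fieldType) (n : nat).
Implicit Types p q r : {mpoly F[n]}.

Lemma mpoly_ring_ind (P : {mpoly F[n]} -> Prop) :
  (forall c, P c%:MP) -> (forall i, P 'X_i) ->
  (forall p q, P p -> P q -> P (p + q)) ->
  (forall p q, P p -> P q -> P (p * q)) -> forall p, P p.
Proof.
move=> PC PX PD PM; elim/mpolyind=> [|c m p _ _ Pp]; first by rewrite -mpolyC0.
apply: PD Pp; rewrite -mul_mpolyC; apply: (PM) => //.
rewrite mpolyXE_id; elim/big_ind: _ => [||i _]; [exact: (PC) | exact: (PM) |].
by elim: (m i) => [|k IHk]; [rewrite expr0 -mpolyC1 | rewrite exprS; apply: PM].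
Qed.

Lemma diffop_linearl (p : {mpoly F[n]}) : linear (fun q : {mpoly F[n]} => diffop q p).
Proof.
(* The sum in [diffop] runs over the support of [q]; a range of monomials common to both arguments
   makes linearity termwise. *)
have E q k : (msize q <= k)%N ->
    diffop q p = \sum_(m : 'X_{1..n < k}) q@_m *: p^`M[m].
  move=> le_qk; set I : subFinType _ := 'X_{1..n < k}.
  rewrite /diffop (big_mksub I) ?msupp_uniq //=; first last.
    by move=> m /msize_mdeg_lt /leq_trans; apply.
  by rewrite big_rmcond //= => m /memN_msupp_eq0 ->; rewrite scale0r.
move=> c q r /=; pose_big_enough k.
  rewrite !(E _ k) // scaler_sumr -big_split /=; apply: eq_bigr => m _.
  by rewrite linearP /= scalerDl scalerA.
by close.
Qed.

Lemma diffop_linearr (q : {mpoly F[n]}) : linear (diffop q).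
Proof.
move=> a p r; rewrite /diffop scaler_sumr -big_split /=.
by apply: eq_bigr => m _; rewrite linearP /= scalerDr !scalerA mulrC.
Qed.

HB.instance Definition _ q :=
  GRing.isLinear.Build F {mpoly F[n]} {mpoly F[n]} _ (diffop q)
    (diffop_linearr q).

Lemma diffopDl q r p : diffop (q + r) p = diffop q p + diffop r p.
Proof. by have := diffop_linearl p 1 q r; rewrite !scale1r. Qed.

Lemma diffop0l p : diffop 0 p = 0.
Proof. by rewrite /diffop msupp0 big_nil. Qed.

Lemma diffopZl c q p : diffop (c *: q) p = c *: diffop q p.
Proof. by have := diffop_linearl p c q 0; rewrite diffop0l !addr0. Qed.

Lemma diffop_suml (I : Type) (s : seq I) (P : pred I) (q : I -> {mpoly F[n]}) p :
  diffop (\sum_(i <- s | P i) q i) p = \sum_(i <- s | P i) diffop (q i) p.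
Proof.
by apply: (big_morph (fun q => diffop q p)) => [q1 q2|];
  [apply: diffopDl | apply: diffop0l].
Qed.

Lemma diffopXm m p : diffop 'X_[m] p = p^`M[m].
Proof. by rewrite /diffop msuppX big_seq1 mcoeffX eqxx scale1r. Qed.

Lemma diffopX i p : diffop 'X_i p = p^`M(i).
Proof. by rewrite diffopXm mderivmU1m. Qed.

Lemma diffopC c p : diffop c%:MP p = c *: p.
Proof.
by rewrite -[c%:MP]mulr1 mul_mpolyC diffopZl -mpolyX0 diffopXm mderivm0m.
Qed.

(** Makes S a module over Sym(V): under the apolar pairing, differentiation by [q] is adjoint to
    multiplication by [q]. *)
Lemma diffopM q r p : diffop (q * r) p = diffop q (diffop r p).
Proof.
elim/mpoly_ring_ind: q r p => [c|i|q q' IHq IHq'|q q' IHq IHq'] r p.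
- by rewrite mul_mpolyC diffopZl diffopC.
- elim/mpolyind: r => [|c m r _ _ IHr].
    by rewrite mulr0 !diffop0l raddf0.
  rewrite mulrDr -scalerAr !diffopDl !diffopZl IHr linearP /=; congr (_ *: _ + _).
  by rewrite -mpolyXD !diffopXm addmC mderivmDm.
- by rewrite mulrDl !diffopDl IHq IHq'.
- by rewrite -mulrA !IHq IHq'.
Qed.

(** As a function on row vectors this is v |-> p(v A). The action on S is [lsub (W g)] and the one
    on Sym(V) substitutes a transposed inverse, so both are treated at once. *)
Definition lsub (A : 'M[F]_n) (p : {mpoly F[n]}) : {mpoly F[n]} :=
  p \mPo [tuple \sum_(j < n) A j i *: 'X_j | i < n].

Lemma lsub_is_linear A : linear (lsub A).
Proof. by move=> c p q; rewrite /lsub linearP. Qed.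

HB.instance Definition _ A :=
  GRing.isLinear.Build F {mpoly F[n]} {mpoly F[n]} _ (lsub A)
    (lsub_is_linear A).

Lemma lsub_is_multiplicative A : monoid_morphism (lsub A).
Proof. by split=> [|p q]; rewrite /lsub ?rmorph1 ?rmorphM. Qed.

HB.instance Definition _ A :=
  GRing.isMonoidMorphism.Build {mpoly F[n]} {mpoly F[n]} (lsub A)
    (lsub_is_multiplicative A).

Lemma lsubX A i : lsub A 'X_i = \sum_j A j i *: 'X_j.
Proof. by rewrite /lsub comp_mpolyXU -tnth_nth tnth_mktuple. Qed.

Lemma lsubC A c : lsub A c%:MP = c%:MP.
Proof. exact: comp_mpolyC. Qed.

Lemma lsub_mul A B p : lsub A (lsub B p) = lsub (A *m B) p.
Proof.
elim/mpoly_ring_ind: p => [c|i|p q IHp IHq|p q IHp IHq].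
- by rewrite !lsubC.
- rewrite !lsubX linear_sum /=.
  under eq_bigr do rewrite linearZ /= lsubX scaler_sumr.
  rewrite exchange_big /=; apply: eq_bigr => k _.
  by rewrite mxE scaler_suml; apply: eq_bigr => j _; rewrite scalerA mulrC.
- by rewrite !raddfD /= IHp IHq.
- by rewrite !rmorphM /= IHp IHq.
Qed.

Lemma lsub1 p : lsub 1%:M p = p.
Proof.
elim/mpoly_ring_ind: p => [c|i|p q IHp IHq|p q IHp IHq].
- by rewrite !lsubC.
- rewrite lsubX (bigD1 i) //= mxE eqxx scale1r big1 ?addr0 // => j /negPf ji.
  by rewrite mxE ji scale0r.
- by rewrite !raddfD /= IHp IHq.
- by rewrite !rmorphM /= IHp IHq.
Qed.

Lemma mderivXU (i j : 'I_n) : ('X_i : {mpoly F[n]})^`M(j) = (i == j)%:R%:MP.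
Proof.
rewrite mderivX mnm1E; case: eqVneq => [->|_]; last by rewrite scale0r mpolyC0.
rewrite scale1r -[RHS]/(1%:MP) mpolyC1 -mpolyX0; congr 'X_[_].
by apply/mnmP=> x; rewrite mnmBE mnm0E subnn.
Qed.

Lemma mderiv_lsub A i p :
  (lsub A p)^`M(i) = \sum_k A i k *: lsub A p^`M(k).
Proof.
elim/mpoly_ring_ind: p => [c|j|p q IHp IHq|p q IHp IHq].
- by rewrite lsubC mderivC big1 // => k _; rewrite mderivC raddf0 scaler0.
- rewrite lsubX raddf_sum /= (bigD1 i) //= big1 => [|k ki]; last first.
    by rewrite mderivZ mderivXU (negPf ki) mpolyC0 scaler0.
  rewrite [RHS](bigD1 j) //= [X in _ = _ + X]big1 => [|k kj]; last first.
    by rewrite mderivXU eq_sym (negPf kj) lsubC mpolyC0 scaler0.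
  by rewrite mderivZ !mderivXU !eqxx lsubC.
- rewrite raddfD /= mderivD IHp IHq -big_split /=.
  by apply: eq_bigr => k _; rewrite mderivD raddfD scalerDr.
- rewrite rmorphM /= mderivM IHp IHq mulr_suml mulr_sumr -big_split /=.
  apply: eq_bigr => k _.
  by rewrite mderivM raddfD /= !rmorphM scalerDr scalerAl scalerAr.
Qed.

(** The chain rule: the derivative of p(v A) along w is that of p along w A, and [A^T] induces this
    map of directions on Sym(V). *)
Lemma diffop_lsub A q p :
  diffop q (lsub A p) = lsub A (diffop (lsub A^T q) p).
Proof.
elim/mpoly_ring_ind: q p => [c|i|q r IHq IHr|q r IHq IHr] p.
- by rewrite lsubC !diffopC linearZ.
- rewrite diffopX mderiv_lsub lsubX diffop_suml raddf_sum.
  by apply: eq_bigr => k _; rewrite diffopZl diffopX mxE [RHS]linearZ.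
- by rewrite raddfD !diffopDl raddfD IHq IHr.
- by rewrite rmorphM !diffopM IHr IHq.
Qed.

End PolynomialBasics.

(** * Homogeneous components and the apolar pairing *)

Section Homogeneity.

Variables (F : fieldType) (n : nat).
Implicit Types p q r : {mpoly F[n]}.

Lemma mcoeff_pihomog (mf : measure n) d p m :
  (pihomog mf d p)@_m = if mf m == d then p@_m else 0.
Proof.
elim/mpolyind: p => [|c m' p _ _ IHp]; first by rewrite raddf0 mcoeff0 if_same.
rewrite linearP /= pihomogX !mcoeffD !mcoeffZ IHp mcoeffX.
case: (eqVneq m' m) => [->|neq].
  by case: (mf m == d); rewrite ?mcoeffX ?eqxx // mcoeff0 mulr0 addr0.
case: (mf m' == d); rewrite ?mcoeffX ?mcoeff0 ?(negPf neq) !mulr0;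
  by case: (mf m == d); rewrite ?add0r.
Qed.

Lemma pihomog_sum (mf : measure n) p :
  exists k, p = \sum_(d < k) pihomog mf d p.
Proof. by exists (mmeasure mf p); apply: pihomog_partitionE. Qed.

Lemma pihomog_eq0 (mf : measure n) p : (forall d, pihomog mf d p = 0) -> p = 0.
Proof.
by move=> p0; have [k ->] := pihomog_sum mf p; rewrite big1.
Qed.

Lemma pihomogMl d k p q : p \is k.-homog ->
  pihomog mdeg d (p * q) = if (k <= d)%N then p * pihomog mdeg (d - k) q else 0.
Proof.
move=> pk; have hom r (j e : nat) : r \is j.-homog ->
    pihomog mdeg e r = if j == e then r else 0.
  move=> rj; case: eqP => [<-|/eqP je]; first exact: pihomog_dE.
  exact: pihomog_ne0 rj.
have [l qE] := pihomog_sum mdeg q.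
rewrite [X in pihomog _ d (_ * X)]qE [X in pihomog _ (d - k) X]qE.
rewrite mulr_sumr !raddf_sum /= mulr_sumr; case: leqP => [kd|dk].
  apply: eq_bigr => j _.
  rewrite (hom _ _ _ (dhomogM pk (pihomogP mdeg j q))).
  rewrite (hom _ _ _ (pihomogP mdeg j q)).
  have -> : (j == d - k :> nat)%N = (k + j == d)%N.
    by rewrite -[in LHS](eqn_add2l k) subnKC.
  by case: eqP; rewrite ?mulr0.
rewrite big1 // => j _; rewrite (hom _ _ _ (dhomogM pk (pihomogP mdeg j q))).
by case: eqP => // e; rewrite -e ltnNge leq_addr in dk.
Qed.

Lemma pihomogM d p q :
  pihomog mdeg d (p * q) =
  \sum_(k < d.+1) pihomog mdeg k p * pihomog mdeg (d - k) q.
Proof.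
have [l pE] : exists l, p = \sum_(k < d.+1 + l) pihomog mdeg k p.
  by exists (mmeasure mdeg p); apply: pihomog_partitionE; rewrite leq_addl.
rewrite [X in pihomog _ d (X * _)]pE mulr_suml raddf_sum /= big_split_ord /=.
rewrite [X in _ + X]big1 ?addr0 => [|i _].
  apply: eq_bigr => i _; rewrite (pihomogMl _ _ (pihomogP mdeg i p)).
  by rewrite -ltnS ltn_ord.
by rewrite (pihomogMl _ _ (pihomogP _ _ p)) leqNgt ltnS leq_addr.
Qed.

Lemma comp_mpolyXm_homog k (mf : measure n) (t : n.-tuple {mpoly F[k]}) m :
  (forall i, tnth t i \is (mf U_(i)%MM).-homog) ->
  'X_[m] \mPo t \is (mf m).-homog.
Proof.
move=> ht; rewrite comp_mpolyX mfE; elim/big_rec2: _ => [|i d q _ hq].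
  exact: dhomog1.
by apply: dhomogM => //; rewrite mulnC; apply: dhomogMn.
Qed.

(** Serves twice: for linear substitutions, with [mdeg], and for substituting the basic invariants,
    with the j-th variable weighted by d_j. *)
Lemma pihomog_comp k (mf : measure n) (t : n.-tuple {mpoly F[k]}) d p :
  (forall i, tnth t i \is (mf U_(i)%MM).-homog) ->
  pihomog mdeg d (p \mPo t) = pihomog mf d p \mPo t.
Proof.
move=> ht; elim/mpolyind: p => [|c m p _ _ IHp]; first by rewrite !raddf0.
rewrite 2![in LHS]linearP /= IHp 2![in RHS]linearP /=; congr (_ *: _ + _).
have hX := comp_mpolyXm_homog m ht.
rewrite pihomogX; case: eqP => [<-|/eqP neq]; first exact: pihomog_dE.
by rewrite raddf0; apply: pihomog_ne0 hX.
Qed.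

Lemma pihomog_lsub (A : 'M[F]_n) d p :
  pihomog mdeg d (lsub A p) = lsub A (pihomog mdeg d p).
Proof.
apply: pihomog_comp => i; rewrite tnth_mktuple rpred_sum // => j _.
by rewrite rpredZ // dhomogX /= !mdeg1.
Qed.

Lemma lsub_homog (A : 'M[F]_n) d p : p \is d.-homog -> lsub A p \is d.-homog.
Proof. by rewrite !homog_piE pihomog_lsub => /eqP->. Qed.

Lemma mcoeff_diffop q p m :
  (diffop q p)@_m = \sum_(k <- msupp q)
    q@_k * (p@_(k + m) *+ (\prod_(i < n) ((k + m)%MM i) ^_ (k i))).
Proof.
rewrite /diffop raddf_sum /=; apply: eq_bigr => k _.
by rewrite mcoeffZ mcoeff_mderivm.
Qed.

Lemma pihomog_diffop k e q p : q \is k.-homog ->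
  pihomog mdeg e (diffop q p) = diffop q (pihomog mdeg (k + e) p).
Proof.
move=> /dhomogP qk; apply/mpolyP=> m; rewrite mcoeff_pihomog !mcoeff_diffop.
case: eqP => [me|/eqP me].
  rewrite big_seq [RHS]big_seq; apply: eq_bigr => j jq.
  by rewrite mcoeff_pihomog /= mdegD qk // me eqxx.
rewrite big_seq big1 // => j jq.
by rewrite mcoeff_pihomog /= mdegD qk // eqn_add2l (negPf me) mul0rn mulr0.
Qed.

(** The apolar (Fischer) pairing of S with Sym(V); in the monomial bases it is diagonal with
    factorial entries. *)
Definition apair p q : F := (diffop q p)@_0%MM.

Lemma apairE p q :
  apair p q = \sum_(m <- msupp q) q@_m * (p@_m *+ \prod_(i < n) (m i)`!).
Proof.
rewrite /apair mcoeff_diffop; apply: eq_bigr => m _.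
by rewrite addm0; congr (_ * (_ *+ _)); apply: eq_bigr => i _; rewrite ffactnn.
Qed.

Lemma apair_lsub A p q : apair (lsub A p) q = apair p (lsub A^T q).
Proof.
rewrite /apair diffop_lsub; move: (diffop _ _) => r.
elim/mpolyind: r => [|c m r _ _ IHr]; first by rewrite raddf0.
rewrite linearP /= !mcoeffD !mcoeffZ IHr; congr (_ * _ + _).
have := pihomog_lsub A 0 'X_[m]; rewrite pihomogX.
move/(congr1 (mcoeff 0%MM)); rewrite mcoeff_pihomog /= mdeg0 eqxx => ->.
rewrite mdeg_eq0 mcoeffX; case: eqP => [->|_]; last by rewrite raddf0 mcoeff0.
by rewrite mpolyX0 rmorph1 mcoeff1 eqxx.
Qed.

End Homogeneity.

(** * Evaluation and directional derivatives *)

Section Evaluation.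

Variables (F : fieldType) (n : nat).
Implicit Types (p q r : {mpoly F[n]}) (v u : 'rV[F]_n).

Definition ev p v : F := p.@[v 0].

Definition dirder p v u : F := \sum_i u 0 i * ev p^`M(i) v.

Lemma evC c v : ev c%:MP v = c. Proof. exact: mevalC. Qed.
Lemma evX i v : ev 'X_i v = v 0 i. Proof. exact: mevalXU. Qed.
Lemma evD p q v : ev (p + q) v = ev p v + ev q v. Proof. exact: mevalD. Qed.
Lemma evB p q v : ev (p - q) v = ev p v - ev q v. Proof. exact: mevalB. Qed.
Lemma evM p q v : ev (p * q) v = ev p v * ev q v. Proof. exact: mevalM. Qed.
Lemma evZ c p v : ev (c *: p) v = c * ev p v. Proof. exact: mevalZ. Qed.
Lemma ev0 v : ev 0 v = 0. Proof. exact: meval0. Qed.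
Lemma ev1 v : ev 1 v = 1. Proof. exact: meval1. Qed.

Lemma ev_sum (I : Type) (s : seq I) (P : pred I) (p : I -> {mpoly F[n]}) v :
  ev (\sum_(i <- s | P i) p i) v = \sum_(i <- s | P i) ev (p i) v.
Proof. exact: raddf_sum. Qed.

Lemma coef0_ev p : p@_0%MM = ev p 0.
Proof.
elim/mpoly_ring_ind: p => [c|i|q r IHq IHr|q r IHq IHr].
- by rewrite mcoeffC eqxx mulr1 evC.
- by rewrite mcoeffX mnm1_eq0 evX mxE.
- by rewrite mcoeffD IHq IHr evD.
- by rewrite evM -IHq -IHr -[LHS]/(mcoeff 0%MM (q * r)) rmorphM.
Qed.

Lemma ev_lsub A p v : ev (lsub A p) v = ev p (v *m A).
Proof.
rewrite /ev comp_mpoly_meval; apply: meval_eq => i.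
rewrite tnth_mktuple raddf_sum /= mxE; apply: eq_bigr => j _.
by rewrite mevalZ mevalXU mulrC.
Qed.

Lemma dirderD p q v u : dirder (p + q) v u = dirder p v u + dirder q v u.
Proof.
by rewrite -big_split; apply: eq_bigr => i _ /=; rewrite mderivD evD mulrDr.
Qed.

Lemma dirder0 v u : dirder 0 v u = 0.
Proof. by rewrite /dirder big1 // => i _; rewrite mderiv0 ev0 mulr0. Qed.

Lemma dirderZ c p v u : dirder (c *: p) v u = c * dirder p v u.
Proof.
by rewrite mulr_sumr; apply: eq_bigr => i _; rewrite mderivZ evZ mulrCA.
Qed.

Lemma dirder_sum (I : Type) (s : seq I) (P : pred I) (p : I -> {mpoly F[n]}) v u :
  dirder (\sum_(i <- s | P i) p i) v u = \sum_(i <- s | P i) dirder (p i) v u.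
Proof.
apply: (big_morph (fun p => dirder p v u)) => [p1 p2|]; last exact: dirder0.
exact: dirderD.
Qed.

Lemma dirderM p q v u :
  dirder (p * q) v u = dirder p v u * ev q v + ev p v * dirder q v u.
Proof.
rewrite mulr_suml mulr_sumr -big_split; apply: eq_bigr => i _ /=.
by rewrite mderivM evD !evM mulrDr mulrA mulrCA.
Qed.

Lemma dirderX k v u : dirder 'X_k v u = u 0 k.
Proof.
rewrite /dirder (bigD1 k) //= big1 => [|i /negPf ik].
  by rewrite mderivXU eqxx evC mulr1 addr0.
by rewrite mderivXU eq_sym ik evC mulr0.
Qed.

Lemma dirder_lsub A p v u : dirder (lsub A p) v u = dirder p (v *m A) (u *m A).
Proof.
rewrite /dirder; under eq_bigr do rewrite mderiv_lsub ev_sum mulr_sumr.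
rewrite exchange_big /=; apply: eq_bigr => k _.
rewrite mxE mulr_suml; apply: eq_bigr => i _.
by rewrite evZ ev_lsub mulrA.
Qed.

Lemma mderiv_comp k (t : k.-tuple {mpoly F[n]}) (P : {mpoly F[k]}) i :
  (P \mPo t)^`M(i) = \sum_j (P^`M(j) \mPo t) * (tnth t j)^`M(i).
Proof.
elim/mpoly_ring_ind: P => [c|j|P Q IHP IHQ|P Q IHP IHQ].
- by rewrite comp_mpolyC mderivC big1 // => j _; rewrite mderivC raddf0 mul0r.
- rewrite comp_mpolyXU -tnth_nth (bigD1 j) //= big1 => [|l lj].
    by rewrite mderivXU eqxx comp_mpolyC mul1r addr0.
  by rewrite mderivXU eq_sym (negPf lj) comp_mpolyC mul0r.
- rewrite raddfD /= mderivD IHP IHQ -big_split; apply: eq_bigr => j _ /=.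
  by rewrite mderivD raddfD mulrDl.
- rewrite rmorphM /= mderivM IHP IHQ mulr_suml mulr_sumr -big_split.
  apply: eq_bigr => j _ /=.
  by rewrite mderivM raddfD /= !rmorphM mulrDl mulrAC mulrA.
Qed.

End Evaluation.

(** * Spans of products and finite dimensionality *)

Section SpanBasics.

Variable (F : fieldType) (n : nat).
Implicit Types A B : {mpoly F[n]} -> Prop.

(** One predicate covers the Hilbert ideal, the S^W-span of the harmonics, and the ideals of S or
    S^W generated by finitely many invariants; only [A] and [B] vary. *)
Inductive prodspan A B : {mpoly F[n]} -> Prop :=
| prodspan0 : prodspan A B 0
| prodspanS a b p : A a -> B b -> prodspan A B p -> prodspan A B (a * b + p).

Lemma prodspan1 A B a b : A a -> B b -> prodspan A B (a * b).
Proof. by move=> Aa Bb; rewrite -[_ * _]addr0; apply: prodspanS => //; apply: prodspan0. Qed.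

Lemma prodspanD A B p q : prodspan A B p -> prodspan A B q -> prodspan A B (p + q).
Proof.
move=> Sp Sq; elim: Sp => [|a b r Aa Bb _ IH]; first by rewrite add0r.
by rewrite -addrA; apply: prodspanS.
Qed.

Lemma prodspan_sum A B (I : Type) (s : seq I) (P : pred I) (p : I -> {mpoly F[n]}) :
  (forall i, P i -> prodspan A B (p i)) -> prodspan A B (\sum_(i <- s | P i) p i).
Proof.
by move=> Sp; elim/big_ind: _ => [|x y|] //; [apply: prodspan0 | apply: prodspanD].
Qed.

Lemma prodspanM A B r p :
  (forall b, B b -> B (r * b)) -> prodspan A B p -> prodspan A B (r * p).
Proof.
move=> Br; elim=> [|a b q Aa Bb _ IH]; first by rewrite mulr0; apply: prodspan0.
by rewrite mulrDr mulrCA; apply: prodspanS => //; apply: Br.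
Qed.

(** Replaces the choice of a basis in a space given by a predicate: [P] will be orthogonality or
    linear independence, and [M] a dimension bound. *)
Lemma maximal_seq (E : Type) (P : seq E -> Prop) M :
  P [::] -> (forall s, P s -> (size s <= M)%N) ->
  exists2 s, P s & forall x, ~ P (x :: s).
Proof.
move=> P0 PM; pose Q k := `[< exists2 s, P s & size s = k >].
have Q0 : exists k, Q k by exists 0%N; apply/asboolP; exists [::].
have QM k : Q k -> (k <= M)%N by case/asboolP=> s Ps <-; apply: PM.
case: (ex_maxnP Q0 QM) => k /asboolP[s Ps sk] kmax; exists s => // x Pxs.
have /kmax : Q (size (x :: s)) by apply/asboolP; exists (x :: s).
by rewrite /= sk ltnn.
Qed.

Lemma linear_comb (E E' : lmodType F) (f : E -> E') (I : Type) (s : seq I)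
    (c : I -> F) (b : I -> E) :
  linear f -> f (\sum_(i <- s) c i *: b i) = \sum_(i <- s) c i *: f (b i).
Proof.
move=> fL; have f0 : f 0 = 0.
  by have := fL (-1) 0 0; rewrite scaleN1r addNr => ->; rewrite scaleN1r addNr.
by elim: s => [|j s IHs]; rewrite ?big_nil // !big_cons fL IHs.
Qed.

Lemma dependent_family (E : lmodType F) (T : finType) (L : T -> E -> F) k
    (b : 'I_k -> E) :
  (forall t, linear (L t : E -> F^o)) -> (#|T| < k)%N ->
  exists2 c : 'rV[F]_k, c != 0 & forall t, L t (\sum_i c 0 i *: b i) = 0.
Proof.
move=> Ll Tk; pose A := \matrix_(i < k, j < #|T|) L (enum_val j) (b i).
have Ak : kermx A != 0.
  apply/eqP=> A0; have := mxrank_ker A; rewrite A0 mxrank0 => /esym/eqP.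
  by rewrite subn_eq0 leqNgt (leq_ltn_trans (rank_leq_col A)).
have [i ci] : exists i, row i (kermx A) != 0.
  apply/existsP; apply: contraNT Ak => /existsPn ker0.
  by apply/eqP/row_matrixP=> i; rewrite row0; apply/eqP; rewrite -[_ == _]negbK ker0.
exists (row i (kermx A)) => // t.
have := mulmx_ker A => /(congr1 (fun M : 'M_(k, #|T|) => M i (enum_rank t))).
rewrite !mxE => AE; rewrite (linear_comb _ _ _ (Ll t)) -[RHS]AE; apply: eq_bigr => j _.
by rewrite !mxE enum_rankK.
Qed.

End SpanBasics.

(** * Harmonic decomposition *)

Section OrthogonalDecomposition.

Variables (C : numClosedFieldType) (E : lmodType C) (phi : E -> E -> C).
Hypothesis phi_linear : forall y, linear ((fun x => phi x y) : E -> C^o).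
Hypothesis phi_sym : forall x y, phi y x = (phi x y)^*.
Hypothesis phi_def : forall x, x != 0 -> phi x x != 0.
Variable U : E -> Prop.
Hypothesis U0 : U 0.
Hypothesis U_linear : forall c x y, U x -> U y -> U (c *: x + y).
Variable T : finType.
Variable L : T -> E -> C.
Hypothesis L_linear : forall t, linear (L t : E -> C^o).
Hypothesis L_inj : forall x, U x -> (forall t, L t x = 0) -> x = 0.

Let Ucomb (I : Type) (s : seq I) (c : I -> C) (b : I -> E) :
  (forall i, U (b i)) -> U (\sum_(i <- s) c i *: b i).
Proof.
by move=> Ub; elim: s => [|i s IHs]; rewrite ?big_nil ?big_cons //; apply: U_linear.
Qed.

(** The finitely many [L] separate the points of [U], so orthogonal lists in [U] have bounded
    length. With a maximal one, [x - pr x] must vanish for [x] in [U], as it would otherwise extend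
    the list; hence [p - pr p] is orthogonal to all of [U]. *)
Lemma orthogonal_decomposition p :
  exists2 y, U y & forall x, U x -> phi (p - y) x = 0.
Proof.
pose orth s := (forall i, (i < size s)%N -> U s`_i /\ s`_i != 0) /\
  (forall i j, (i < size s)%N -> (j < size s)%N -> i != j -> phi s`_i s`_j = 0).
have phiB x y z : phi (x - y) z = phi x z - phi y z.
  by have := phi_linear z (-1) y x; rewrite !scaleN1r [- y + x]addrC => ->; rewrite addrC.
have phi0l z : phi 0 z = 0 by rewrite -(subrr z) phiB subrr.
have bound s : orth s -> (size s <= #|T|)%N.
  case=> sU sO; rewrite leqNgt; apply/negP => lt_s.
  have [c c0 cE] := dependent_family (fun i : 'I_(size s) => s`_i) L_linear lt_s.
  have /L_inj-/(_ cE) c_eq0 : U (\sum_(i < size s) c 0 i *: s`_i).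
    by apply: Ucomb => i; have [] := sU i (ltn_ord i).
  case/eqP: c0; apply/rowP=> i; rewrite mxE; apply/eqP.
  have [_ /phi_def] := sU i (ltn_ord i); apply: contraTT => ci.
  have := congr1 (phi^~ s`_i) c_eq0.
  rewrite (linear_comb _ _ _ (phi_linear _)) (bigD1 i) //= big1 ?addr0.
    by rewrite phi0l => /eqP; rewrite mulf_eq0 (negPf ci) /= => ->.
  by move=> j ji; rewrite sO ?ltn_ord ?scaler0.
have orth0 : orth [::] by split.
have [s [sU sO] smax] := maximal_seq orth0 bound.
pose pr x := \sum_(i < size s) (phi x s`_i / phi s`_i s`_i) *: s`_i.
have prO x i : (i < size s)%N -> phi (x - pr x) s`_i = 0.
  move=> ilt; rewrite phiB (linear_comb _ _ _ (phi_linear _)).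
  rewrite (bigD1 (Ordinal ilt)) //= big1 ?addr0 => [|j ji]; last first.
    by rewrite (sO _ _ (ltn_ord j) ilt ji) scaler0.
  have [_ /phi_def si] := sU i ilt.
  by rewrite /GRing.scale /= divfK ?subrr.
have Upr x : U (pr x) by apply: Ucomb => i; have [] := sU i (ltn_ord i).
exists (pr p) => // x Ux.
have UB y z : U y -> U z -> U (y - z).
  by move=> Uy Uz; rewrite addrC -scaleN1r; apply: U_linear.
have /eqP xE : x - pr x == 0.
  apply/negPn/negP=> x0; apply: (smax (x - pr x)); split=> [[|i] ilt|].
  - by split=> //; apply: UB.
  - exact: sU.
  case=> [|i] [|j] //= ilt jlt ij; first exact: prO.
    by rewrite phi_sym prO ?conjC0.
  exact: sO.
rewrite phi_sym; move/eqP: xE; rewrite subr_eq0 => /eqP->.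
rewrite (linear_comb _ _ _ (phi_linear _)) big1 ?conjC0 // => i _.
by rewrite (phi_sym (p - pr p)) prO ?conjC0 ?scaler0.
Qed.

End OrthogonalDecomposition.

Section Harmonics.

Variables (C : numClosedFieldType) (gT : finGroupType) (G : {group gT}).
Variables (n : nat) (W : mx_representation C G n).
Implicit Types p q r : {mpoly C[n]}.

Lemma actSE g p : actS W g p = lsub (W g) p. Proof. by []. Qed.

Lemma actSymVE g q : actSymV W g q = lsub (W g^-1%g)^T q.
Proof.
rewrite /actSymV /lsub; congr (_ \mPo _); apply/eq_from_tnth=> i.
by rewrite !tnth_mktuple; apply: eq_bigr => j _; rewrite mxE.
Qed.

Lemma actSM g h p : g \in G -> h \in G ->
  actS W (g * h)%g p = actS W g (actS W h p).
Proof. by move=> Gg Gh; rewrite !actSE lsub_mul repr_mxM. Qed.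

Lemma actS1 p : actS W 1%g p = p.
Proof. by rewrite actSE repr_mx1 lsub1. Qed.

Lemma actSKV g : g \in G -> cancel (actS W g^-1%g) (actS W g).
Proof. by move=> Gg p; rewrite -actSM ?groupV // mulgV actS1. Qed.

Lemma lsub_coef0 (A : 'M[C]_n) p : (lsub A p)@_0%MM = p@_0%MM.
Proof. by rewrite !coef0_ev ev_lsub mul0mx. Qed.

Lemma invS_pihomog e p : p \in invS_pred W -> pihomog mdeg e p \in invS_pred W.
Proof.
move/invS_predP=> pW; apply/invS_predP=> g Gg.
by rewrite actSE -pihomog_lsub -actSE pW.
Qed.

Definition posinv p : Prop := p \in invS_pred W /\ p@_0%MM = 0.

Definition hilbert_ideal := prodspan posinv (fun _ => True).

Lemma hilbert_idealM r p : hilbert_ideal p -> hilbert_ideal (r * p).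
Proof. exact: prodspanM. Qed.

Lemma hilbert_idealZ c p : hilbert_ideal p -> hilbert_ideal (c *: p).
Proof. by rewrite -mul_mpolyC; apply: hilbert_idealM. Qed.

Lemma posinv_pihomog e p : posinv p -> posinv (pihomog mdeg e p).
Proof.
case=> pW p0; split; first exact: invS_pihomog.
by rewrite mcoeff_pihomog p0 if_same.
Qed.

Lemma hilbert_ideal_pihomog e p :
  hilbert_ideal p -> hilbert_ideal (pihomog mdeg e p).
Proof.
elim=> [|a b q aW _ _ IH]; first by rewrite raddf0; apply: prodspan0.
rewrite raddfD /=; apply: prodspanD => //; rewrite pihomogM.
by apply: prodspan_sum => k _; apply: prodspan1 => //; apply: posinv_pihomog.
Qed.

(* [K] is the matrix of a W-invariant hermitian form on [V].  It induces the
   semilinear ring isomorphism [dag] from [S] to [Sym(V)] below, for which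
   [apair p (dag q)] is a hermitian inner product on [S]. *)
Let K : 'M[C]_n := \sum_(h in G) (W h)^T *m map_mx Num.conj (W h).

Let K_equiv g : g \in G -> (W g^-1%g)^T *m K = K *m map_mx Num.conj (W g).
Proof.
move=> Gg; rewrite /K mulmx_sumr mulmx_suml.
rewrite (reindex_inj (mulIg g)) /=; apply: eq_big => h.
  by rewrite groupMr.
move=> Ghg; have Gh : h \in G by rewrite -(groupMr h Gg).
rewrite mulmxA -trmx_mul -repr_mxM ?groupV // mulgK.
by rewrite repr_mxM // map_mxM mulmxA.
Qed.

Let K_pos (w : 'rV[C]_n) : w != 0 -> 0 < (w *m K *m (map_mx Num.conj w)^T) 0 0.
Proof.
move=> w0.
have dot_ge0 (x : 'rV[C]_n) i : 0 <= x 0 i * (map_mx Num.conj x)^T i 0.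
  by rewrite !mxE mul_conjC_ge0.
have KE : (w *m K *m (map_mx Num.conj w)^T) 0 0 =
    \sum_(h in G) \sum_i (w *m (W h)^T) 0 i * (map_mx Num.conj (w *m (W h)^T))^T i 0.
  rewrite /K mulmx_sumr mulmx_suml summxE; apply: eq_bigr => h _.
  by rewrite map_mxM trmx_mul -map_trmx trmxK !mulmxA -mulmxA mxE.
rewrite {}KE (bigD1 1%g) //= ltr_wpDr ?sumr_ge0 // => [h _|]; first exact: sumr_ge0.
rewrite repr_mx1 trmx1 mulmx1.
have [i wi] : exists i, w 0 i != 0.
  apply/existsP; apply: contraNT w0 => /existsPn w0.
  by apply/eqP/rowP=> i; rewrite mxE; apply/eqP; rewrite -[_ == _]negbK w0.
rewrite (bigD1 i) //= ltr_wpDr ?sumr_ge0 //.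
by rewrite !mxE mul_conjC_gt0.
Qed.

(** In the coordinates given by [Q] the form [phi] becomes the standard one, whose symmetry and
    definiteness can be read off coefficients. *)
Let hermitian_sqrt : exists2 Q : 'M[C]_n, Q \in unitmx &
  K = Q^T *m map_mx Num.conj Q.
Proof.
have Kh : K \is hermsymmx.
  apply/is_hermitianmxP; rewrite expr0 scale1r -[RHS]/(map_mx Num.conj K^T).
  rewrite /K [X in map_mx _ X]raddf_sum map_mx_sum.
  apply: eq_bigr => h _; rewrite /= trmx_mul trmxK map_mxM /= -map_trmx.
  by congr (_ *m _); apply/matrixP=> i j; rewrite !mxE conjCK.
have KE := orthomx_spectralP (hermitian_normalmx Kh).
have Pu := spectral_unitarymx K.
move: (spectralmx K) (spectral_diag K) KE Pu => P D KE Pu.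
have PPt : P *m map_mx Num.conj P^T = 1%:M by apply/unitarymxP.
have Punit := unitarymx_unit Pu; rewrite (invmx_unitary Pu) in KE.
have DE i : D 0 i = (row i P *m K *m (map_mx Num.conj (row i P))^T) 0 0.
  have : P *m K *m (map_mx Num.conj P)^T = diag_mx D.
    by rewrite KE !mulmxA map_trmx PPt mul1mx -!mulmxA PPt mulmx1.
  move/(congr1 (fun M : 'M_n => M i i)); rewrite [X in _ = X]mxE eqxx mulr1n => <-.
  by rewrite -row_mul !mxE; apply: eq_bigr => j _; rewrite !mxE.
have D_gt0 i : 0 < D 0 i.
  rewrite DE; apply: K_pos; apply: contraTneq Punit => Pi0.
  apply/negP => /mulmxV; move/(congr1 (row i)); rewrite row_mul Pi0 mul0mx => /rowP/(_ i).
  by rewrite !mxE eqxx => /eqP; rewrite eq_sym oner_eq0.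
pose S : 'M[C]_n := diag_mx (\row_i sqrtC (D 0 i)).
have Sconj : map_mx Num.conj S = S.
  apply/matrixP=> i j; rewrite !mxE; case: eqP => [_|_]; last exact: conjC0.
  by rewrite !mulr1n; apply/CrealP; rewrite ger0_real // sqrtC_ge0 ltW.
have SS : S *m S = diag_mx D.
  rewrite /S mulmx_diag; congr diag_mx; apply/rowP=> i; rewrite !mxE.
  by rewrite -expr2 sqrtCK.
(* The spectral theorem gives [K] as the conjugate transpose of [S *m P] times [S *m P], so [Q] has
   to be the conjugate of [S *m P]. *)
exists (map_mx Num.conj (S *m P)).
  rewrite map_unitmx unitmx_mul Punit andbT unitmxE det_diag unitfE.
  by apply/prodf_neq0=> i _; rewrite mxE sqrtC_eq0 gt_eqF.
have -> : map_mx Num.conj (map_mx Num.conj (S *m P)) = S *m P.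
  by apply/matrixP=> i j; rewrite !mxE conjCK.
rewrite map_mxM Sconj trmx_mul tr_diag_mx -/S mulmxA -(mulmxA _ S S) SS.
by rewrite map_trmx.
Qed.

Let cj : {mpoly C[n]} -> {mpoly C[n]} := map_mpoly Num.conj.

Let cj_lsub (A : 'M[C]_n) p : cj (lsub A p) = lsub (map_mx Num.conj A) (cj p).
Proof.
rewrite /cj; elim/mpoly_ring_ind: p => [c|i|p q IHp IHq|p q IHp IHq].
- by rewrite lsubC !map_mpolyC lsubC.
- rewrite lsubX map_mpolyX lsubX raddf_sum; apply: eq_bigr => j _ /=.
  by rewrite map_mpolyZ map_mpolyX mxE.
- by rewrite !raddfD /= IHp IHq.
- by rewrite !rmorphM /= IHp IHq.
Qed.

Let cjK p : cj (cj p) = p.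
Proof. by apply/mpolyP=> m; rewrite !mcoeff_map_mpoly /= conjCK. Qed.

Let dag p := lsub K (cj p).

Let dagM p q : dag (p * q) = dag p * dag q.
Proof. by rewrite /dag /cj !rmorphM. Qed.

Let dagD p q : dag (p + q) = dag p + dag q.
Proof. by rewrite /dag /cj !raddfD. Qed.

Let dag_pihomog e p : pihomog mdeg e (dag p) = dag (pihomog mdeg e p).
Proof.
rewrite /dag pihomog_lsub; congr lsub; apply/mpolyP=> m.
by rewrite mcoeff_pihomog !mcoeff_map_mpoly /= mcoeff_pihomog; case: ifP; rewrite ?conjC0.
Qed.

Let dag_coef0 p : (dag p)@_0%MM = (p@_0%MM)^*.
Proof. by rewrite lsub_coef0 mcoeff_map_mpoly. Qed.

Let K_unit : K \in unitmx.
Proof.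
have [Q Qu ->] := hermitian_sqrt.
by rewrite unitmx_mul unitmx_tr Qu map_unitmx.
Qed.

Let dagi p := cj (lsub (invmx K) p).

Let dagiK p : dag (dagi p) = p.
Proof. by rewrite /dag /dagi cjK lsub_mul mulmxV ?lsub1. Qed.

Let dagK p : dagi (dag p) = p.
Proof. by rewrite /dag /dagi lsub_mul mulVmx ?lsub1 ?cjK. Qed.

Let dag_act g p : g \in G -> actSymV W g (dag p) = dag (actS W g p).
Proof.
move=> Gg; rewrite actSymVE /dag (lsub_mul (W g^-1%g)^T K) (K_equiv Gg).
by rewrite -lsub_mul -cj_lsub.
Qed.

Let dag_inv p : p \in invS_pred W -> forall g, g \in G -> actSymV W g (dag p) = dag p.
Proof. by move/invS_predP=> pW g Gg; rewrite dag_act // pW. Qed.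

Let dagi_inv q : (forall g, g \in G -> actSymV W g q = q) -> dagi q \in invS_pred W.
Proof.
move=> qW; apply/invS_predP=> g Gg; apply: (can_inj dagK).
by rewrite -dag_act // dagiK qW.
Qed.

Let apairD p q r : apair p (q + r) = apair p q + apair p r.
Proof. by rewrite /apair diffopDl mcoeffD. Qed.

Lemma apair_lin q : linear ((fun p => apair p q) : {mpoly C[n]} -> C^o).
Proof. by move=> c p r; rewrite /apair linearP mcoeffD mcoeffZ. Qed.

Let apairwE k p q : (msize q <= k)%N -> apair p q =
  \sum_(m : 'X_{1..n < k}) q@_m * (p@_m *+ \prod_(i < n) (m i)`!).
Proof.
move=> le_qk; set I : subFinType _ := 'X_{1..n < k}.
rewrite apairE (big_mksub I) ?msupp_uniq //=; first last.
  by move=> m /msize_mdeg_lt /leq_trans; apply.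
by rewrite big_rmcond //= => m /memN_msupp_eq0 ->; rewrite mul0r.
Qed.

Let msize_cj p : (msize (cj p) <= msize p)%N.
Proof.
rewrite !msizeE; apply/bigmax_leqP_seq => m; rewrite mcoeff_msupp mcoeff_map_mpoly /= conjC_eq0 => pm _.
by apply: leq_bigmax_seq; rewrite ?mcoeff_msupp.
Qed.

Let apair_cj_sym p q : apair q (cj p) = (apair p (cj q))^*.
Proof.
pose k := maxn (msize p) (msize q).
rewrite !(apairwE (k := k)) ?(leq_trans (msize_cj _)) ?leq_maxl ?leq_maxr //.
rewrite rmorph_sum; apply: eq_bigr => m _.
by rewrite !mcoeff_map_mpoly /= rmorphM rmorphMn /= conjCK mulrnAr mulrnAr mulrC.
Qed.

Let apair_cj_def p : p != 0 -> apair p (cj p) != 0.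
Proof.
move=> p0; rewrite (apairwE (k := msize p)) ?msize_cj //.
have ge0 (m : 'X_{1..n < msize p}) :
    0 <= (cj p)@_m * (p@_m *+ \prod_(i < n) (m i)`!).
  by rewrite mcoeff_map_mpoly /= mulrnAr mulrn_wge0 // mulrC mul_conjC_ge0.
rewrite psumr_neq0 => [|m _]; last exact: ge0.
have lt : (mdeg (mlead p) < msize p)%N by rewrite msize_mdeg_lt ?mlead_supp.
apply/hasP; exists (BMultinom lt); first by rewrite mem_index_enum.
have /= := ge0 (BMultinom lt); rewrite lt_neqAle => ->; rewrite andbT eq_sym mcoeff_map_mpoly /= mulrnAr mulrn_eq0 negb_or.
rewrite mulrC mul_conjC_eq0 mleadc_eq0 p0 andbT -lt0n prodn_gt0 // => i.
exact: fact_gt0.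
Qed.

Let phi p q := apair p (dag q).

Let phi_sqrt : exists2 Q, Q \in unitmx &
  forall p q, phi p q = apair (lsub Q p) (cj (lsub Q q)).
Proof.
have [Q Qu KE] := hermitian_sqrt; exists Q => // p q.
have E : dag q = lsub Q^T (cj (lsub Q q)) by rewrite cj_lsub lsub_mul -KE.
by rewrite apair_lsub -E.
Qed.

Let phi_sym p q : phi q p = (phi p q)^*.
Proof.
have [Q _ phiE] := phi_sqrt; rewrite !phiE; exact: apair_cj_sym.
Qed.

Let phi_def p : p != 0 -> phi p p != 0.
Proof.
have [Q Qu phiE] := phi_sqrt; rewrite phiE => p0; apply: apair_cj_def.
apply: contraNneq p0 => /(congr1 (lsub (invmx Q))).
by rewrite lsub_mul (mulVmx Qu) lsub1 raddf0 => ->.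
Qed.

(** Pairing [p] with a product a b applies [dag a] to [p] and then [dag b]; if [a] is invariant
    without constant term, the first operator already kills a harmonic [p]. *)
Let harmonic_phi p z : harmonic W p -> hilbert_ideal z -> phi p z = 0.
Proof.
move=> pH; elim=> [|a b q [aW a0] _ _ IH].
  by rewrite /phi /dag /cj raddf0 /= raddf0 /apair diffop0l mcoeff0.
rewrite /phi dagD apairD [X in _ + X]IH addr0 dagM mulrC /apair diffopM.
have -> : diffop (dag a) p = 0.
  by apply: pH; [apply: dag_inv | rewrite dag_coef0 a0 conjC0].
by rewrite raddf0 mcoeff0.
Qed.

Lemma harmonic_ideal_eq0 p : harmonic W p -> hilbert_ideal p -> p = 0.
Proof.
move=> pH pI; apply/eqP; apply: contraT => /phi_def.
by rewrite harmonic_phi ?eqxx.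
Qed.

Let apair_nondeg p : (forall r, apair p r = 0) -> p = 0.
Proof.
move=> p0; apply/eqP; apply: contraT => /apair_cj_def.
by rewrite p0 eqxx.
Qed.

Let apair_homog e p q : p \is e.-homog -> apair p q = apair p (pihomog mdeg e q).
Proof.
move=> /dhomogP pe; pose k := maxn (msize q) (msize (pihomog mdeg e q)).
rewrite !(apairwE (k := k)) ?leq_maxl ?leq_maxr //.
apply: eq_bigr => m _; rewrite mcoeff_pihomog.
case: eqP => // me; suff -> : p@_m = 0 by rewrite mul0rn !mulr0.
by apply/eqP; apply: contraT; rewrite -mcoeff_msupp => /pe.
Qed.

(** An orthogonal projection made inside a single degree, where the ideal is finite dimensional. *)
Lemma harmonic_decomposition e p : p \is e.-homog -> exists h z,
  [/\ p = h + z, harmonic W h, hilbert_ideal z, h \is e.-homog & z \is e.-homog].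
Proof.
move=> pe; pose U z := hilbert_ideal z /\ z \is e.-homog.
have Ulin c x y : U x -> U y -> U (c *: x + y).
  move=> [xI xe] [yI ye]; split; last by rewrite rpredD ?rpredZ.
  by apply: prodspanD => //; apply: hilbert_idealZ.
have U0 : U 0 by split; [apply: prodspan0 | rewrite rpred0].
pose L (m : 'X_{1..n < e.+1}) (z : {mpoly C[n]}) := z@_m.
have Llin m : linear (L m : {mpoly C[n]} -> C^o).
  by move=> c x y; rewrite /L mcoeffD mcoeffZ.
have Linj x : U x -> (forall m, L m x = 0) -> x = 0.
  move=> [_ /dhomogP xe] x0; apply/mpolyP=> m; rewrite mcoeff0; apply/eqP.
  apply: contraT; rewrite -mcoeff_msupp => mx.
  have lt : (mdeg m < e.+1)%N by rewrite (xe m mx).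
  by have := x0 (BMultinom lt); rewrite /L /= => /eqP; rewrite mcoeff_eq0 mx.
have phi_lin q : linear ((fun x => phi x q) : {mpoly C[n]} -> C^o).
  exact: apair_lin.
have [z [zI ze] zO] :=
  orthogonal_decomposition phi_lin phi_sym phi_def U0 Ulin Llin Linj p.
exists (p - z), z; have he : p - z \is e.-homog by rewrite rpredB.
split=> //; first by rewrite subrK.
(* [diffop q (p - z)] vanishes if its pairing with every [r] does, and that is the pairing of
   [p - z] with r q. Transported back by [dagi], r q lies in the Hilbert ideal, whose degree [e]
   part is orthogonal to [p - z]. *)
move=> q qW q0; apply: apair_nondeg => r.
rewrite /apair -diffopM -/(apair (p - z) (r * q)).
rewrite -(dagiK (r * q)); set x := dagi _.
have xE : x = dagi r * dagi q by rewrite /x /dagi /cj !rmorphM.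
have xI : hilbert_ideal x.
  rewrite xE; apply: hilbert_idealM; rewrite -[dagi q]mulr1.
  apply: prodspan1 => //; split; first exact: dagi_inv.
  by apply: (can_inj conjCK); rewrite -dag_coef0 dagiK q0 conjC0.
rewrite (apair_homog _ he) dag_pihomog; apply: zO; split; last exact: pihomogP.
exact: hilbert_ideal_pihomog.
Qed.

End Harmonics.

(** * S is spanned by the harmonics over the invariants *)

Section HarmonicSpan.

Variables (C : numClosedFieldType) (gT : finGroupType) (G : {group gT}).
Variables (n : nat) (W : mx_representation C G n).
Implicit Types p q r : {mpoly C[n]}.

Local Notation invSP := (fun a => a \in invS_pred W).

Lemma prodspan_inv a p :
  a \in invS_pred W -> prodspan invSP (harmonic W) p ->
  prodspan invSP (harmonic W) (a * p).
Proof.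
move=> aW; elim=> [|b h q bW hH _ IH]; first by rewrite mulr0; apply: prodspan0.
by rewrite mulrDr mulrA; apply: prodspanS => //; apply: rpredM.
Qed.

Lemma posinv_pihomog0 p : p@_0%MM = 0 -> pihomog mdeg 0 p = 0.
Proof.
move=> p0; apply/mpolyP=> m; rewrite mcoeff_pihomog mcoeff0 /= mdeg_eq0.
by case: eqP => // ->.
Qed.

Lemma harmonic_span p : prodspan invSP (harmonic W) p.
Proof.
have [k ->] := pihomog_sum mdeg p; apply: prodspan_sum => e _.
move: (nat_of_ord e) (pihomog _ e p) (pihomogP mdeg e p) => {k}e {}p.
elim/ltn_ind: e p => e IHe p pe.
(* [z] is rewritten as its own component of degree [e], so that each summand a b of its expression
   in the ideal is cut to that degree. As [a] has no constant term, only components of [b] of degree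
   below [e] occur. *)
have [h [z [-> hH zI _ /pihomog_dE <-]]] := harmonic_decomposition W pe.
apply: prodspanD.
  by rewrite -[h]mul1r; apply: prodspan1 => //; apply: rpred1.
elim: zI => [|a b q [aW a0] _ _ IH]; first by rewrite raddf0; apply: prodspan0.
rewrite raddfD /=; apply: prodspanD => //; rewrite pihomogM.
apply: prodspan_sum => -[[|k] ltk] _ /=.
  by rewrite (posinv_pihomog0 a0) mul0r; apply: prodspan0.
apply: prodspan_inv; first exact: invS_pihomog.
by apply: IHe (pihomogP _ _ _); rewrite ltn_subrL (leq_trans _ (ltnSE ltk)).
Qed.

Lemma harmonicZD c p r : harmonic W p -> harmonic W r -> harmonic W (c *: p + r).
Proof.
by move=> pH rH q qW q0; rewrite linearP /= pH // rH // scaler0 addr0.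
Qed.

Lemma harmonic_act g p : g \in G -> harmonic W p -> harmonic W (actS W g p).
Proof.
move=> Gg pH q qW q0; rewrite actSE diffop_lsub.
have -> : lsub (W g)^T q = q.
  by have := qW _ (groupVr Gg); rewrite actSymVE invgK.
by rewrite pH // raddf0.
Qed.

Lemma diffop_pihomog_eq0 k e q p : q \is k.-homog -> diffop q p = 0 ->
  diffop q (pihomog mdeg e p) = 0.
Proof.
move=> qk qp0; apply: (pihomog_eq0 (mf := mdeg)) => d.
rewrite (pihomog_diffop _ _ qk).
have [<-|ne] := eqVneq (k + d)%N e; last first.
  by rewrite (pihomog_ne0 _ (pihomogP _ e p)) ?raddf0 // eq_sym.
by rewrite pihomog_id -(pihomog_diffop _ _ qk) qp0 raddf0.
Qed.

Lemma harmonic_pihomog e p : harmonic W p -> harmonic W (pihomog mdeg e p).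
Proof.
move=> pH q qW q0; have [k ->] := pihomog_sum mdeg q.
rewrite diffop_suml big1 // => j _.
apply: (diffop_pihomog_eq0 _ (pihomogP mdeg j q)); apply: pH.
  by move=> g Gg; rewrite actSymVE -pihomog_lsub -actSymVE qW.
by rewrite mcoeff_pihomog q0 if_same.
Qed.

Lemma sum_act_inv p : \sum_(g in G) actS W g p \in invS_pred W.
Proof.
apply/invS_predP=> h Gh; rewrite raddf_sum [RHS](reindex_inj (mulgI h)) /=.
by apply: eq_big => [g|g Gg]; [rewrite groupMl | rewrite actSM].
Qed.

(** Monic with invariant coefficients and root [p]: S is integral over S^W. Applied to the
    variables, it bounds the degrees of harmonics and later makes the fibres of the basic invariants
    nonempty. *)
Definition orbit_poly p : {poly {mpoly C[n]}} :=
  \prod_(g in G) ('X - (actS W g p)%:P).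

Lemma orbit_poly_root p : (orbit_poly p).[p] = 0.
Proof.
have root0 (R : comNzRingType) (c : gT -> R) :
    (\prod_(g in G) ('X - (c g)%:P)).[c 1%g] = 0.
  by rewrite horner_prod (bigD1 1%g) //= hornerXsubC subrr mul0r.
have := root0 _ (fun g => actS W g p); cbv beta.
by rewrite actS1.
Qed.

Lemma map_orbit_poly (R : comNzRingType) (f : {rmorphism {mpoly C[n]} -> R}) p :
  map_poly f (orbit_poly p) = \prod_(g in G) ('X - (f (actS W g p))%:P).
Proof.
rewrite /orbit_poly rmorph_prod; apply: eq_bigr => g _.
by rewrite rmorphB /= map_polyX map_polyC.
Qed.

Lemma orbit_poly_inv p i : (orbit_poly p)`_i \in invS_pred W.
Proof.
apply/invS_predP=> h Gh.
have E : \prod_(g in G) ('X - (actS W h (actS W g p))%:P) = orbit_poly p.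
  rewrite /orbit_poly [RHS](reindex_inj (mulgI h)).
  apply: eq_big => [g|g Gg]; first by rewrite groupMl.
  by rewrite actSM.
by have := coef_map (actS W h) (orbit_poly p) i; rewrite map_orbit_poly E => <-.
Qed.

Lemma size_orbit_poly p : size (orbit_poly p) = #|G|.+1.
Proof.
rewrite /orbit_poly -big_enum /= -(big_map (fun g => actS W g p) predT (fun c => 'X - c%:P)).
by rewrite size_prod_XsubC size_map -cardE.
Qed.

Lemma orbit_poly_monic p : orbit_poly p \is monic.
Proof. by apply: rpred_prod => g _; apply: monicXsubC. Qed.

Lemma var_exp_ideal i : hilbert_ideal W ('X_i ^+ #|G|).
Proof.
pose P := orbit_poly ('X_i : {mpoly C[n]}).
have := orbit_poly_root ('X_i : {mpoly C[n]}); rewrite -/P horner_coef.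
rewrite size_orbit_poly big_ord_recr /=.
have -> : P`_#|G| = 1.
  by have /eqP := orbit_poly_monic 'X_i; rewrite lead_coefE size_orbit_poly.
rewrite mul1r addrC => /eqP; rewrite addr_eq0 => /eqP->.
rewrite -sumrN; apply: prodspan_sum => j _; rewrite -mulrN.
apply: prodspan1 => //; split; first exact: orbit_poly_inv.
(* At the origin every conjugate of ['X_i] vanishes, so all lower coefficients have zero constant
   term. *)
have E : map_poly (meval ((0 : 'rV[C]_n) 0)) P = 'X^#|G|.
  rewrite map_orbit_poly (eq_bigr (fun=> 'X)) ?prodr_const // => g _.
  have ev0 : ev (actS W g 'X_i) 0 = 0 by rewrite ev_lsub mul0mx evX mxE.
  by rewrite /= -/(ev (actS W g 'X_i) 0) ev0 polyC0 subr0.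
have := congr1 (fun Q : {poly C} => Q`_j) E; rewrite coef_map coefXn /=.
by rewrite (ltn_eqF (ltn_ord j)) coef0_ev.
Qed.

End HarmonicSpan.

(** * Equivariant maps *)

Section EquivariantMaps.

Variables (C : numClosedFieldType) (gT : finGroupType) (G : {group gT}).
Variables (n : nat) (W : mx_representation C G n).
Implicit Types p q : {mpoly C[n]}.

(** A monomial of degree above n |G| has some exponent of at least |G|, hence lies in the Hilbert
    ideal, which contains no nonzero harmonic. *)
Lemma harmonic_bound : exists M, forall p, harmonic W p -> (msize p <= M)%N.
Proof.
pose k := #|G|; have k_gt0 : (0 < k)%N := cardG_gt0 G.
have big_ideal m : (n * k < mdeg m)%N -> hilbert_ideal W 'X_[m].
  move=> lt_m; have /existsP[i lei] : [exists i, (k <= m i)%N].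
    apply: contraLR lt_m => /existsPn small; rewrite -leqNgt mdegE.
    rewrite -[X in (X * _)%N]card_ord -sum_nat_const leq_sum // => i _.
    by rewrite ltnW // ltnNge.
  have -> : m = (m - U_(i) *+ k + U_(i) *+ k)%MM.
    rewrite submK //; apply/mnm_lepP => j; rewrite mulmnE mnm1E.
    by case: eqP => [<-|_]; rewrite ?mul1n.
  by rewrite mpolyXD -mpolyXn; apply: hilbert_idealM; apply: var_exp_ideal.
exists (n * k).+1 => p pH; rewrite leqNgt; apply/negP => lt_p.
have p0 : p != 0 by apply: contraTneq lt_p => ->; rewrite mmeasure0.
pose e := mdeg (mlead p); have lt_e : (n * k < e)%N.
  by rewrite -ltnS /e (mlead_deg p0).
have /eqP : pihomog mdeg e p = 0.
  apply: (harmonic_ideal_eq0 (harmonic_pihomog e pH)).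
  rewrite pihomogE; apply: prodspan_sum => m /eqP me.
  by apply: hilbert_idealZ; apply: big_ideal; rewrite [mdeg m]me.
apply/negP; apply: contraNneq p0 => /(congr1 (mcoeff (mlead p))).
by rewrite mcoeff_pihomog eqxx mcoeff0 => /eqP; rewrite mleadc_eq0.
Qed.

Variables (U : lmodType C) (aU : gT -> U -> U).

Definition equivariant (t : U -> {mpoly C[n]}) : Prop :=
  linear t /\ forall g u, g \in G -> t (aU g u) = actS W g (t u).

Lemma homWH_equivariant (s : homWH W aU) : equivariant s.
Proof. by have [] := homWH_P s. Qed.

Lemma homWH_harmonic (s : homWH W aU) u : harmonic W (s u).
Proof. by have [] := homWH_P s. Qed.

Lemma equivariant_homWH t : equivariant t -> (forall u, harmonic W (t u)) ->
  exists s : homWH W aU, forall u, s u = t u.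
Proof.
move=> [tL tG] tH; have tP : t \in homWH_pred W aU by apply/asboolP.
by exists (HomWH tP).
Qed.

Lemma invS_val_linear : linear (@invS_val _ _ _ _ W).
Proof. by []. Qed.

Lemma homWH_ext (s t : homWH W aU) : (forall u, s u = t u) -> s = t.
Proof. by move=> st; apply/val_inj/funext. Qed.

Lemma homWH_comb (I : Type) (r : seq I) (c : I -> C) (b : I -> homWH W aU) u :
  (\sum_(i <- r) c i *: b i) u = \sum_(i <- r) c i *: b i u.
Proof. by apply: (linear_comb _ _ _ (f := fun s : homWH W aU => s u)). Qed.

Lemma homWH_pihomog d (s : homWH W aU) :
  exists t : homWH W aU, forall u, t u = pihomog mdeg d (s u).
Proof.
have [sL sG] := homWH_equivariant s.
apply: (equivariant_homWH (t := fun u => pihomog mdeg d (s u))) => [|u].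
  split=> [c u v|g u Gg]; first by rewrite sL linearP.
  by rewrite sG // actSE pihomog_lsub.
by apply: harmonic_pihomog; apply: homWH_harmonic.
Qed.

Variables (k : nat) (e : 'I_k -> U) (x : 'I_k -> U -> C).
Hypothesis aU_linear : forall g, linear (aU g).
Hypothesis aUM : forall g h u, g \in G -> h \in G -> aU (g * h)%g u = aU g (aU h u).
Hypothesis x_linear : forall i, linear (x i : U -> C^o).
Hypothesis xE : forall u, u = \sum_i x i u *: e i.

(** The Reynolds average, up to the factor |G|, of the rank one map u |-> l(u) q. *)
Definition avgmap (l : U -> C) q (u : U) : {mpoly C[n]} :=
  \sum_(g in G) l (aU g^-1%g u) *: actS W g q.

Lemma avgmap_equivariant l q : linear (l : U -> C^o) -> equivariant (avgmap l q).
Proof.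
move=> l_lin; split=> [c u v|h u Gh].
  rewrite scaler_sumr -big_split; apply: eq_bigr => g _ /=.
  by rewrite aU_linear l_lin scalerDl scalerA.
rewrite /avgmap raddf_sum /= (reindex_inj (mulgI h)) /=.
apply: eq_big => [g|g]; first by rewrite groupMl.
rewrite groupMl // => Gg; rewrite linearZ /= -actSM //.
by rewrite -aUM ?groupV ?groupM // invMg mulgKV.
Qed.

Lemma avgmap_harmonic l q u : harmonic W q -> harmonic W (avgmap l q u).
Proof.
move=> qH; rewrite /avgmap; elim/big_ind: _ => [|p r pH rH|g Gg].
- by move=> s _ _; rewrite raddf0.
- by rewrite -[p]scale1r; apply: harmonicZD.
- rewrite -[_ *: _]addr0; apply: harmonicZD; first exact: harmonic_act.
  by move=> s _ _; rewrite raddf0.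
Qed.

(** Averaging is S^W-linear in [q] and preserves harmonicity, so the claim passes from harmonic [q]
    to all of H.S^W, which is S. *)
Lemma avgmap_span l q : linear (l : U -> C^o) ->
  exists s : seq (invS W * homWH W aU),
    forall u, avgmap l q u = \sum_(y <- s) invS_val y.1 * y.2 u.
Proof.
move=> l_lin; elim: (harmonic_span W q) => [|a h p aW hH _ [s sE]].
  exists [::] => u; rewrite big_nil /avgmap big1 // => g _.
  by rewrite raddf0 scaler0.
have [t tE] := equivariant_homWH (avgmap_equivariant h l_lin)
  (fun u => avgmap_harmonic l u hH).
exists ((InvS aW, t) :: s) => u; rewrite big_cons /= tE -sE.
rewrite /avgmap mulr_sumr -big_split; apply: eq_bigr => g Gg /=.
rewrite raddfD /= rmorphM /= scalerDr scalerAr; congr (_ * _ + _).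
exact: (invS_predP _ _ aW).
Qed.

Lemma equivariant_span t : equivariant t ->
  exists s : seq (invS W * homWH W aU),
    forall u, t u = \sum_(y <- s) invS_val y.1 * y.2 u.
Proof.
move=> [tL tG].
(* [t] is its own average, and it is the sum of the rank one maps attached to the pairs [x i],
   [t (e i)]. *)
have tE u : t u = #|G|%:R^-1 *: \sum_i avgmap (x i) (t (e i)) u.
  rewrite exchange_big /= (eq_bigr (fun=> t u)) => [|g Gg].
    rewrite sumr_const -scaler_nat scalerA mulVf ?scale1r //.
    by rewrite pnatr_eq0 -lt0n cardG_gt0.
  have := linear_comb (index_enum 'I_k) (x^~ (aU g^-1%g u)) e tL.
  rewrite -xE tG ?groupV // => /(congr1 (actS W g)).
  by rewrite actSKV // raddf_sum => ->; apply: eq_bigr => i _; rewrite [RHS]linearZ.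
have [s sE] := choice (fun i => avgmap_span (t (e i)) (x_linear i)).
pose c : C := #|G|%:R^-1.
exists [seq (y.1, c *: y.2) | y <- flatten [seq s i | i <- enum 'I_k]] => u.
rewrite big_map big_flatten big_map big_enum /= tE scaler_sumr.
apply: eq_bigr => i _; rewrite sE scaler_sumr; apply: eq_bigr => y _ /=.
by rewrite scalerAr.
Qed.

Lemma equivariant_basis_span m (b : 'I_m -> homWH W aU) t :
  is_basis (fun _ => True) b -> equivariant t ->
  exists a : 'I_m -> invS W, forall u, t u = \sum_i invS_val (a i) * b i u.
Proof.
move=> [_ bspan] /equivariant_span[s sE].
have [c cE] : exists c : homWH W aU -> 'rV[C]_m,
    forall y, y = \sum_(i < m) c y 0 i *: b i.
  have Qex y : exists c : 'rV[C]_m, y = \sum_(i < m) c 0 i *: b i.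
    by have [c []] := bspan y I; exists c.
  by have [c cQ] := choice Qex; exists c.
exists (fun i => \sum_(y <- s) c y.2 0 i *: y.1) => u; rewrite sE.
under eq_bigr do rewrite [X in _ * homWH_val X _]cE homWH_comb mulr_sumr.
rewrite exchange_big /=; apply: eq_bigr => i _.
rewrite (linear_comb _ _ _ invS_val_linear) mulr_suml; apply: eq_bigr => y _.
by rewrite -scalerAr -scalerAl.
Qed.

(** A map into H is determined by finitely many coefficients of its values on the [e i], so free
    lists are bounded. A maximal one among lists of homogeneous maps spans, because homogeneous
    components of an equivariant harmonic map are again such maps. *)
Lemma homWH_graded_basis : exists m (b : 'I_m -> homWH W aU) (d : 'I_m -> nat),
  (forall i u, b i u \is (d i).-homog) /\ is_basis (fun _ => True) b.
Proof.
have [M HM] := harmonic_bound.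
pose isfree (r : seq (homWH W aU)) :=
  forall c : 'rV[C]_(size r), \sum_(i < size r) c 0 i *: r`_i = 0 -> c = 0.
pose homogeneous (s : homWH W aU) := exists d, forall u, s u \is d.-homog.
pose P r := (forall i, (i < size r)%N -> homogeneous r`_i) /\ isfree r.
pose L (z : 'I_k * 'X_{1..n < M}) (s : homWH W aU) : C := (s (e z.1))@_z.2.
have L_lin z : linear (L z : homWH W aU -> C^o).
  by move=> c s t; rewrite /L mcoeffD mcoeffZ.
have L_inj s : (forall z, L z s = 0) -> s = 0.
  move=> s0; apply: homWH_ext => u; have [sL _] := homWH_equivariant s.
  rewrite [u in LHS]xE (linear_comb _ _ _ sL) big1 // => i _.
  suff -> : s (e i) = 0 by rewrite scaler0.
  apply/mpolyP=> m; rewrite mcoeff0.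
  have [lt_m|le_m] := ltnP (mdeg m) M; first exact: (s0 (i, BMultinom lt_m)).
  apply: memN_msupp_eq0; apply: msize_mdeg_ge; apply: leq_trans le_m.
  by apply: HM; apply: homWH_harmonic.
have bound r : P r -> (size r <= #|{: 'I_k * 'X_{1..n < M}}|)%N.
  case=> _ rfree; rewrite leqNgt; apply/negP => lt_r.
  have [c c0 cE] := dependent_family (fun i : 'I_(size r) => r`_i) L_lin lt_r.
  by move/eqP: c0; apply; apply: rfree; apply: L_inj.
have P0 : P [::] by split=> // c _; apply/rowP=> -[].
have [r [rhom rfree] rmax] := maximal_seq P0 bound.
have [d dE] : exists d : 'I_(size r) -> nat,
    forall (i : 'I_(size r)) u, r`_i u \is (d i).-homog.
  pose Q (i : 'I_(size r)) d := forall u, r`_i u \is d.-homog.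
  by have [d dQ] := choice (P := Q) (fun i => rhom i (ltn_ord i)); exists d.
exists (size r), (fun i => r`_i), d; split=> //; split=> // s _.
have hom_span t : homogeneous t ->
    exists c : 'rV[C]_(size r), t = \sum_(i < size r) c 0 i *: r`_i.
  move=> th; have /not_andP[] := rmax t; first by case=> -[|i] //=; apply: rhom.
  case/existsNP => c /not_implyP[]; rewrite big_ord_recl /= => ct c0.
  have [c00|c00] := eqVneq (c 0 ord0) 0.
    case: c0; rewrite c00 scale0r add0r in ct.
    have c'0 : \row_(i < size r) c 0 (lift ord0 i) = 0.
      by apply: rfree; rewrite -[RHS]ct; apply: eq_bigr => l _; rewrite mxE.
    apply/rowP=> i; rewrite mxE; case: (unliftP ord0 i) => [j ->|-> //].
    by move/rowP: c'0 => /(_ j); rewrite !mxE.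
  exists (\row_i (- (c 0 ord0)^-1 * c 0 (lift ord0 i))).
  move/eqP: ct; rewrite addr_eq0 => /eqP /(congr1 ( *:%R (c 0 ord0)^-1)).
  rewrite scalerA mulVf // scale1r => ->; rewrite scalerN scaler_sumr -sumrN.
  by apply: eq_bigr => l _; rewrite mxE scalerA mulNr scaleNr.
have [c cE] : exists c : 'rV[C]_(size r), s = \sum_(i < size r) c 0 i *: r`_i.
  have [t tE] := choice (fun d => homWH_pihomog d s).
  have [c cE] : exists c : nat -> 'rV[C]_(size r),
      forall d, t d = \sum_(i < size r) c d 0 i *: r`_i.
    pose Q j (c : 'rV[C]_(size r)) := t j = \sum_(i < size r) c 0 i *: r`_i.
    have Qex j : exists c, Q j c.
      by apply: hom_span; exists j => u; rewrite tE pihomogP.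
    by have [c cQ] := choice Qex; exists c.
  exists (\sum_(j < M) c j); apply: homWH_ext => u.
  rewrite [LHS](@pihomog_partitionE _ _ mdeg M); last first.
    by apply: HM; apply: homWH_harmonic.
  under eq_bigr do rewrite -tE cE homWH_comb.
  rewrite exchange_big homWH_comb /=; apply: eq_bigr => i _.
  by rewrite summxE scaler_suml.
exists c; split=> // c' c'E; apply/eqP; rewrite -subr_eq0; apply/eqP; apply: rfree.
rewrite -[RHS](subrr s) {1}cE c'E -sumrB; apply: eq_bigr => i _.
by rewrite -scalerBl !mxE.
Qed.

End EquivariantMaps.

(** * Basic invariants *)

Section Interpolation.

Variables (C : numClosedFieldType) (n : nat).
Implicit Types (p q : {mpoly C[n]}) (v w u : 'rV[C]_n).

Lemma separate_points v (s : seq 'rV[C]_n) : v \notin s ->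
  exists2 h : {mpoly C[n]}, ev h v = 1 & forall w, w \in s -> ev h w = 0.
Proof.
elim: s => [_|w s IHs]; first by exists 1; rewrite ?ev1.
rewrite inE negb_or => /andP[vw /IHs[h hv hs]].
have [i vwi] : exists i, v 0 i - w 0 i != 0.
  apply/existsP; apply: contraNT vw => /existsPn vw0.
  apply/eqP/rowP=> i; apply/eqP; rewrite -subr_eq0.
  by rewrite -[_ == _]negbK vw0.
exists ((v 0 i - w 0 i)^-1 *: ('X_i - (w 0 i)%:MP) * h) => [|x].
  by rewrite evM evZ evB evX evC hv mulr1 mulVf.
rewrite evM inE => /predU1P[->|/hs->]; last by rewrite mulr0.
by rewrite evZ evB evX evC subrr mulr0 mul0r.
Qed.

(* 3 h^2 - 2 h^3 has differential 6 h (1 - h) dh. *)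
Lemma hermite_points v (s : seq 'rV[C]_n) : v \notin s ->
  exists q : {mpoly C[n]},
    [/\ ev q v = 1, forall u, dirder q v u = 0 &
        forall w, w \in s -> ev q w = 0 /\ forall u, dirder q w u = 0].
Proof.
move=> /separate_points[h hv hs]; exists (h * h * (3 *: 1 - 2 *: h)).
have evE w : ev (h * h * (3 *: 1 - 2 *: h)) w =
    ev h w * ev h w * (3 - 2 * ev h w).
  by rewrite !evM evB !evZ ev1 mulr1.
have d1 w u : dirder 1 w u = 0.
  by rewrite /dirder big1 // => i _; rewrite -mpolyC1 mderivC ev0 mulr0.
have dE w u : dirder (h * h * (3 *: 1 - 2 *: h)) w u =
    6 * ev h w * (1 - ev h w) * dirder h w u.
  rewrite dirderM dirderM -scaleNr dirderD !dirderZ d1 mulr0 add0r.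
  rewrite !evM scaleNr evB !evZ ev1 mulr1; move: (ev h w) (dirder h w u) => a b.
  by ring.
split=> [|u|w /hs hw]; first by rewrite evE hv !mul1r mulr1 -natrB.
  by rewrite dE hv subrr mulr0 mul0r.
by split=> [|u]; rewrite ?evE ?dE hw ?mulr0 !mul0r.
Qed.

End Interpolation.

Section Actions.

Variables (C : numClosedFieldType) (gT : finGroupType) (G : {group gT}).
Variables (n : nat) (W : mx_representation C G n).
Implicit Types (v w u : 'rV[C]_n).

Lemma actV_linear g : linear (actV W g).
Proof. by move=> c u v; rewrite /actV mulmxDl -scalemxAl. Qed.

Lemma actVM g h v : g \in G -> h \in G -> actV W (g * h)%g v = actV W g (actV W h v).
Proof. by move=> Gg Gh; rewrite /actV invMg repr_mxM ?groupV // mulmxA. Qed.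

Lemma actVd_linear g : linear (actVd W g).
Proof. by move=> c u v; rewrite /actVd mulmxDr -scalemxAr. Qed.

Lemma actVdM g h x :
  g \in G -> h \in G -> actVd W (g * h)%g x = actVd W g (actVd W h x).
Proof. by move=> Gg Gh; rewrite /actVd repr_mxM // mulmxA. Qed.

(* The curve (1, t, t^2, ...) meets each proper subspace ker (W g - 1) in finitely
   many points. *)
Lemma regular_point : mx_faithful W ->
  exists v, forall g, g \in G -> v *m W g = v -> g = 1%g.
Proof.
move=> Wf; pose x (t : C) : 'rV[C]_n := \row_i t ^+ i.
have xP g : exists p : {poly C}, g \in G -> g != 1%g ->
    p != 0 /\ forall t, x t *m W g = x t -> root p t.
  have [Gg|] := boolP (g \in G); last by exists 0.
  have [_|g1] := eqVneq g 1%g; first by exists 0.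
  have [j [i ij]] : exists j, exists i, (W g - 1%:M) i j != 0.
    apply: contrapT => Wg1; case/eqP: g1.
    apply/set1P; apply: (subsetP Wf); rewrite inE Gg mul1mx.
    apply/eqP/matrixP=> i j; apply/eqP; rewrite -subr_eq0; apply: contraT => ij.
    by case: Wg1; exists j, i; rewrite mxE [X in _ + X]mxE.
  pose c k := if insub k is Some i' then (W g - 1%:M) i' j else 0.
  exists (\poly_(k < n) c k) => _ _; split=> [|t xg].
    apply: contraNneq ij => /polyP/(_ i); rewrite coef_poly ltn_ord coef0 /c.
    by rewrite valK => ->.
  have E : (x t *m (W g - 1%:M)) 0 j = 0.
    by rewrite mulmxBr mulmx1 xg subrr mxE.
  rewrite /root horner_poly -[X in _ == X]E mxE; apply/eqP.
  by apply: eq_bigr => k _; rewrite /c valK mulrC [x t 0 k]mxE.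
have [p pP] := choice xP.
have /closed_nonrootP[t tP] : \prod_(g in G | g != 1%g) p g != 0.
  by apply/prodf_neq0 => g /andP[Gg g1]; have [] := pP g Gg g1.
exists (x t) => g Gg xg; apply/eqP; apply: contraNT tP => g1.
have [_ /(_ t xg) pg] := pP g Gg g1.
by rewrite (bigD1 g) ?Gg //= rootM pg.
Qed.

End Actions.

Section BasicInvariants.

Variables (C : numClosedFieldType) (gT : finGroupType) (G : {group gT}).
Variables (n : nat) (W : mx_representation C G n.+1).
Implicit Types (p q : {mpoly C[n.+1]}).

Lemma coordV_linear i : linear ((fun v : 'rV[C]_n.+1 => v 0 i) : _ -> C^o).
Proof. by move=> c u v; rewrite !mxE. Qed.

Lemma coordVd_linear i : linear ((fun v : 'cV[C]_n.+1 => v i 0) : _ -> C^o).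
Proof. by move=> c u v; rewrite !mxE. Qed.

Lemma rV_coordE (v : 'rV[C]_n.+1) : v = \sum_i v 0 i *: vV C i.
Proof. exact: row_sum_delta. Qed.

Lemma cV_coordE (x : 'cV[C]_n.+1) : x = \sum_i x i 0 *: vVd C i.
Proof.
rewrite {1}[x]matrix_sum_delta; apply: eq_bigr => i _.
by rewrite big_ord1.
Qed.

Definition homV_span m (b : 'I_m -> homV W) t :=
  @equivariant_basis_span _ _ _ _ W _ (actV W) _ _ _ (actV_linear W)
    (@actVM _ _ _ _ W) coordV_linear rV_coordE m b t.

Definition homVd_span m (b : 'I_m -> homVd W) t :=
  @equivariant_basis_span _ _ _ _ W _ (actVd W) _ _ _ (actVd_linear W)
    (@actVdM _ _ _ _ W) coordVd_linear cV_coordE m b t.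

Definition homVd_graded_basis :=
  @homWH_graded_basis _ _ _ _ W _ (actVd W) _ _ _ cV_coordE.

Lemma tildeE (s : homV W) : invS_val (tilde s) = \sum_i 'X_i * s (vV C i).
Proof. by apply: eq_bigr => i _; rewrite linform_vVd. Qed.

Lemma tilde_linear : linear (@tilde _ _ _ _ W).
Proof.
move=> c s t; apply: val_inj.
rewrite -[LHS]/(invS_val _) -[RHS]/(c *: invS_val (tilde s) + invS_val (tilde t)).
rewrite !tildeE scaler_sumr -big_split.
by apply: eq_bigr => i _ /=; rewrite mulrDr scalerAr.
Qed.

Lemma euler_identity e p : p \is e.-homog ->
  \sum_i 'X_i * p^`M(i) = e%:R *: p.
Proof.
move=> /dhomogP pe.
have E m : \sum_i 'X_i * ('X_[m] : {mpoly C[n.+1]})^`M(i) = (mdeg m)%:R *: 'X_[m].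
  rewrite mdegE natr_sum scaler_suml; apply: eq_bigr => i _.
  rewrite mderivX -scalerAr -mpolyXD; case: (posnP (m i)) => [->|mi].
    by rewrite !scale0r.
  by congr (_ *: 'X_[_]); rewrite addmC submK // lep1mP -lt0n.
rewrite [p in RHS]mpolyE [in LHS](mpolyE p).
under eq_bigr do rewrite raddf_sum mulr_sumr.
rewrite exchange_big scaler_sumr big_seq [RHS]big_seq.
apply: eq_bigr => m mp; rewrite scalerA mulrC -scalerA -(pe m mp) -E scaler_sumr.
by apply: eq_bigr => i _; rewrite /= mderivZ scalerAr.
Qed.

Lemma gradient_equivariant p : p \in invS_pred W ->
  equivariant W (actV W) (fun v => \sum_i v 0 i *: p^`M(i)).
Proof.
move=> /invS_predP pW; split=> [c u v|g v Gg].
  rewrite scaler_sumr -big_split; apply: eq_bigr => i _ /=.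
  by rewrite !mxE scalerDl scalerA.
have dp i : p^`M(i) = \sum_k W g i k *: actS W g p^`M(k).
  by rewrite -{1}(pW g Gg) actSE mderiv_lsub.
under eq_bigr do rewrite dp scaler_sumr.
rewrite exchange_big raddf_sum /=; apply: eq_bigr => k _.
rewrite [RHS]linearZ /=; under eq_bigr do rewrite scalerA.
rewrite -scaler_suml; congr (_ *: _).
transitivity ((actV W g v *m W g) 0 k); first by rewrite mxE.
by rewrite /actV -mulmxA -repr_mxM ?groupV // mulVg repr_mx1 mulmx1.
Qed.

Variable sigma : 'I_n.+1 -> homV W.
Hypothesis sigma_basis : is_basis (fun _ => True) sigma.
Variable ds : 'I_n.+1 -> nat.
Hypothesis sigma_homog : forall j v, sigma j v \is (ds j).-homog.

Definition basic_invariants : n.+1.-tuple {mpoly C[n.+1]} :=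
  [tuple invS_val (tilde (sigma j)) | j < n.+1].

Local Notation f := basic_invariants.

Lemma tnth_basic j : tnth f j = invS_val (tilde (sigma j)).
Proof. exact: tnth_mktuple. Qed.

Lemma tilde_coef0 (s : homV W) : (invS_val (tilde s))@_0%MM = 0.
Proof.
rewrite coef0_ev tildeE ev_sum big1 // => i _.
by rewrite evM evX mxE mul0r.
Qed.

Lemma tilde_homog j : tnth f j \is (ds j).+1.-homog.
Proof.
rewrite tnth_basic tildeE rpred_sum // => i _.
rewrite -(add1n (ds j)); apply: dhomogM; last exact: sigma_homog.
by rewrite dhomogX /= mdeg1.
Qed.

(** The differential of [p] is an equivariant map from V to S. Expanding it in the [sigma j] and
    contracting with the coordinates turns each [sigma j] into f_j. *)
Lemma invS_tilde_span p : p \in invS_pred W -> exists b : 'I_n.+1 -> invS W,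
  \sum_i 'X_i * p^`M(i) = \sum_j invS_val (b j) * tnth f j.
Proof.
move=> pW; have [b bE] := homV_span sigma_basis (gradient_equivariant pW).
exists b; transitivity (\sum_i 'X_i * \sum_j invS_val (b j) * sigma j (vV C i)).
  apply: eq_bigr => i _; rewrite -bE (bigD1 i) //= big1 => [|k /negPf ki].
    by rewrite mxE !eqxx scale1r addr0.
  by rewrite mxE eqxx /= ki scale0r.
under eq_bigr do rewrite mulr_sumr.
rewrite exchange_big; apply: eq_bigr => j _.
rewrite tnth_basic tildeE mulr_sumr; apply: eq_bigr => i _.
by rewrite mulrCA.
Qed.

Lemma basic_invariants_generate p : p \in invS_pred W ->
  exists P : {mpoly C[n.+1]}, P \mPo f = p.
Proof.
pose gen q := exists P : {mpoly C[n.+1]}, P \mPo f = q.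
have gen0 : gen 0 by exists 0; rewrite raddf0.
have genD q r : gen q -> gen r -> gen (q + r).
  by move=> [P <-] [Q <-]; exists (P + Q); rewrite raddfD.
have genM q r : gen q -> gen r -> gen (q * r).
  by move=> [P <-] [Q <-]; exists (P * Q); rewrite rmorphM.
have genS (I : Type) (s : seq I) (P : pred I) (r : I -> {mpoly C[n.+1]}) :
    (forall i, P i -> gen (r i)) -> gen (\sum_(i <- s | P i) r i).
  by move=> rgen; elim/big_ind: _.
have genf j : gen (tnth f j).
  by exists 'X_j; rewrite comp_mpolyXU -tnth_nth.
suff hom e r : r \is e.-homog -> r \in invS_pred W -> gen r.
  move=> pW; have [k ->] := pihomog_sum mdeg p; apply: (genS) => e _.
  by apply: hom (pihomogP mdeg e p) _; apply: invS_pihomog.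
elim/ltn_ind: e r => -[|e] IHe r re rW.
  exists (r@_0%MM)%:MP; rewrite comp_mpolyC; apply/mpolyP=> m; rewrite mcoeffC.
  case: eqP => [->|/eqP m0]; first by rewrite mulr1.
  by rewrite mulr0 (dhomog_nemf_coeff re) ?[mdeg m == _]mdeg_eq0.
have [b bE] := invS_tilde_span rW.
(* Euler's identity divided by the degree. Cutting to degree e + 1 leaves coefficients of the f_j of
   degree at most [e]. *)
have -> : r = (e.+1%:R^-1)%:MP * pihomog mdeg e.+1 (\sum_j invS_val (b j) * tnth f j).
  rewrite -bE (euler_identity re) linearZ /= (pihomog_dE re) mul_mpolyC scalerA.
  by rewrite mulVf ?scale1r // pnatr_eq0.
apply: (genM); first by exists (e.+1%:R^-1)%:MP; rewrite comp_mpolyC.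
rewrite raddf_sum; apply: (genS) => j _ /=.
suff : gen (pihomog mdeg e.+1 (tnth f j * invS_val (b j))) by rewrite mulrC.
rewrite pihomogM; apply: (genS) => k _; have [->|kd] := eqVneq (k : nat) (ds j).+1; last first.
  by rewrite (pihomog_ne0 _ (tilde_homog j)) 1?eq_sym // mul0r.
rewrite (pihomog_dE (tilde_homog j)); apply: (genM) => //.
apply: (IHe (e.+1 - (ds j).+1)%N); first by rewrite subSS ltnS leq_subr.
  exact: pihomogP.
by apply: invS_pihomog; apply: valP.
Qed.

Hypothesis W_faithful : mx_faithful W.

(* Averaging Hermite interpolants at a regular point yields invariants with
   prescribed differential at that point. *)
Lemma jacobian_neq0 : \det (\matrix_(i, j) (tnth f j)^`M(i)) != 0.
Proof.
have [v v_reg] := regular_point W_faithful.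
pose s := [seq v *m W g | g <- enum (G :\ 1%g)].
have vs : v \notin s.
  apply/mapP=> -[g]; rewrite mem_enum !inE => /andP[g1 Gg] /esym vg.
  by case/eqP: g1; apply: v_reg.
have [q [qv dqv qs]] := hermite_points vs.
pose p k : {mpoly C[n.+1]} := \sum_(g in G) actS W g (q * 'X_k).
have dp k u : dirder (p k) v u = u 0 k.
  rewrite /p dirder_sum (bigD1 1%g) //= big1 => [|g /andP[Gg g1]].
    by rewrite actS1 dirderM qv dqv dirderX mul0r mul1r add0r addr0.
  rewrite actSE dirder_lsub dirderM.
  have /qs[-> ->] : v *m W g \in s.
    by apply/mapP; exists g => //; rewrite mem_enum !inE g1.
  by rewrite !mul0r addr0.
have [P PE] := choice (fun k => basic_invariants_generate (sum_act_inv W (q * 'X_k))).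
pose J := \matrix_(i, j) (tnth f j)^`M(i).
(* The chain rule for [p k], a polynomial in the f_j whose differential at [v] is that of the k-th
   coordinate. *)
have Jev : map_mx (meval (v 0)) J *m
    (\matrix_(j, k) ev ((P k)^`M(j) \mPo f) v) = 1%:M.
  apply/matrixP=> i k; rewrite !mxE.
  have := dp k (delta_mx 0 i); rewrite /p -PE mxE eqxx /= eq_sym => <-.
  rewrite /dirder [RHS](bigD1 i) //= [X in _ = _ + X]big1 => [|l /negPf li].
    rewrite mxE !eqxx mul1r addr0 mderiv_comp ev_sum; apply: eq_bigr => j _.
    by rewrite evM !mxE mulrC.
  by rewrite mxE eqxx li mul0r.
have [Ju _] := mulmx1_unit Jev.
apply: contraTneq Ju; rewrite unitmxE det_map_mx -/J => ->.
by rewrite rmorph0 unitr0.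
Qed.

(** By the chain rule the partials of a relation [P], taken at the f_j, are killed by the Jacobian
    matrix. They are therefore shorter relations, zero by induction, and in characteristic 0 this
    makes [P] constant. *)
Lemma basic_invariants_independent P : P \mPo f = 0 -> P = 0.
Proof.
have [k] := ubnP (msize P); elim: k P => // k IHk P; rewrite ltnS => leP Pf.
have [->//|P0] := eqVneq P 0.
pose J := \matrix_(i, j) (tnth f j)^`M(i).
pose r : 'cV[{mpoly C[n.+1]}]_n.+1 := \col_j (P^`M(j) \mPo f).
have Jr : J *m r = 0.
  apply/matrixP=> i j; rewrite ord1 !mxE.
  have := mderiv_comp f P i; rewrite Pf mderiv0 => dP0; rewrite [RHS]dP0.
  by apply: eq_bigr => l _; rewrite !mxE mulrC.
have r0 j : P^`M(j) \mPo f = 0.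
  have : \adj J *m (J *m r) = 0 by rewrite Jr mulmx0.
  rewrite mulmxA mul_adj_mx mul_scalar_mx => /matrixP/(_ j 0).
  rewrite !mxE => /eqP; rewrite mulf_eq0 (negPf jacobian_neq0) /=.
  by move/eqP.
have dP j : P^`M(j) = 0.
  apply: IHk (r0 j); apply: leq_trans leP.
  have sP : (0 < msize P)%N by rewrite lt0n msize_poly_eq0.
  rewrite -[X in (_ < X)%N](prednK sP) ltnS msizeE; apply/bigmax_leqP_seq => m.
  rewrite mcoeff_msupp mcoeff_deriv -ltnS (prednK sP) => Pm _.
  have mP : (m + U_(j))%MM \in msupp P.
    by rewrite mcoeff_msupp; apply: contraNneq Pm => ->; rewrite mul0rn.
  by have := msize_mdeg_lt mP; rewrite mdegD mdeg1 addn1.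
have PC : P = (P@_0%MM)%:MP.
  apply/mpolyP=> m; rewrite mcoeffC; case: eqP => [->|/eqP m0]; first by rewrite mulr1.
  have [j mj] : exists j, m j != 0%N.
    apply/existsP; apply: contraNT m0 => /existsPn m0.
    by apply/eqP/mnmP=> j; rewrite mnm0E; apply/eqP; rewrite -[_ == _]negbK m0.
  have := congr1 (mcoeff (m - U_(j))%MM) (dP j).
  rewrite mcoeff_deriv mcoeff0 submK ?lep1mP // => /eqP.
  by rewrite mulrn_eq0 /= mulr0 => /eqP.
by move: Pf; rewrite PC comp_mpolyC.
Qed.

End BasicInvariants.

(** * Freeness over the invariants *)

Section Freeness.

Variables (C : numClosedFieldType) (gT : finGroupType) (G : {group gT}).
Variables (n : nat) (W : mx_representation C G n.+1).
Implicit Types (p q r a b : {mpoly C[n.+1]}) (gs : seq {mpoly C[n.+1]}).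

Local Notation invSP := (fun a => a \in invS_pred W).

(** [W g - 1%:M] is a column [x] times a row [y], so [g] fixes each variable modulo the linear form
    [L] of [x], and hence each polynomial. *)
Lemma reflection_divides g : g \in G -> reflection W g ->
  exists2 L : {mpoly C[n.+1]}, L != 0 /\ L \is 1.-homog &
    forall p, exists q, p - actS W g p = L * q.
Proof.
move=> Gg; rewrite /reflection eqSS => /eqP rk.
have [x [y [x0 Wg]]] : exists (x : 'cV[C]_n.+1) (y : 'rV[C]_n.+1),
    x != 0 /\ W g = 1%:M + x *m y.
  pose A := W g - 1%:M; have AE : W g = 1%:M + A by rewrite addrC subrK.
  have rA : (\rank A <= 1)%N.
    have : (rfix_mx W [set g] <= kermx A)%MS.
      apply/sub_kermxP; rewrite mulmxBr mulmx1.
      by rewrite rfix_mx_id ?inE // subrr.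
    move/mxrankS; rewrite rk mxrank_ker leq_subRL ?rank_leq_row //.
    by rewrite -[X in (_ <= X)%N]add1n leq_add2r.
  have [A0|/rowV0Pn[y yA y0]] := eqVneq A 0.
    exists (const_mx 1), 0; rewrite mulmx0 addr0 AE A0 addr0; split=> //.
    apply/eqP=> /matrixP/(_ 0 0); rewrite !mxE => /eqP.
    by rewrite oner_eq0.
  have /submxP[x xE] : (A <= y)%MS.
    by rewrite -(geq_leqif (mxrank_leqif_sup yA)) rank_rV y0.
  exists x, y; split; last by rewrite AE xE.
  by apply: contraNneq y0 => x0; move: yA; rewrite xE x0 mul0mx submx0.
pose L : {mpoly C[n.+1]} := \sum_j x j 0 *: 'X_j.
exists L; first split.
- apply: contraNneq x0 => L0; apply/eqP/colP=> j; rewrite mxE.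
  have := congr1 (mcoeff U_(j)) L0; rewrite mcoeff0 raddf_sum (bigD1 j) //=.
  rewrite big1 ?addr0 => [|i ij]; rewrite mcoeffZ mcoeffX eq_mnm1 ?eqxx ?mulr1 //.
  by rewrite (negPf ij) mulr0.
- by apply: rpred_sum => j _; rewrite rpredZ // dhomogX /= mdeg1.
elim/mpoly_ring_ind=> [c|i|p q [p' pE] [q' qE]|p q [p' pE] [q' qE]].
- by exists 0; rewrite actSE lsubC subrr mulr0.
- exists (- (y 0 i)%:MP); rewrite actSE lsubX Wg.
  under eq_bigr do rewrite mxE scalerDl.
  rewrite big_split /= (bigD1 i) //= big1 => [|j ji]; last first.
    by rewrite mxE (negPf ji) scale0r.
  rewrite mxE eqxx scale1r addr0 opprD addNKr mulrN mulrC mul_mpolyC.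
  congr (- _); rewrite scaler_sumr; apply: eq_bigr => j _.
  by rewrite mxE big_ord1 scalerA mulrC.
- by exists (p' + q'); rewrite raddfD /= opprD addrACA pE qE mulrDr.
- exists (p' * q + actS W g p * q'); rewrite rmorphM /= mulrDr mulrA -pE.
  by rewrite mulrCA -qE mulrBl mulrBr addrA subrK.
Qed.

Lemma prodspan_average gs p : {subset gs <= invS_pred W} ->
  prodspan (fun a => a \in gs) (fun _ => True) p ->
  prodspan (fun a => a \in gs) invSP (\sum_(g in G) actS W g p).
Proof.
move=> gsW; elim=> [|a b q ags _ _ IH].
  by rewrite big1 => [|g _]; [apply: prodspan0 | rewrite raddf0].
under eq_bigr do rewrite raddfD /= rmorphM /=.
rewrite big_split; apply: prodspanD => //=.
rewrite (eq_bigr (fun g => a * actS W g b)) => [|g Gg]; last first.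
  by congr (_ * _); apply: (invS_predP _ _ (gsW a ags)).
by rewrite -mulr_sumr; apply: prodspan1 => //; apply: sum_act_inv.
Qed.

Lemma hilbert_ideal_act g p : g \in G -> hilbert_ideal W p ->
  hilbert_ideal W (actS W g p).
Proof.
move=> Gg; elim=> [|a b q [aW a0] _ _ IH]; first by rewrite raddf0; apply: prodspan0.
rewrite raddfD /= rmorphM /= (invS_predP _ _ aW g Gg).
by apply: prodspanS.
Qed.

Hypothesis W_reflections : <<[set g in G | reflection W g]>>%g = G :> {set gT}.

(** The Hilbert ideal is stable under the group, so the elements fixing [p] modulo it form a
    subgroup; containing the reflections, it is everything. *)
Lemma reflection_coset_ideal p :
  (forall g, g \in G -> reflection W g -> hilbert_ideal W (p - actS W g p)) ->
  forall g, g \in G -> hilbert_ideal W (p - actS W g p).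
Proof.
move=> pR; pose H := [set g in G | `[< hilbert_ideal W (p - actS W g p) >]].
have Hgrp : group_set H.
  apply/group_setP; split=> [|g h].
    by rewrite inE group1 actS1 subrr; apply/asboolP; apply: prodspan0.
  rewrite !inE => /andP[Gg /asboolP pg] /andP[Gh /asboolP ph].
  rewrite (groupM Gg Gh); apply/asboolP; rewrite (actSM _ _ Gg Gh).
  have -> : p - actS W g (actS W h p) =
      (p - actS W g p) + actS W g (p - actS W h p).
    by rewrite [actS W g (_ - _)]raddfB /= addrA subrK.
  by apply: prodspanD => //; apply: hilbert_ideal_act.
move=> g; rewrite -W_reflections => gR.
have : g \in Group Hgrp.
  apply: (subsetP _ _ gR); rewrite gen_subG; apply/subsetP=> h.
  by rewrite !inE => /andP[Gh hR]; rewrite Gh; apply/asboolP; apply: pR.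
by rewrite inE => /andP[_ /asboolP].
Qed.

Lemma prodspan_quotient g L gs p : g \in G -> L != 0 ->
  (forall p, exists q, p - actS W g p = L * q) ->
  {subset gs <= invS_pred W} ->
  prodspan (fun a => a \in gs) (fun _ => True) p ->
  exists2 r, prodspan (fun a => a \in gs) (fun _ => True) r &
    p - actS W g p = L * r.
Proof.
move=> Gg L0 Lq gsW; elim=> [|a b q ags _ _ [r rS rE]].
  by exists 0; [apply: prodspan0 | rewrite raddf0 subr0 mulr0].
have [b' bE] := Lq b; exists (a * b' + r); first exact: prodspanS.
rewrite raddfD /= rmorphM /= (invS_predP _ _ (gsW a ags) g Gg) opprD addrACA rE.
by rewrite -mulrBr bE mulrDr mulrCA.
Qed.

(* If [L] is the linear form of a reflection [g], then (p - g p) / L satisfies the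
   same relation in smaller degree.  By induction [p] is invariant modulo the Hilbert
   ideal, hence congruent to its average. *)
Lemma chevalley gs a e p : {subset gs <= invS_pred W} -> a \in invS_pred W ->
  ~ prodspan (fun a => a \in gs) invSP a -> p \is e.-homog ->
  prodspan (fun a => a \in gs) (fun _ => True) (a * p) -> hilbert_ideal W p.
Proof.
move=> gsW aW aN; elim: e p => [|e IHe] p pe apS.
  have pC : p = (p@_0%MM)%:MP.
    apply/mpolyP=> m; rewrite mcoeffC; case: eqP => [->|/eqP m0].
      by rewrite mulr1.
    by rewrite mulr0 (dhomog_nemf_coeff pe) ?[mdeg m == _]mdeg_eq0.
  have [p0|p0] := eqVneq (p@_0%MM) 0.
    by rewrite pC p0 mpolyC0; apply: prodspan0.
  (* Were the constant [p] nonzero, averaging a p over the group and dividing would express [a]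
     through [gs] with invariant coefficients. *)
  case: aN; have := prodspan_average gsW apS.
  pose c := (#|G|%:R * p@_0%MM)^-1.
  have cu : #|G|%:R * p@_0%MM != 0.
    by rewrite mulf_neq0 // pnatr_eq0 -lt0n cardG_gt0.
  move=> H; have -> : a = c%:MP * \sum_(g in G) actS W g (a * p).
    rewrite (eq_bigr (fun=> (p@_0%MM) *: a)) => [|g Gg]; last first.
      rewrite rmorphM /= (invS_predP _ _ aW g Gg) pC actSE lsubC mulrC.
      by rewrite mul_mpolyC mcoeffC eqxx mulr1.
    rewrite sumr_const -scaler_nat scalerA mul_mpolyC scalerA mulVf //.
    by rewrite scale1r.
  apply: prodspanM H => b bW; apply: rpredM => //.
  by apply/invS_predP=> g Gg; rewrite actSE lsubC.
have pR g : g \in G -> reflection W g -> hilbert_ideal W (p - actS W g p).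
  move=> Gg /(reflection_divides Gg)[L [L0 L1] Lq].
  have [r rS rE] := prodspan_quotient Gg L0 Lq gsW apS.
  have [q qE] := Lq p.
  have q'E : p - actS W g p = L * pihomog mdeg e q.
    have pe' : p - actS W g p \is e.+1.-homog.
      by rewrite rpredB // actSE lsub_homog.
    rewrite -(pihomog_dE pe') qE pihomogM (bigD1 (Ordinal (isT : (1 < e.+2)%N))) //=.
    rewrite (pihomog_dE L1) subSS subn0 big1 ?addr0 // => k k1.
    by rewrite (pihomog_ne0 _ L1) ?mul0r // eq_sym.
  rewrite q'E; apply: hilbert_idealM; apply: IHe; first exact: pihomogP.
  suff -> : a * pihomog mdeg e q = r by [].
  apply: (mulfI L0); rewrite mulrCA -q'E -rE rmorphM /= (invS_predP _ _ aW g Gg).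
  by rewrite mulrBr.
have pI := reflection_coset_ideal pR.
have -> : p = (#|G|%:R^-1)%:MP *
    (\sum_(g in G) (p - actS W g p) + \sum_(g in G) actS W g p).
  rewrite -big_split /= (eq_bigr (fun=> p)) => [|g _]; last by rewrite subrK.
  rewrite sumr_const -scaler_nat mul_mpolyC scalerA mulVf ?scale1r //.
  by rewrite pnatr_eq0 -lt0n cardG_gt0.
apply: hilbert_idealM; apply: prodspanD; first exact: prodspan_sum.
rewrite -[X in prodspan _ _ X]mulr1; apply: prodspan1 => //.
split; first exact: sum_act_inv.
rewrite raddf_sum big1 //= => g _; rewrite actSE lsub_coef0.
by rewrite (dhomog_nemf_coeff pe) //= mdeg0.
Qed.

Lemma prodspan_comb k (g : 'I_k -> {mpoly C[n.+1]}) p :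
  prodspan (fun a => a \in [seq g i | i <- enum 'I_k]) invSP p ->
  exists2 b : 'I_k -> {mpoly C[n.+1]}, forall i, b i \in invS_pred W &
    p = \sum_i b i * g i.
Proof.
elim=> [|a b q /mapP[j _ ->] bW _ [c cW ->]].
  exists (fun=> 0) => [i|]; first exact: rpred0.
  by rewrite big1 // => i _; rewrite mul0r.
exists (fun i => c i + (if i == j then b else 0)) => [i|].
  by rewrite rpredD //; case: eqP; rewrite // rpred0.
under [in RHS]eq_bigr do rewrite mulrDl.
rewrite big_split /= [RHS]addrC; congr (_ + _).
rewrite (bigD1 j) //= eqxx big1 => [|i /negPf->]; first by rewrite addr0 mulrC.
by rewrite mul0r.
Qed.

(* Either Chevalley's lemma puts all [s ord0 t] in the Hilbert ideal, or [a ord0] is a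
   combination sum_i b_i a_i of the other [a i], and the relation shortens upon
   replacing [s i] by [s i + b i * s ord0]. *)
Lemma ideal_independent_free (T : Type) k N (s : 'I_k -> T -> {mpoly C[n.+1]})
    (d : 'I_k -> nat) (a : 'I_k -> {mpoly C[n.+1]}) :
  (forall i t, s i t \is (d i).-homog) ->
  (forall i, a i \in invS_pred W) ->
  (forall i, (d i <= N)%N -> a i \is (N - d i).-homog) ->
  (forall i, (N < d i)%N -> a i = 0) ->
  (forall c : 'I_k -> C, (forall t, hilbert_ideal W (\sum_i c i *: s i t)) ->
     forall i, c i = 0) ->
  (forall t, \sum_i a i * s i t = 0) -> forall i, a i = 0.
Proof.
elim: k s d a => [|k IHk] s d a sd aW aN aN0 indep rel; first by case.
pose up := lift ord0 : 'I_k -> 'I_k.+1.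
have relE t : a ord0 * s ord0 t + \sum_i a (up i) * s (up i) t = 0.
  by have := rel t; rewrite big_ord_recl.
pose gs := [seq a (up i) | i <- enum 'I_k].
have gsW : {subset gs <= invS_pred W} by move=> _ /mapP[i _ ->].
have [aS|aS] := EM (prodspan (fun x => x \in gs) invSP (a ord0)); last first.
  have s0I t : hilbert_ideal W (s ord0 t).
    apply: (chevalley gsW (aW ord0) aS (sd ord0 t)).
    have /eqP := relE t; rewrite addr_eq0 -sumrN => /eqP->.
    apply: prodspan_sum => i _; rewrite -mulrN; apply: prodspan1 => //.
    by apply/mapP; exists i; rewrite ?mem_enum.
  have : (ord0 == ord0 :> 'I_k.+1)%:R = 0 :> C.
    apply: (indep (fun i => (i == ord0)%:R)) => t.
    rewrite big_ord_recl eqxx scale1r big1 ?addr0 // => i _.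
    by rewrite scale0r.
  by rewrite eqxx => /eqP; rewrite oner_eq0.
have [b0 b0W aE0] := prodspan_comb aS.
(* The components of the [b0 i] in the degrees that keep the modified maps [s'] homogeneous;
   comparing degrees in [aE0] shows that they suffice. *)
pose b i := if (d ord0 <= d (up i))%N then pihomog mdeg (d (up i) - d ord0) (b0 i) else 0.
have bW i : b i \in invS_pred W.
  by rewrite /b; case: ifP => _; rewrite ?rpred0 // invS_pihomog.
have [a0|a0] := eqVneq (a ord0) 0.
  have up0 i : a (up i) = 0.
    apply: (IHk (fun i => s (up i)) (fun i => d (up i)) (fun i => a (up i))
      (fun i => sd (up i)) (fun i => aW (up i)) (fun i => aN (up i))
      (fun i => aN0 (up i))).
      move=> c cI j; have := indep (fun i => oapp c 0 (unlift ord0 i)) _ (up j).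
      rewrite liftK /=; apply=> t; rewrite big_ord_recl unlift_none scale0r add0r.
      by under eq_bigr do rewrite liftK; apply: cI.
    by move=> t; have := relE t; rewrite a0 mul0r add0r.
  by move=> i; case: (unliftP ord0 i) => [j|] ->.
have d0N : (d ord0 <= N)%N.
  by rewrite leqNgt; apply: contra_neqN a0; apply: aN0.
have aE : a ord0 = \sum_i a (up i) * b i.
  rewrite -[LHS](pihomog_dE (aN ord0 d0N)).
  rewrite aE0 raddf_sum; apply: eq_bigr => i _ /=; rewrite mulrC.
  have [diN|/aN0->] := leqP (d (up i)) N; last by rewrite !mul0r raddf0.
  rewrite (pihomogMl _ _ (aN _ diN)) /b leq_sub2lE //.
  have -> : (N - d ord0 - (N - d (up i)) = d (up i) - d ord0)%N by lia.
  by case: ifP; rewrite ?mulr0.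
pose s' i t := s (up i) t + b i * s ord0 t.
have s'd i t : s' i t \is (d (up i)).-homog.
  apply: rpredD => //; rewrite /b; case: ifP => [le|_]; last by rewrite mul0r rpred0.
  rewrite -(subnK le); apply: dhomogM; last exact: sd.
  by rewrite subnK // pihomogP.
have s'I (c : 'I_k -> C) : (forall t, hilbert_ideal W (\sum_i c i *: s' i t)) ->
    forall i, c i = 0.
  (* Modulo the Hilbert ideal each [b i] equals its constant term, so a relation between the [s'] is
     one between the [s], with coefficient [c0] on [s ord0]. *)
  move=> cI j; pose c0 := \sum_i c i * (b i)@_0%MM.
  have := indep (fun i => oapp c c0 (unlift ord0 i)) _ (up j).
  rewrite liftK /=; apply=> t; rewrite big_ord_recl unlift_none /=.
  under eq_bigr do rewrite liftK /=.
  have -> : c0 *: s ord0 t + \sum_i c i *: s (up i) t = \sum_i c i *: s' i t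
      + \sum_i (((b i)@_0%MM)%:MP - b i) * (c i *: s ord0 t).
    rewrite scaler_suml -!big_split /=; apply: eq_bigr => i _.
    by rewrite /s' -!mul_mpolyC mpolyCM; ring.
  apply: prodspanD; first exact: cI.
  apply: prodspan_sum => i _; apply: prodspan1 => //; split.
    rewrite rpredB //; apply/invS_predP => g Gg.
    by rewrite actSE lsubC.
  by rewrite mcoeffB mcoeffC eqxx mulr1 subrr.
have up0 i : a (up i) = 0.
  apply: (IHk s' (fun i => d (up i)) (fun i => a (up i)) s'd
    (fun i => aW (up i)) (fun i => aN (up i)) (fun i => aN0 (up i)) s'I) => t.
  have := relE t; rewrite aE mulr_suml addrC -big_split /= => relt.
  rewrite -[RHS]relt.
  by apply: eq_bigr => l _; rewrite mulrDr mulrA.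
move=> i; case: (unliftP ord0 i) => [j|] -> //.
by rewrite aE big1 // => l _; rewrite up0 mul0r.
Qed.

(** Harmonics meet the Hilbert ideal in 0, so a basis is independent modulo that ideal. The relation
    is cut to one total degree [N], chosen so that [a i] contributes its component of degree [e]. *)
Lemma homWH_free (U : lmodType C) (aU : gT -> U -> U) m (b : 'I_m -> homWH W aU)
    (d : 'I_m -> nat) (a : 'I_m -> invS W) :
  (forall i u, b i u \is (d i).-homog) -> is_basis (fun _ => True) b ->
  (forall u, \sum_i invS_val (a i) * b i u = 0) -> forall i, a i = 0.
Proof.
move=> bd [_ bspan] rel i; apply: val_inj => /=; set ai := invS_val (a i).
apply: (pihomog_eq0 (mf := mdeg)) => e.
pose N := (e + d i)%N.
pose a' j := if (d j <= N)%N then pihomog mdeg (N - d j) (invS_val (a j)) else 0.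
have a'0 : a' i = 0.
  apply: (@ideal_independent_free U m N (fun j => b j) d a') => //.
  - by move=> j; rewrite /a'; case: ifP => _; rewrite ?rpred0 // invS_pihomog // (valP (a j)).
  - by move=> j; rewrite /a' => ->; apply: pihomogP.
  - by move=> j; rewrite /a' ltnNge => /negPf->.
  - move=> c cI j; have b0 : \sum_j c j *: b j = 0.
      apply: homWH_ext => u; rewrite homWH_comb; apply: harmonic_ideal_eq0 (cI u).
      by rewrite -homWH_comb; apply: homWH_harmonic.
    have [c' [_ c'u]] := bspan 0 I.
    have := c'u (\row_j c j); have := c'u 0.
    move=> -> => [|]; last by rewrite big1 // => l _; rewrite mxE scale0r.
    move=> /(_ _)/rowP/(_ j); rewrite !mxE => <- //.
    by rewrite -[LHS]b0; apply: eq_bigr => l _; rewrite mxE.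
  - move=> u; have := congr1 (pihomog mdeg N) (rel u).
    rewrite raddf0 raddf_sum => relN; rewrite -[RHS]relN.
    apply: eq_bigr => j _ /=; rewrite [in RHS]mulrC (pihomogMl _ _ (bd j u)).
    by rewrite /a'; case: ifP; rewrite ?mul0r // mulrC.
by move: a'0; rewrite /a' /N leq_addl addnK.
Qed.

End Freeness.

(** * Nonsingularity of the duality pairing *)

Section Nullstellensatz.

Variables (C : numClosedFieldType) (n : nat).
Implicit Types (p q r b : {mpoly C[n]}).

Variable K : {mpoly C[n]} -> Prop.
Hypothesis K0 : K 0.
Hypothesis KD : forall p q, K p -> K q -> K (p + q).
Hypothesis KM : forall r p, K p -> K (r * p).
Hypothesis K1 : ~ K 1.

(** The product of the linear factors of [P] at ['X_i] carries [b] into [K]. Removing factors one by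
    one, [r] is the first remaining product that fails to do so. *)
Lemma linear_factor_step i (P : {poly C}) b :
  P != 0 -> K (\sum_(j < size P) P`_j *: 'X_i ^+ j) -> ~ K b ->
  exists c r, ~ K (r * b) /\ K (('X_i - c%:MP) * (r * b)).
Proof.
move=> P0 KP Kb.
have [rs PE] := closed_field_poly_normal P.
pose pr (s : seq C) := \prod_(c <- s) ('X_i - c%:MP) : {mpoly C[n]}.
have prE : \sum_(j < size P) P`_j *: 'X_i ^+ j = lead_coef P *: pr rs.
  have := congr1 (fun Q => (map_poly (@mpolyC n C) Q).['X_i]) PE.
  rewrite map_polyZ hornerZ rmorph_prod horner_prod mul_mpolyC.
  under [in X in _ = X -> _]eq_bigr do rewrite rmorphB /= map_polyX map_polyC hornerXsubC.
  move=> <-; rewrite (horner_coef_wide _ (size_poly _ _)).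
  by apply: eq_bigr => j _; rewrite coef_map mul_mpolyC.
have : K (pr rs * b).
  rewrite mulrC; apply: KM; move: KP; rewrite prE => /(KM ((lead_coef P)^-1)%:MP).
  by rewrite mul_mpolyC scalerA mulVf ?scale1r ?lead_coef_eq0.
rewrite /pr; elim: rs {PE prE} => [|c s IHs]; first by rewrite big_nil mul1r.
rewrite big_cons -mulrA => Kc.
have [/IHs//|Ks] := EM (K (\prod_(c <- s) ('X_i - c%:MP) * b)).
by exists c, (\prod_(c <- s) ('X_i - c%:MP)).
Qed.

Hypothesis K_integral : forall i, exists2 P : {poly C}, P != 0 &
  K (\sum_(j < size P) P`_j *: 'X_i ^+ j).

(* Multiplying by factors of the integral equations produces [b] outside [K] with
   [('X_i - v i) * b] in [K] for all [i], so that [p * b = p(v) b] modulo [K]. *)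
Lemma zero_of_proper_ideal : exists v, forall p, K p -> ev p v = 0.
Proof.
have loop (s : seq 'I_n) : exists (v : 'I_n -> C) b,
    ~ K b /\ forall i, i \in s -> K (('X_i - (v i)%:MP) * b).
  elim: s => [|i s [v [b [Kb vK]]]]; first by exists (fun=> 0), 1.
  have [P P0 KP] := K_integral i.
  have [c [r [Kr Kc]]] := linear_factor_step P0 KP Kb.
  exists (fun j => if j == i then c else v j), (r * b); split=> // j.
  rewrite inE; case: eqP => [-> _|_ /= js]; first exact: Kc.
  by rewrite mulrCA; apply: KM; apply: vK.
have [v [b [Kb vK]]] := loop (enum 'I_n).
exists (\row_i v i) => p Kp; set w := \row_i v i.
have E q : K ((q - (ev q w)%:MP) * b).
  elim/mpoly_ring_ind: q => [c|i|q r IHq IHr|q r IHq IHr].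
  - by rewrite evC subrr mul0r.
  - by rewrite evX mxE; apply: vK; rewrite mem_enum.
  - rewrite evD mpolyCD opprD addrACA mulrDl; exact: KD.
  - have -> : (q * r - (ev (q * r) w)%:MP) * b =
        r * ((q - (ev q w)%:MP) * b) + (ev q w)%:MP * ((r - (ev r w)%:MP) * b).
      by rewrite evM mpolyCM; ring.
    by apply: KD; apply: KM.
apply/eqP; apply: contraT => pw; case: Kb.
have : K ((ev p w)^-1%:MP * (b * p + (-1) * ((p - (ev p w)%:MP) * b))).
  by apply: (KM); apply: KD; apply: (KM).
have -> : b * p + (-1) * ((p - (ev p w)%:MP) * b) = (ev p w)%:MP * b by ring.
by rewrite mulrA -mpolyCM mulVf // mpolyC1 mul1r.
Qed.

End Nullstellensatz.

Lemma closed_prim_root (C : numClosedFieldType) d : (0 < d)%N ->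
  exists z : C, d.-primitive_root z.
Proof.
move=> d0; have [r rE] := closed_field_poly_normal ('X^d - 1 : {poly C}).
rewrite (monicP (monicXnsubC 1 d0)) scale1r in rE.
have sz : (d <= size r)%N.
  by rewrite -ltnS -(size_prod_XsubC r id) -rE size_XnsubC.
have ru : uniq r.
  by rewrite -separable_prod_XsubC -rE separable_Xn_sub_1 // pnatr_eq0 -lt0n.
have rr : all d.-unity_root r by apply/allP=> z; rewrite -root_prod_XsubC -rE.
by have /hasP[z _ zP] := has_prim_root d0 rr ru sz; exists z.
Qed.

Section WeightedDegree.

Variables (n : nat) (w : 'I_n -> nat).

Definition wdeg (m : 'X_{1..n}) : nat := (\sum_i m i * w i)%N.

Lemma wdeg0 : wdeg 0%MM = 0%N.
Proof. by rewrite /wdeg big1 // => i _; rewrite mnm0E mul0n. Qed.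

Lemma wdegD : {morph wdeg : m1 m2 / (m1 + m2)%MM >-> (m1 + m2)%N}.
Proof.
move=> m1 m2; rewrite /wdeg -big_split; apply: eq_bigr => i _ /=.
by rewrite mnmDE mulnDl.
Qed.

HB.instance Definition _ := isMeasure.Build n wdeg wdeg0 wdegD.

Lemma wdeg1 i : wdeg U_(i)%MM = w i.
Proof.
rewrite /wdeg (bigD1 i) //= big1 => [|j /negPf ji].
  by rewrite mnm1E eqxx mul1n addn0.
by rewrite mnm1E eq_sym ji mul0n.
Qed.

End WeightedDegree.

Section Pairing.

Variables (C : numClosedFieldType) (gT : finGroupType) (G : {group gT}).
Variables (n : nat) (W : mx_representation C G n.+1).
Implicit Types (p q : {mpoly C[n.+1]}) (v u : 'rV[C]_n.+1).

Lemma linform_linear : linear (@linform C n).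
Proof.
move=> c x y; rewrite /linform scaler_sumr -big_split; apply: eq_bigr => i _ /=.
by rewrite !mxE scalerDl scalerA.
Qed.

Lemma ev_linform (x : 'cV[C]_n.+1) v : ev (linform x) v = (v *m x) 0 0.
Proof.
rewrite /linform ev_sum mxE; apply: eq_bigr => i _.
by rewrite evZ evX mulrC.
Qed.

Lemma dirder_linform (x : 'cV[C]_n.+1) v u : dirder (linform x) v u = (u *m x) 0 0.
Proof.
rewrite /linform dirder_sum mxE; apply: eq_bigr => i _.
by rewrite dirderZ dirderX mulrC.
Qed.

Lemma actS_linform g x : actS W g (linform x) = linform (W g *m x).
Proof.
rewrite actSE /linform raddf_sum /=.
under eq_bigr do rewrite linearZ /= lsubX scaler_sumr.
rewrite exchange_big; apply: eq_bigr => k _.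
rewrite mxE scaler_suml; apply: eq_bigr => j _.
by rewrite scalerA mulrC.
Qed.

Lemma linform_inj : injective (@linform C n).
Proof.
move=> x y xy; apply/colP=> i; have := congr1 (fun p => ev p (delta_mx 0 i)) xy.
by rewrite !ev_linform -!rowE !mxE.
Qed.

(** Equivariance makes the matrix of [s] commute with W, and Schur's lemma applies after subtracting
    an eigenvalue. As a vector field, [s] is then a multiple of the Euler field. *)
Lemma homVd_degree1_scalar (s : homVd W) : mx_irreducible W ->
  (forall x, s x \is 1.-homog) -> exists c, forall x, s x = c *: linform x.
Proof.
move=> Wirr s1; have [sL sG] := homWH_equivariant s.
pose K : 'M[C]_n.+1 := \matrix_(j, k) (s (vVd C k))@_U_(j).
have sE x : s x = linform (K *m x).
  rewrite {1}[x]cV_coordE (linear_comb _ _ _ sL).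
  have -> : K *m x = \sum_i x i 0 *: (K *m vVd C i).
    by rewrite {1}[x]cV_coordE mulmx_sumr; apply: eq_bigr => i _; rewrite -scalemxAr.
  rewrite (linear_comb _ _ _ linform_linear); apply: eq_bigr => k _; congr (_ *: _).
  apply/mpolyP=> m; rewrite /linform raddf_sum /=.
  have [/mdeg1P[j /eqP->]|m1] := boolP (mdeg m == 1%N).
    rewrite (bigD1 j) //= big1 => [|i /negPf ij].
      by rewrite mcoeffZ mcoeffX eqxx mulr1 addr0 -colE !mxE.
    by rewrite mcoeffZ mcoeffX eq_mnm1 ij mulr0.
  rewrite (dhomog_nemf_coeff (s1 _)) // big1 // => i _.
  rewrite mcoeffZ mcoeffX; case: eqP => [mE|_]; last by rewrite mulr0.
  by rewrite -mE mdeg1 in m1.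
have KG : centgmx W K.
  apply/centgmxP=> g Gg; apply/matrixP=> i j.
  have := sG g (vVd C j) Gg; rewrite !sE actS_linform => /linform_inj.
  by rewrite /actVd !mulmxA -!colE => /colP/(_ i); rewrite !mxE.
have [c /eigenvalueP[v vK v0]] := eigenvalue_closed K (ltn0Sn n).
exists c => x; rewrite sE; suff -> : K = c%:M.
  by rewrite mul_scalar_mx; have := linform_linear c x 0;
     rewrite addr0 => ->; rewrite /linform [X in _ + X]big1 ?addr0 // => i _;
     rewrite mxE scale0r.
apply/eqP; rewrite -subr_eq0; apply: contraT => Kc.
have cG : centgmx W (K - c%:M).
  apply/centgmxP=> g Gg; rewrite mulmxBl mulmxBr (centgmxP KG) //.
  by rewrite scalar_mxC.
have Ku := mx_Schur Wirr cG Kc; case/eqP: v0.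
by rewrite -[v](mulmxK Ku) mulmxBr vK mul_mx_scalar subrr mul0mx.
Qed.

Lemma lsub_scalar (t : C) e p : p \is e.-homog -> lsub t%:M p = t ^+ e *: p.
Proof.
move=> /dhomogP pe.
have E m : lsub t%:M 'X_[m] = t ^+ mdeg m *: ('X_[m] : {mpoly C[n.+1]}).
  rewrite [in LHS]mpolyXE_id rmorph_prod /=.
  under eq_bigr => i _.
    rewrite rmorphXn /= lsubX (bigD1 i) //= big1 => [|j /negPf ji].
      rewrite mxE eqxx mulr1n addr0 exprZn; over.
    by rewrite mxE ji mulr0n scale0r.
  by rewrite scaler_prod -mpolyXE_id mdegE expr_sum.
rewrite [in RHS](mpolyE p) [X in lsub _ X](mpolyE p) raddf_sum scaler_sumr.
rewrite big_seq [RHS]big_seq.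
apply: eq_bigr => m mp /=; rewrite linearZ /= E pe // !scalerA.
by rewrite mulrC.
Qed.

Lemma lsub_scalar_inv (t : C) p : p \in invS_pred W -> lsub t%:M p \in invS_pred W.
Proof.
move=> /invS_predP pW; apply/invS_predP=> g Gg.
by rewrite actSE lsub_mul scalar_mxC -lsub_mul -actSE pW.
Qed.

(** Differentiating p(w g) = p(w) at the fixed point [v] shows that the derivatives along [z] and
    along [z *m W g] agree. *)
Lemma invS_dirder0 p g v z : p \in invS_pred W -> g \in G -> v *m W g = v ->
  dirder p v (z *m W g - z) = 0.
Proof.
move=> /invS_predP pW Gg vg.
have E := dirder_lsub (W g) p v z; rewrite -actSE pW // vg in E.
rewrite /dirder; under eq_bigr do rewrite mxE [X in _ + X]mxE mulrBl.
by rewrite sumrB -!/(dirder _ _ _) E subrr.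
Qed.

End Pairing.

(** * Fibres of the basic invariants and the pairing matrix *)

Section DualityCore.

Variables (C : numClosedFieldType) (gT : finGroupType) (G : {group gT}).
Variables (n : nat) (W : mx_representation C G n.+1).
Variable sigma : 'I_n.+1 -> homV W.
Hypothesis sigma_basis : is_basis (fun _ => True) sigma.
Variable ds : 'I_n.+1 -> nat.
Hypothesis sigma_homog : forall j v, sigma j v \is (ds j).-homog.
Hypothesis W_faithful : mx_faithful W.
Implicit Types (p q : {mpoly C[n.+1]}) (P : {mpoly C[n.+1]}).

Local Notation f := (basic_invariants sigma).

Lemma ev_comp P v : ev (P \mPo f) v = P.@[fun j => ev (tnth f j) v].
Proof. exact: comp_mpoly_meval. Qed.

(* The ideal generated by the [f_j - y j] is proper: averaging over the group would
   turn an expression of 1 into an algebraic relation between the [f_j]. *)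
Lemma fiber_point (y : 'I_n.+1 -> C) : exists v, forall j, ev (tnth f j) v = y j.
Proof.
have gen := basic_invariants_generate sigma_basis sigma_homog.
have indep := basic_invariants_independent sigma_basis sigma_homog W_faithful.
pose A p := exists2 P, p = P \mPo f & P.@[y] = 0.
pose K := prodspan A (fun _ => True).
have KA P : K (P \mPo f - (P.@[y])%:MP).
  rewrite -[X in K X]mulr1; apply: prodspan1 => //.
  exists (P - (P.@[y])%:MP); first by rewrite raddfB /= comp_mpolyC.
  by rewrite mevalB mevalC subrr.
have K1 : ~ K 1.
  move=> K1; have : exists2 P, \sum_(g in G) actS W g 1 = P \mPo f & P.@[y] = 0.
    elim: K1 => [|a b p [P aE Py] _ _ [Q QE Qy]].
      by exists 0; rewrite ?meval0 // raddf0 big1 // => g _; rewrite raddf0.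
    have [B BE] := gen _ (sum_act_inv W b).
    exists (P * B + Q); last by rewrite mevalD mevalM Py mul0r add0r.
    rewrite raddfD /= rmorphM /= -QE -aE BE mulr_sumr -big_split.
    apply: eq_bigr => g Gg /=; rewrite raddfD /= rmorphM /=; congr (_ * _ + _).
    have aW : a \in invS_pred W.
      rewrite aE comp_mpolyE rpred_sum // => m _; apply: rpredZ.
      by apply: rpred_prod => j _; rewrite rpredX // tnth_basic; apply: valP.
    exact: (invS_predP _ _ aW).
  case=> P PE Py; have : P - (#|G|%:R)%:MP = 0.
    apply: indep; rewrite raddfB /= -PE comp_mpolyC (eq_bigr (fun=> 1)).
      by rewrite sumr_const mpolyCMn mpolyC1 subrr.
    by move=> g _; rewrite rmorph1.
  move/eqP; rewrite subr_eq0 => /eqP PG; move/eqP: Py; rewrite PG mevalC.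
  by rewrite pnatr_eq0 (gtn_eqF (cardG_gt0 G)).
(* Modulo [K] the coefficients of the orbit polynomial of ['X_i] may be replaced by their values on
   the fibre, which leaves an equation with constant coefficients. *)
have Kint i : exists2 P : {poly C}, P != 0 &
    K (\sum_(j < size P) P`_j *: 'X_i ^+ j).
  pose O := orbit_poly W ('X_i : {mpoly C[n.+1]}).
  have [Q QE] := choice (fun j => gen _ (orbit_poly_inv W 'X_i j)).
  pose P := \poly_(j < #|G|.+1) (Q j).@[y].
  (* By independence the leading coefficient 1 is only expressed by the constant polynomial 1, so
     that [P] is not 0. *)
  have Qlead : Q #|G| = 1.
    apply/eqP; rewrite -subr_eq0; apply/eqP; apply: indep.
    rewrite raddfB /= QE rmorph1; apply/eqP; rewrite subr_eq0.
    have := orbit_poly_monic W ('X_i : {mpoly C[n.+1]}).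
    by rewrite monicE lead_coefE size_orbit_poly.
  have P0 : P != 0.
    apply/eqP=> /polyP/(_ #|G|); rewrite coef_poly ltnSn Qlead meval1 coef0.
    by move/eqP; rewrite oner_eq0.
  exists P => //.
  have -> : \sum_(j < size P) P`_j *: 'X_i ^+ j =
      \sum_(j < #|G|.+1) (Q j).@[y] *: ('X_i : {mpoly C[n.+1]}) ^+ j.
    rewrite (big_ord_widen _ (fun j => P`_j *: 'X_i ^+ j) (size_poly _ _)).
    rewrite big_mkcond; apply: eq_bigr => j _; case: ltnP => [_|le_j].
      by rewrite coef_poly ltn_ord.
    have := nth_default 0 le_j; rewrite coef_poly ltn_ord => ->.
    by rewrite scale0r.
  have OE := orbit_poly_root W ('X_i : {mpoly C[n.+1]}).
  rewrite horner_coef size_orbit_poly in OE.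
  rewrite -[X in K X]subr0 -[X in _ - X]OE -sumrB; apply: prodspan_sum => j _.
  rewrite -mul_mpolyC -mulrBl -QE -opprB mulNr -mulrN mulrC.
  by apply: prodspanM (KA _) => //.
have [v vK] := zero_of_proper_ideal (prodspan0 _ _) (@prodspanD _ _ _ _)
  (fun r p => @prodspanM _ _ _ _ r p (fun b _ => I)) K1 Kint.
exists v => j; have := vK _ (KA 'X_j).
rewrite comp_mpolyXU -tnth_nth mevalXU evB evC => /eqP.
by rewrite subr_eq0 => /eqP.
Qed.

Variables (m : nat) (phi : 'I_m -> homVd W) (e : 'I_m -> nat).
Hypothesis phi_basis : is_basis (fun _ => True) phi.
Hypothesis phi_homog : forall i x, phi i x \is (e i).-homog.

Local Notation L := (@ord_max n).

Lemma faithful_eq1 g : g \in G -> W g = 1%:M -> g = 1%g.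
Proof.
move=> Gg Wg; apply/set1P; apply: (subsetP W_faithful).
by rewrite inE Gg mul1mx Wg eqxx.
Qed.

(* In the proof, [u] annihilates the differentials at [v] of all invariants, [th] is
   the averaged interpolating vector field, and [A i] are its coefficients. *)
Lemma distinguished_point_regular v : mx_irreducible W ->
  (forall i, 0 < e i <= (ds L).+1)%N ->
  (forall j, ev (tnth f j) v = (j == L)%:R) ->
  forall g, g \in G -> v *m W g = v -> g = 1%g.
Proof.
move=> Wirr e_bound vf g0 Gg0 vg0; apply: faithful_eq1 => //.
apply/row_matrixP=> j0; apply/eqP; rewrite -subr_eq0; apply: contraT.
pose u := delta_mx 0 j0 *m W g0 - delta_mx 0 j0 : 'rV[C]_n.+1.
rewrite [row j0 (W g0)]rowE row1 -/u => u0.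
have du p : p \in invS_pred W -> dirder p v u = 0.
  by move=> pW; apply: invS_dirder0 pW Gg0 vg0.
pose D := (ds L).+1.
have [z z_prim] := closed_prim_root C (ltn0Sn (ds L)).
have zD : z ^+ D = 1 := prim_expr_order z_prim.
have zk0 k : z ^+ k != 0.
  by rewrite expf_neq0 //; apply: contraTneq (oner_neq0 C) => z0;
     rewrite -zD z0 expr0n eqxx.
(* All multiples of [v] by powers of [z] take part in the average, so the interpolant must vanish to
   second order at each of their images other than [v]. *)
pose orb := [seq (z ^+ k *: v) *m W g | k <- iota 0 D, g <- enum G].
pose s := filter (predC1 v) orb.
have vs : v \notin s by rewrite mem_filter /= eqxx.
have orbP (k : 'I_D) g : g \in G -> (z ^+ k *: v) *m W g != v ->
    (z ^+ k *: v) *m W g \in s.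
  move=> Gg ne; rewrite mem_filter /= ne; apply/allpairsP; exists (val k, g).
  by split; rewrite ?mem_iota ?mem_enum //=.
have [q [qv dqv qs]] := hermite_points vs.
pose l (x : 'cV[C]_n.+1) := (v *m x) 0 0.
have l_lin : linear (l : _ -> C^o) by move=> c x y; rewrite /l mulmxDr -scalemxAr !mxE.
pose th0 := avgmap W (actVd W) l q.
have [a aE] := homVd_span phi_basis
  (avgmap_equivariant W (actVd_linear W) (@actVdM _ _ _ _ W) q l_lin).
pose th x := \sum_(k < D) (z ^+ k)^-1 *: lsub (z ^+ k)%:M (th0 x).
pose A i := \sum_(k < D) (z ^+ k) ^+ (e i).-1 *: lsub (z ^+ k)%:M (invS_val (a i)).
have thE x : th x = \sum_i A i * phi i x.
  rewrite /th /A; under [RHS]eq_bigr do rewrite mulr_suml.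
  rewrite exchange_big /=; apply: eq_bigr => k _.
  rewrite [th0 x]aE (raddf_sum (lsub (z ^+ k)%:M)) scaler_sumr; apply: eq_bigr => i _ /=.
  rewrite rmorphM /= (lsub_scalar _ (phi_homog i x)) -scalerAl -!scalerAr scalerA.
  congr (_ *: _); have /andP[ei _] := e_bound i.
  by rewrite -{1}(prednK ei) exprS mulrA mulVf ?mul1r.
have AW i : A i \in invS_pred W.
  by apply: rpred_sum => k _; apply: rpredZ; apply: lsub_scalar_inv; apply: valP.
have ev_inv k p : p \in invS_pred W -> ev (lsub (z ^+ k)%:M p) v = ev p v.
  move=> /(basic_invariants_generate sigma_basis sigma_homog)[P <-].
  rewrite ev_lsub !ev_comp; apply: meval_eq => j.
  rewrite -ev_lsub (lsub_scalar _ (tilde_homog sigma_homog j)) evZ vf.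
  case: eqP => [->|_]; last by rewrite mulr0.
  by rewrite exprAC zD expr1n mulr1.
(* A full geometric sum in the power of [z] with exponent e_i - 1. This power is not 1 because e_i -
   1 lies strictly between 0 and [D]. *)
have evA i : e i != 1%N -> ev (A i) v = 0.
  move=> ei1; rewrite ev_sum.
  under eq_bigr => k _ do rewrite evZ ev_inv ?(valP (a i)) // exprAC.
  rewrite -mulr_suml; set x := z ^+ _.
  have x1 : x - 1 != 0.
    rewrite subr_eq0 -(prim_order_dvd z_prim); have := e_bound i; move: ei1.
    by case: (e i) => [|[|k]] //= _ lek; rewrite gtnNdvd.
  suff -> : \sum_(k < D) x ^+ k = 0 by rewrite mul0r.
  by apply: (mulfI x1); rewrite -subrX1 mulr0 exprAC zD expr1n subrr.
have cex i : exists c : C, e i = 1%N -> forall x, phi i x = c *: linform x.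
  have [ei|ei] := eqVneq (e i) 1%N; last by exists 0 => ei1; rewrite ei1 in ei.
  have [|c cE] := homVd_degree1_scalar (s := phi i) Wirr; last by exists c.
  by move=> x; have := phi_homog i x; rewrite ei.
have [c cE] := choice cex.
(* At [v], and to first order along [u], the field [th] is [Lam] times the Euler field. *)
pose Lam := \sum_i ev (A i) v * c i.
have evth x : ev (th x) v = Lam * (v *m x) 0 0.
  rewrite thE ev_sum mulr_suml; apply: eq_bigr => i _; rewrite evM.
  have [ei|/evA->] := eqVneq (e i) 1%N; last by rewrite !mul0r.
  by rewrite cE // evZ ev_linform mulrA.
have dth x : dirder (th x) v u = Lam * (u *m x) 0 0.
  rewrite thE dirder_sum mulr_suml; apply: eq_bigr => i _.
  rewrite dirderM du // mul0r add0r.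
  have [ei|/evA->] := eqVneq (e i) 1%N; last by rewrite !mul0r.
  by rewrite cE // dirderZ dirder_linform mulrA.
have dth0 x : dirder (th x) v u = 0.
  rewrite dirder_sum big1 // => k _; rewrite dirderZ dirder_lsub.
  rewrite dirder_sum big1 ?mulr0 // => g Gg; rewrite dirderZ actSE dirder_lsub.
  rewrite mul_mx_scalar; have [->|ne] := eqVneq ((z ^+ k *: v) *m W g) v.
    by rewrite dqv mulr0.
  by have [_ ->] := qs _ (orbP k g Gg ne); rewrite mulr0.
(* Only pairs (k, g) for which the image of [v] is [v] contribute, each adding the value [v]; the
   pair (0, 1) makes the count nonzero. *)
pose N := (\sum_(k < D) \sum_(g in G) ((z ^+ k *: v) *m W g == v))%N.
have evthN x : ev (th x) v = N%:R * (v *m x) 0 0.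
  rewrite ev_sum /N natr_sum mulr_suml; apply: eq_bigr => k _.
  rewrite evZ ev_lsub mul_mx_scalar ev_sum natr_sum mulr_suml mulr_sumr.
  apply: eq_bigr => g Gg; rewrite evZ actSE ev_lsub.
  have [vE|ne] := eqVneq ((z ^+ k *: v) *m W g) v; last first.
    by have [-> _] := qs _ (orbP k g Gg ne); rewrite !mulr0 mul0r.
  rewrite vE qv mulr1 mul1r /l /actVd mulmxA -{1}vE -mulmxA -mulmxA.
  rewrite (mulmxA (W g)) -repr_mxM ?groupV // mulgV repr_mx1 mul1mx.
  by rewrite -scalemxAl mxE mulKf.
have N0 : N%:R != 0 :> C.
  rewrite pnatr_eq0 -lt0n /N (bigD1 ord0) //= (bigD1 1%g) //=.
  by rewrite expr0 scale1r repr_mx1 mulmx1 eqxx.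
have v0 : v != 0.
  apply/eqP=> v0; have /esym/eqP := vf L.
  by rewrite eqxx v0 -coef0_ev tnth_basic tilde_coef0 oner_eq0.
have LamN : Lam = N%:R.
  have [j vj] : exists j, v 0 j != 0.
    apply/existsP; apply: contraNT v0 => /existsPn v0.
    by apply/eqP/rowP=> j; rewrite mxE; apply/eqP; rewrite -[_ == _]negbK v0.
  have := evth (delta_mx j 0); rewrite evthN -colE mxE => /(mulIf vj).
  by move->.
case/eqP: u0; apply/rowP=> j; have := dth (delta_mx j 0).
rewrite dth0 LamN -colE !mxE => /esym/eqP.
by rewrite mulf_eq0 (negPf N0) => /eqP.
Qed.

(** The polynomial picked by [xget] is [P] itself, by independence of the f_j. *)
Lemma basic_coefE P i :
  basic_coef (fun j => tilde (sigma j)) i (P \mPo f) = P@_U_(i).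
Proof.
rewrite /basic_coef; set A := (X in classical_sets.xget _ X).
have AP : A P by [].
congr (_ @_ _); apply/eqP; rewrite -subr_eq0; apply/eqP.
apply: (basic_invariants_independent sigma_basis sigma_homog W_faithful).
have : A (classical_sets.xget 0 A) by apply: classical_sets.xgetI AP.
by rewrite raddfB /= => ->; rewrite subrr.
Qed.

Lemma pairing_inv (s : homV W) (t : homVd W) :
  duality_pairing s t \in invS_pred W.
Proof.
have [sL sG] := homWH_equivariant s; have [tL tG] := homWH_equivariant t.
apply/invS_predP=> g Gg; rewrite raddf_sum /=.
under eq_bigr => i _.
  rewrite rmorphM /= -sG // -tG // [actV W g _]rV_coordE [actVd W g _]cV_coordE.
  rewrite (linear_comb _ _ _ sL) (linear_comb _ _ _ tL) mulr_suml.
  under eq_bigr do rewrite mulr_sumr.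
  over.
rewrite exchange_big /=; apply: eq_bigr => k _.
rewrite exchange_big /= (bigD1 k) //= [X in _ + X]big1 ?addr0.
  under eq_bigr do rewrite -scalerAl -scalerAr scalerA.
  rewrite -scaler_suml -[RHS]scale1r; congr (_ *: _).
  transitivity ((W g *m W g^-1%g) k k).
    rewrite mxE; apply: eq_bigr => i _.
    by rewrite /actV /actVd -rowE -colE !mxE mulrC.
  by rewrite -repr_mxM ?groupV // mulgV repr_mx1 mxE eqxx.
move=> l lk; under eq_bigr do rewrite -scalerAl -scalerAr scalerA.
rewrite -scaler_suml; suff -> : \sum_i (actV W g (vV C i)) 0 k *
    (actVd W g (vVd C i)) l 0 = 0 by rewrite scale0r.
transitivity ((W g *m W g^-1%g) l k).
  rewrite mxE; apply: eq_bigr => i _.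
  by rewrite /actV /actVd -rowE -colE !mxE mulrC.
by rewrite -repr_mxM ?groupV // mulgV repr_mx1 mxE (negPf lk).
Qed.

Lemma pairing_homog i j : duality_pairing (sigma j) (phi i) \is (ds j + e i).-homog.
Proof. by apply: rpred_sum => k _; apply: dhomogM. Qed.

Local Notation wt := (wdeg (fun j => (ds j).+1)).

Lemma weighted_support P E : P \mPo f \is E.-homog ->
  forall k, k \in msupp P -> wt k = E.
Proof.
move=> PE k; have fh j : tnth f j \is (wt U_(j)%MM).-homog.
  by rewrite wdeg1; apply: tilde_homog.
have PP : pihomog (Measure.clone _ wt _) E P = P.
  apply/eqP; rewrite -subr_eq0; apply/eqP.
  apply: (basic_invariants_independent sigma_basis sigma_homog W_faithful).
  by rewrite raddfB /= -(pihomog_comp _ _ fh) (pihomog_dE PE) subrr.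
rewrite mcoeff_msupp -PP mcoeff_pihomog /=.
by case: (wt k =P E) => // _; rewrite eqxx.
Qed.

Lemma dualityD_degree i j :
  dualityD sigma (phi i) (sigma j) != 0 -> (ds j + e i = (ds L).+1)%N.
Proof.
have [P PE] := basic_invariants_generate sigma_basis sigma_homog
  (pairing_inv (sigma j) (phi i)).
rewrite /dualityD -PE basic_coefE -mcoeff_msupp => PL.
have Phom : P \mPo f \is (ds j + e i).-homog by rewrite PE pairing_homog.
by rewrite -(weighted_support Phom PL) wdeg1.
Qed.

(* Only powers of [f_n] are nonzero at [v], and [ds j + e i] lies strictly between 0
   and twice the degree of [f_n], so the pairing matrix consists of the values of the
   invariants [duality_pairing (sigma j) (phi i)] at [v]. *)
Lemma dualityD_nondegenerate : mx_irreducible W ->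
  (forall i, 0 < e i <= (ds L).+1)%N -> (forall j, ds j <= ds L)%N ->
  exists B, B *m (\matrix_(i, j) dualityD sigma (phi i) (sigma j)) = 1%:M.
Proof.
move=> Wirr e_bound ds_bound.
have [v vf] := fiber_point (fun j => (j == L)%:R).
have v_reg := distinguished_point_regular Wirr e_bound vf.
pose T := \matrix_(i, k) ev (phi i (vVd C k)) v.
pose S := \matrix_(j, k) ev (sigma j (vV C k)) v.
have -> : \matrix_(i, j) dualityD sigma (phi i) (sigma j) = T *m S^T.
  apply/matrixP=> i j; rewrite !mxE.
  have [P PE] := basic_invariants_generate sigma_basis sigma_homog
    (pairing_inv (sigma j) (phi i)).
  rewrite /dualityD -PE basic_coefE; transitivity (ev (P \mPo f) v); last first.
    rewrite PE ev_sum; apply: eq_bigr => k _.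
    by rewrite evM !mxE mulrC.
  have Phom : P \mPo f \is (ds j + e i).-homog by rewrite PE pairing_homog.
  rewrite ev_comp mevalE {1}[P]mpolyE raddf_sum big_seq [RHS]big_seq /=.
  apply: eq_bigr => k kP; rewrite mcoeffZ mcoeffX; congr (_ * _).
  case: eqP => [->|kL].
    rewrite big1 // => l _; rewrite vf mnm1E eq_sym.
    by case: eqP; rewrite ?expr1n ?expr0.
  have [l /andP[lL kl]] : exists l, (l != L) && (k l != 0)%N.
    apply/existsP; apply: contra_notT kL => /existsPn k0; apply/mnmP => l.
    have k0' l' : l' != L -> k l' = 0%N.
      by move=> l'L; have := k0 l'; rewrite l'L negbK => /eqP.
    have := weighted_support Phom kP; rewrite /wdeg (bigD1 L) //= big1 ?addn0.
      move=> kE; rewrite mnm1E eq_sym; have [->|/k0'//] := eqVneq l L.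
      have := e_bound i; have := ds_bound j; move: kE.
      case: (k L) => [|[|k']] //=; rewrite ?mul0n; first by lia.
      by rewrite !mulSn; lia.
    by move=> l' /k0'->.
  by rewrite (bigD1 l) //= vf (negPf lL) expr0n (negPf kl) mul0r.
pose s := [seq v *m W g | g <- enum (G :\ 1%g)].
have vs : v \notin s.
  apply/mapP=> -[g]; rewrite mem_enum !inE => /andP[g1 Gg] /esym vg.
  by case/eqP: g1; apply: v_reg.
have [h hv hs] := separate_points vs.
have ev_avg (U : lmodType C) (aU : gT -> U -> U) (l : U -> C) x :
    aU 1%g x = x -> ev (avgmap W aU l h x) v = l x.
  move=> aU1; rewrite ev_sum (bigD1 1%g) //= big1 => [|g /andP[Gg g1]].
    by rewrite evZ actS1 hv mulr1 invg1 aU1 addr0.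
  rewrite evZ actSE ev_lsub hs ?mulr0 //.
  by apply/mapP; exists g => //; rewrite mem_enum !inE g1.
(* As [v] has trivial stabilizer, some equivariant field takes the value [z] at [v]; its coordinates
   evaluated at [v] express [z] in the rows of [T]. *)
have Tfull (z : 'rV[C]_n.+1) : exists a : 'rV[C]_m, z = a *m T.
  pose l (x : 'cV[C]_n.+1) := (z *m x) 0 0.
  have l_lin : linear (l : _ -> C^o).
    by move=> c x y; rewrite /l mulmxDr -scalemxAr !mxE.
  have [a aE] := homVd_span phi_basis
    (avgmap_equivariant W (actVd_linear W) (@actVdM _ _ _ _ W) h l_lin).
  exists (\row_i ev (invS_val (a i)) v); apply/rowP=> k.
  transitivity (l (vVd C k)); first by rewrite /l -colE mxE.
  rewrite -(ev_avg _ (actVd W)); last by rewrite /actVd repr_mx1 mul1mx.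
  rewrite aE ev_sum mxE; apply: eq_bigr => i _.
  by rewrite evM !mxE.
have Sfull (z : 'cV[C]_n.+1) : exists a : 'rV[C]_n.+1, z^T = a *m S.
  pose l (x : 'rV[C]_n.+1) := (x *m z) 0 0.
  have l_lin : linear (l : _ -> C^o).
    by move=> c x y; rewrite /l mulmxDl -scalemxAl !mxE.
  have [a aE] := homV_span sigma_basis
    (avgmap_equivariant W (actV_linear W) (@actVM _ _ _ _ W) h l_lin).
  exists (\row_i ev (invS_val (a i)) v); apply/rowP=> k.
  transitivity (l (vV C k)); first by rewrite /l -rowE !mxE.
  rewrite -(ev_avg _ (actV W)); last by rewrite /actV invg1 repr_mx1 mulmx1.
  rewrite aE ev_sum mxE; apply: eq_bigr => i _.
  by rewrite evM !mxE.
have [A AT] : exists A, A *m T = 1%:M.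
  have [a aE] := choice (fun k => Tfull (row k 1%:M)).
  exists (\matrix_k a k); apply/row_matrixP=> k.
  by rewrite row_mul rowK -aE.
have [B BS] : exists B, B *m S = 1%:M.
  have [b bE] := choice (fun k => Sfull (col k 1%:M)).
  exists (\matrix_k b k); apply/row_matrixP=> k.
  by rewrite row_mul rowK -bE tr_col trmx1.
(* [S] is square, so its left inverse is also a right inverse; [T] has [m] rows and only comes with
   a left inverse. *)
have SB : S *m B = 1%:M by apply: mulmx1C.
exists (B^T *m A); rewrite mulmxA -(mulmxA _ A) AT mulmx1.
by rewrite -trmx_mul SB trmx1.
Qed.

End DualityCore.

(** * The duality map on derivations *)

Section DegreePredicate.

Variables (F : fieldType) (n : nat).
Implicit Types p q : {mpoly F[n]}.

Lemma S_0 k : S_ k (0 : {mpoly F[n]}).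
Proof. by case: k => //= e; apply: rpred0. Qed.

Lemma S_D k p q : S_ k p -> S_ k q -> S_ k (p + q).
Proof. by case: k => /= e; [apply: rpredD | move=> -> ->; rewrite addr0]. Qed.

Lemma S_Z k c p : S_ k p -> S_ k (c *: p).
Proof. by case: k => /= e; [apply: rpredZ | move=> ->; rewrite scaler0]. Qed.

Lemma S_sum k (I : Type) (r : seq I) (P : pred I) (p : I -> {mpoly F[n]}) :
  (forall i, P i -> S_ k (p i)) -> S_ k (\sum_(i <- r | P i) p i).
Proof. by move=> pk; elim/big_ind: _ => //; [apply: S_0 | apply: S_D]. Qed.

Lemma S_M k l p q : S_ k p -> S_ l q -> S_ (k + l) (p * q).
Proof.
case: k => k; last by move=> /= -> _; rewrite mul0r; apply: S_0.
case: l => l; last by move=> /= _ ->; rewrite mulr0; apply: S_0.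
exact: dhomogM.
Qed.

End DegreePredicate.

Section LinearAlgebra.

Variable F : fieldType.

Lemma has_dim_le (E : lmodType F) (P : E -> Prop) k l :
  has_dim P k -> has_dim P l -> (k <= l)%N.
Proof.
move=> [b [bP bU]] [c [cP cU]].
have bc i : exists x : 'rV[F]_l, b i = \sum_j x 0 j *: c j.
  by have [x []] := cU _ (bP i); exists x.
have [X XE] := choice bc.
have := rank_leq_col (\matrix_i X i); apply: leq_trans.
suff /eqP-> : row_free (\matrix_i X i) by [].
apply/inj_row_free => v vX0.
have v0 : \sum_i v 0 i *: b i = 0.
  under eq_bigr do rewrite XE scaler_sumr.
  rewrite exchange_big big1 //= => j _.
  under eq_bigr do rewrite scalerA.
  rewrite -scaler_suml; have /rowP/(_ j) := vX0; rewrite !mxE => E0.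
  suff -> : \sum_i v 0 i * X i 0 j = 0 by rewrite scale0r.
  by rewrite -[RHS]E0; apply: eq_bigr => i _; rewrite !mxE.
(* [P] may fail at 0, so [v] cannot be compared with zero coordinates. It is added to the
   coordinates of a basis vector instead, which requires [k] to be positive. *)
case: k b v bP bU bc X XE vX0 v0 => [|k] b v bP bU _ _ _ _ v0.
  by apply/rowP=> -[].
have [w [b0 wU]] := bU _ (bP ord0).
have wE : w = w + v.
  apply: wU; rewrite [LHS]b0; under [RHS]eq_bigr do rewrite mxE scalerDl.
  by rewrite big_split /= v0 addr0.
by apply: (addrI w); rewrite addr0 -wE.
Qed.

Lemma has_dim_uniq (E : lmodType F) (P : E -> Prop) k l :
  has_dim P k -> has_dim P l -> k = l.
Proof.
by move=> bP cP; apply/eqP; rewrite eqn_leq !(has_dim_le (P := P)).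
Qed.

Lemma mulmx1C_eq k l (A : 'M[F]_(k, l)) (B : 'M[F]_(l, k)) :
  k = l -> A *m B = 1%:M -> B *m A = 1%:M.
Proof. by move=> kl; case: _ / kl B => B in A *; apply: mulmx1C. Qed.

End LinearAlgebra.

Section Derivations.

Variables (C : numClosedFieldType) (gT : finGroupType) (G : {group gT}).
Variables (n : nat) (W : mx_representation C G n.+1).
Implicit Types (p q : {mpoly C[n.+1]}).

Lemma der_sumE (A : comAlgType C) (I : Type) (r : seq I) (P : pred I)
    (t : I -> der A) x :
  (\sum_(i <- r | P i) t i) x = \sum_(i <- r | P i) t i x.
Proof. by elim/big_rec2: _ => // i y1 y2 _ <-. Qed.

Lemma der_C (A : comAlgType C) (t : der A) c : t c%:A = 0.
Proof.
have [tL tM] := derP t; have t1 : t 1 = 0.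
  by have := tM 1 1; rewrite !mulr1 mul1r => /eqP; rewrite -subr_eq0 opprD addNKr oppr_eq0 => /eqP.
have t0 : t 0 = 0.
  by have := tL (-1) 0 0; rewrite scaleN1r addNr => ->; rewrite scaleN1r addNr.
by have := tL c 1 0; rewrite addr0 t0 addr0 t1 scaler0.
Qed.

Lemma der_mpoly_ext (s t : der {mpoly C[n.+1]}) :
  (forall i, s 'X_i = t 'X_i) -> s = t.
Proof.
move=> st; have [sL sM] := derP s; have [tL tM] := derP t.
apply/val_inj/funext => p /=; elim/mpoly_ring_ind: p => [c|i|p q IHp IHq|p q IHp IHq].
- by rewrite -[c%:MP]mulr1 mul_mpolyC !der_C.
- exact: st.
- have := sL 1 p q; have := tL 1 p q; rewrite !scale1r => -> ->.
  by rewrite IHp IHq.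
- by rewrite sM tM IHp IHq.
Qed.

Lemma invDer_equivariant (t : invDer W) :
  equivariant W (actVd W) (fun x => t (linform x)).
Proof.
have [tL _] := derP (invDer_val t); split=> [c x y|g x Gg].
  by rewrite linform_linear tL.
rewrite /actVd -actS_linform -(invDerP t Gg (actS W g (linform x))).
by rewrite -actSM ?groupV // mulVg actS1.
Qed.

Lemma invDer_ext (s t : invDer W) :
  (forall x, s (linform x) = t (linform x)) -> s = t.
Proof.
by move=> st; apply/val_inj/der_mpoly_ext => i /=; rewrite -linform_vVd st.
Qed.

Lemma equivariant_invDer (s : 'cV[C]_n.+1 -> {mpoly C[n.+1]}) :
  equivariant W (actVd W) s -> exists t : invDer W, forall x, t (linform x) = s x.
Proof.
move=> [sL sG]; pose t p := \sum_i p^`M(i) * s (vVd C i).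
have tX x : t (linform x) = s x.
  rewrite [in RHS](cV_coordE x) (linear_comb _ _ _ sL); apply: eq_bigr => i _.
  rewrite /linform raddf_sum (bigD1 i) //= big1 => [|j /negPf ji].
    by rewrite mderivZ mderivXU eqxx addr0 -scalerAl mul1r.
  by rewrite mderivZ mderivXU ji mpolyC0 scaler0.
have tD : t \in @der_pred C {mpoly C[n.+1]}.
  apply/asboolP; split=> [c p q|p q]; rewrite /t.
    rewrite scaler_sumr -big_split; apply: eq_bigr => i _ /=.
    by rewrite mderivD mderivZ mulrDl -scalerAl.
  rewrite mulr_sumr mulr_suml -big_split; apply: eq_bigr => i _ /=.
  by rewrite mderivM; ring.
have tW : Der tD \in invDer_pred W.
  apply/asboolP => g Gg p /=; rewrite -[RHS](actSKV W Gg); congr (actS W g _).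
  rewrite /t raddf_sum; under eq_bigr do rewrite actSE mderiv_lsub mulr_suml.
  rewrite exchange_big; apply: eq_bigr => k _ /=.
  rewrite rmorphM /= -(sG g^-1%g) ?groupV // [actVd W _ _]cV_coordE.
  rewrite (linear_comb _ _ _ sL) mulr_sumr; apply: eq_bigr => i _.
  by rewrite -scalerAl scalerAr /actVd -colE mxE.
by exists (InvDer tW).
Qed.

End Derivations.

(** * Bases of the two modules of derivations and the matrix of the map *)

Section Assembly.

Variables (C : numClosedFieldType) (gT : finGroupType) (G : {group gT}).
Variables (n : nat) (W : mx_representation C G n.+1).
Variable sigma : 'I_n.+1 -> homV W.
Hypothesis sigma_basis : is_basis (fun _ => True) sigma.
Variable ds : 'I_n.+1 -> nat.
Hypothesis sigma_homog : forall j v, sigma j v \is (ds j).-homog.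
Hypothesis W_faithful : mx_faithful W.
Implicit Types (P Q : {mpoly C[n.+1]}).

Local Notation f := (basic_invariants sigma).
Local Notation L := (@ord_max n).

Lemma comp_inv P : P \mPo f \in invS_pred W.
Proof.
rewrite comp_mpolyE rpred_sum // => m _; apply: rpredZ.
by apply: rpred_prod => j _; rewrite rpredX // tnth_basic; apply: valP.
Qed.

(** With [cf_surj] and [cf_inj], the isomorphism of Sym(Hom_W(V,H)) with S^W. *)
Definition cf P : invS W := InvS (comp_inv P).

Lemma der_invS_scaleE (a : invS W) (t : der (invS W)) p :
  invS_val ((a *: t) p) = invS_val a * invS_val (t p).
Proof. by []. Qed.

Lemma mcoeff_linear k : linear (mcoeff k : {mpoly C[n.+1]} -> C^o).
Proof. by move=> x P Q; rewrite mcoeffD mcoeffZ. Qed.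

Lemma comp_basic_linear : linear (comp_mpoly f).
Proof. by move=> c P Q; rewrite linearP. Qed.

Lemma cf_surj p : exists P, cf P = p.
Proof.
have [P PE] := basic_invariants_generate sigma_basis sigma_homog (valP p).
by exists P; apply: val_inj.
Qed.

Lemma cf_inj : injective cf.
Proof.
move=> P Q /(congr1 (@invS_val _ _ _ _ W)) /= PQ.
apply/eqP; rewrite -subr_eq0; apply/eqP.
apply: (basic_invariants_independent sigma_basis sigma_homog W_faithful).
by rewrite raddfB /= PQ subrr.
Qed.

Lemma cf_linear : linear cf.
Proof. by move=> c P Q; apply: val_inj; rewrite /= linearP. Qed.

Lemma cfM P Q : cf (P * Q) = cf P * cf Q.
Proof. by apply: val_inj; rewrite /= rmorphM. Qed.

Lemma cfD P Q : cf (P + Q) = cf P + cf Q.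
Proof. by apply: val_inj; rewrite /= raddfD. Qed.

Lemma cfX j : cf 'X_j = tilde (sigma j).
Proof.
apply: val_inj; rewrite /= comp_mpolyXU -tnth_nth tnth_basic.
by [].
Qed.

Lemma cfC c : cf c%:MP = c%:A.
Proof. by apply: val_inj; rewrite /= comp_mpolyC -mul_mpolyC mulr1. Qed.

Lemma derInv_ext (s t : der (invS W)) :
  (forall j, s (tilde (sigma j)) = t (tilde (sigma j))) -> s = t.
Proof.
move=> st; have [sL sM] := derP s; have [tL tM] := derP t.
apply/val_inj/funext => p /=; have [P <-] := cf_surj p.
elim/mpoly_ring_ind: P {p} => [c|i|P Q IHP IHQ|P Q IHP IHQ].
- by rewrite cfC !der_C.
- by rewrite cfX st.
- rewrite cfD; have := sL 1 (cf P) (cf Q); have := tL 1 (cf P) (cf Q).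
  by rewrite !scale1r => -> ->; rewrite IHP IHQ.
- by rewrite cfM sM tM IHP IHQ.
Qed.

Lemma partial_exists j :
  exists D : der (invS W), forall P, D (cf P) = cf P^`M(j).
Proof.
have [Q QE] := choice cf_surj.
have QK P : Q (cf P) = P by apply: cf_inj; rewrite QE.
pose D p := cf (Q p)^`M(j).
have DE P : D (cf P) = cf P^`M(j) by rewrite /D QK.
have DD : D \in @der_pred C (invS W).
  apply/asboolP; split=> [c p q|p q];
    have [P <-] := cf_surj p; have [P' <-] := cf_surj q.
    by rewrite -cf_linear !DE mderivD mderivZ cf_linear.
  by rewrite -cfM !DE mderivM cfD !cfM addrC.
by exists (Der DD).
Qed.

Hypothesis W_reflections : <<[set g in G | reflection W g]>>%g = G :> {set gT}.
Variables (m : nat) (phi : 'I_m -> homVd W) (e : 'I_m -> nat).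
Hypothesis phi_basis : is_basis (fun _ => True) phi.
Hypothesis phi_homog : forall i x, phi i x \is (e i).-homog.

Lemma coord_uniq (a b : 'I_m -> invS W) :
  (forall x, \sum_i invS_val (a i) * phi i x = \sum_i invS_val (b i) * phi i x) ->
  forall i, a i = b i.
Proof.
move=> ab i; apply/eqP; rewrite -subr_eq0; apply/eqP.
apply: (homWH_free W_reflections phi_homog phi_basis (a := fun i => a i - b i)).
move=> x; have := ab x => /eqP; rewrite -subr_eq0 -sumrB => /eqP abx.
by rewrite -[RHS]abx; apply: eq_bigr => j _; rewrite -mulrBl.
Qed.

Variable dpart : 'I_n.+1 -> der (invS W).
Hypothesis dpartE : forall j P, dpart j (cf P) = cf P^`M(j).
Variable coord : invDer W -> 'I_m -> invS W.
Hypothesis coordE : forall (t : invDer W) x,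
  t (linform x) = \sum_i invS_val (coord t i) * phi i x.
Variable tphi : 'I_m -> invDer W.
Hypothesis tphiE : forall i x, tphi i (linform x) = phi i x.

Local Notation c i j := (dualityD sigma (phi i) (sigma j)).

Lemma dpart_tilde j k : dpart j (tilde (sigma k)) = (k == j)%:R.
Proof.
rewrite -cfX dpartE mderivXU cfC; case: (k == j); first by rewrite scale1r.
by rewrite scale0r.
Qed.

Lemma coord_linear a t u i : coord (a *: t + u) i = a * coord t i + coord u i.
Proof.
move: i; apply: coord_uniq => x; rewrite -coordE.
transitivity (invS_val a * t (linform x) + u (linform x)) => //.
rewrite !coordE mulr_sumr -big_split; apply: eq_bigr => i _ /=.
by rewrite mulrDl mulrA.
Qed.

Lemma tphi_comb (a : 'I_m -> invS W) x :
  (\sum_i a i *: tphi i) (linform x) = \sum_i invS_val (a i) * phi i x.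
Proof.
have E (r : seq 'I_m) : (\sum_(i <- r) a i *: tphi i) (linform x) =
    \sum_(i <- r) invS_val (a i) * phi i x.
  elim: r => [|i r IHr]; first by rewrite !big_nil.
  by rewrite !big_cons -IHr -tphiE.
exact: E.
Qed.

Lemma coord_comb (a : 'I_m -> invS W) i : coord (\sum_j a j *: tphi j) i = a i.
Proof. by move: i; apply: coord_uniq => x; rewrite -coordE tphi_comb. Qed.

Lemma invDer_coordE t : t = \sum_i coord t i *: tphi i.
Proof. by apply: invDer_ext => x; rewrite tphi_comb coordE. Qed.

Definition dualityPhi (t : invDer W) : der (invS W) :=
  \sum_j (\sum_i c i j *: coord t i) *: dpart j.

Lemma dualityPhi_linear : linear dualityPhi.
Proof.
move=> a t u; rewrite scaler_sumr -big_split; apply: eq_bigr => j _ /=.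
rewrite scalerA -scalerDl; congr (_ *: _).
rewrite mulr_sumr -big_split; apply: eq_bigr => i _ /=.
by rewrite coord_linear scalerDr scalerAr.
Qed.

HB.instance Definition _ :=
  GRing.isLinear.Build (invS W) (invDer W) (der (invS W)) _ dualityPhi
    dualityPhi_linear.

Lemma dualityPhi_tilde t k :
  dualityPhi t (tilde (sigma k)) = \sum_i c i k *: coord t i.
Proof.
rewrite /dualityPhi der_sumE (bigD1 k) //= [X in _ + X]big1 => [|j /negPf jk].
  by rewrite dpart_tilde eqxx mulr1 addr0.
by rewrite dpart_tilde eq_sym jk mulr0.
Qed.

(** Not formal: [basic_coef] goes through a chosen polynomial, and it is the independence of the f_j
    that makes it linear. *)
Lemma dualityD_comb (b : 'I_m -> C) (a : 'I_n.+1 -> C) :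
  dualityD sigma (\sum_i b i *: phi i) (\sum_j a j *: sigma j) =
  \sum_j a j * \sum_i b i * c i j.
Proof.
have Pex i j : exists P, P \mPo f = duality_pairing (sigma j) (phi i).
  exact: (basic_invariants_generate sigma_basis sigma_homog
    (pairing_inv (sigma j) (phi i))).
have [P' PE'] := choice (fun z : 'I_m * 'I_n.+1 => Pex z.1 z.2).
pose P i j := P' (i, j).
have PE i j : P i j \mPo f = duality_pairing (sigma j) (phi i) := PE' (i, j).
have cE i j : c i j = (P i j)@_U_(L).
  by rewrite /dualityD -PE (basic_coefE sigma_basis sigma_homog W_faithful).
pose Q := \sum_j a j *: \sum_i b i *: P i j.
have QE : Q \mPo f =
    duality_pairing (\sum_j a j *: sigma j) (\sum_i b i *: phi i).
  rewrite /duality_pairing (linear_comb _ _ _ comp_basic_linear).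
  under eq_bigr do rewrite (linear_comb _ _ _ comp_basic_linear).
  under [RHS]eq_bigr do rewrite !homWH_comb mulr_suml.
  rewrite [RHS]exchange_big; apply: eq_bigr => j _ /=.
  under [RHS]eq_bigr do rewrite -scalerAl mulr_sumr.
  rewrite -scaler_sumr exchange_big; congr (_ *: _).
  apply: eq_bigr => i _ /=; rewrite PE scaler_sumr.
  by apply: eq_bigr => k _; rewrite scalerAr.
rewrite [LHS]/dualityD -QE (basic_coefE sigma_basis sigma_homog W_faithful) /Q.
rewrite (linear_comb _ _ _ (mcoeff_linear U_(L)%MM)); apply: eq_bigr => j _; congr (_ * _).
by rewrite (linear_comb _ _ _ (mcoeff_linear U_(L)%MM)); apply: eq_bigr => i _; rewrite cE.
Qed.

Lemma homVd_comb s : exists b : 'I_m -> C, s = \sum_i b i *: phi i.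
Proof. by have [b [bE _]] := phi_basis.2 s I; exists (fun i => b 0 i). Qed.

Lemma dualityPhi_extends : extends_D sigma dualityPhi.
Proof.
move=> s t ts v; have [b sE] := homVd_comb s.
have [a [vE _]] := sigma_basis.2 v I.
have coord_t i : coord t i = (b i)%:A.
  move: i; apply: coord_uniq => x; rewrite -coordE ts sE homWH_comb.
  by apply: eq_bigr => i _; rewrite /= -scalerAl mul1r.
rewrite [in RHS]vE sE dualityD_comb [in LHS]vE (linear_comb _ _ _ (@tilde_linear _ _ _ _ W)).
have [tL _] := derP (dualityPhi t); rewrite (linear_comb _ _ _ tL) scaler_suml.
apply: eq_bigr => j _; rewrite -scalerA dualityPhi_tilde; congr (_ *: _).
rewrite scaler_suml; apply: eq_bigr => i _.
by rewrite coord_t scalerA mulrC.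
Qed.

Lemma dualityPhi_unique (Phi : {linear invDer W -> der (invS W)}) :
  extends_D sigma Phi -> Phi =1 dualityPhi.
Proof.
move=> PhiD t; rewrite (invDer_coordE t) (raddf_sum Phi) (raddf_sum dualityPhi).
apply: eq_bigr => i _; rewrite /= !linearZ /=; congr (_ *: _); apply: derInv_ext => j.
by rewrite (PhiD _ _ (tphiE i)) (dualityPhi_extends (tphiE i)).
Qed.

(** The components of the coordinates in the expected degrees are coordinates of [t] as well, and
    coordinates are unique. The shift comes from [tphi i] having degree e_i - 1. *)
Lemma coord_degree k t i : invDer_deg k t -> S_ (k + 1 - (e i)%:Z) (invS_val (coord t i)).
Proof.
move=> tk; have tx x : S_ (k + 1) (t (linform x)).
  rewrite addrC; apply: (tk 1); apply: rpred_sum => j _.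
  by rewrite rpredZ // dhomogX /= mdeg1.
case: (k + 1) tx => [N|N] tx; last first.
  suff -> : coord t i = 0 by apply: S_0.
  apply: (coord_uniq (b := fun=> 0)) => x; rewrite -coordE [LHS]tx big1 // => j _.
  exact: mul0r.
pose a j := if (e j <= N)%N then pihomog mdeg (N - e j) (invS_val (coord t j)) else 0.
have aW j : a j \in invS_pred W.
  by rewrite /a; case: ifP => _; rewrite ?rpred0 // invS_pihomog // (valP (coord t j)).
have -> : coord t i = InvS (aW i).
  apply: (coord_uniq (b := fun j => InvS (aW j))) => x; rewrite -coordE.
  rewrite -[LHS](pihomog_dE (tx x)) coordE raddf_sum; apply: eq_bigr => j _ /=.
  rewrite mulrC (pihomogMl _ _ (phi_homog j x)) /a; case: ifP; rewrite ?mul0r //.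
  by rewrite mulrC.
rewrite -[invS_val _]/(a i) /a; case: leqP => [le|_]; last exact: S_0.
by rewrite subzn //; apply: pihomogP.
Qed.

Lemma dpart_degree k j p : S_ k (invS_val p) ->
  S_ (k - (ds j).+1%:Z) (invS_val (dpart j p)).
Proof.
have [P <-] := cf_surj p; rewrite dpartE -[invS_val (cf _^`M(j))]/(P^`M(j) \mPo f).
rewrite -[invS_val _]/(P \mPo f); case: k => [E|E] PE; last first.
  suff -> : P = 0 by rewrite mderiv0 raddf0; apply: S_0.
  by apply: (basic_invariants_independent sigma_basis sigma_homog W_faithful).
have supp := weighted_support sigma_basis sigma_homog W_faithful PE.
have supp' k : k \in msupp P^`M(j) -> (wdeg (fun j => (ds j).+1) k + (ds j).+1 = E)%N.
  rewrite mcoeff_msupp mcoeff_deriv => kP; rewrite -(supp (k + U_(j))%MM).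
    by rewrite wdegD wdeg1.
  by rewrite mcoeff_msupp; apply: contraNneq kP => ->; rewrite mul0rn.
rewrite (mpolyE P^`M(j)) (linear_comb _ _ _ comp_basic_linear) big_seq.
apply: S_sum => k kP; apply: S_Z; rewrite -(supp' k kP) PoszD addrK /=.
have fh l : tnth f l \is (wdeg (fun j => (ds j).+1) U_(l)%MM).-homog.
  by rewrite wdeg1; apply: tilde_homog.
exact: comp_mpolyXm_homog fh.
Qed.

Lemma dualityPhi_degree : degree_preserving (ds L).+1%:Z dualityPhi.
Proof.
move=> k t tk i p pi; rewrite /dualityPhi der_sumE.
have -> : invS_val (\sum_j ((\sum_i c i j *: coord t i) *: dpart j) p) =
    \sum_j \sum_i c i j *: (invS_val (coord t i) * invS_val (dpart j p)).
  rewrite (big_morph (@invS_val _ _ _ _ W) (id1 := 0) (op1 := +%R)) //.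
  apply: eq_bigr => j _.
  rewrite der_invS_scaleE.
  rewrite (linear_comb _ _ _ (@invS_val_linear _ _ _ _ W)) mulr_suml.
  by apply: eq_bigr => l _; rewrite -scalerAl.
apply: S_sum => j _; apply: S_sum => l _.
have [->|cn0] := eqVneq (c l j) 0; first by rewrite scale0r; apply: S_0.
have cd := dualityD_degree sigma_basis sigma_homog W_faithful phi_homog cn0.
apply: S_Z; have -> : i + (k - (ds L).+1%:Z) =
    (k + 1 - (e l)%:Z) + (i - (ds j).+1%:Z) by lia.
by apply: S_M; [apply: coord_degree | apply: dpart_degree].
Qed.

Lemma tphi_comb_degree k (a : 'I_m -> invS W) :
  (forall i, S_ (k + 1 - (e i)%:Z) (invS_val (a i))) ->
  invDer_deg k (\sum_i a i *: tphi i).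
Proof.
move=> ak i p pi; set t := \sum_i _.
have tE q : t q = \sum_l q^`M(l) * t (linform (vVd C l)).
  have [tL tM] := derP (invDer_val t); have tL1 q1 q2 : t (q1 + q2) = t q1 + t q2.
    by have := tL 1 q1 q2; rewrite !scale1r.
  elim/mpoly_ring_ind: q => [b|l|q1 q2 IH1 IH2|q1 q2 IH1 IH2].
  - rewrite -[b%:MP]mulr1 mul_mpolyC der_C big1 // => l _.
    by rewrite -mul_mpolyC mulr1 mderivC mul0r.
  - rewrite (bigD1 l) //= big1 => [|l' /negPf ll'].
      by rewrite mderivXU eqxx linform_vVd mul1r addr0.
    by rewrite mderivXU eq_sym ll' mpolyC0 mul0r.
  - rewrite tL1 IH1 IH2 -big_split; apply: eq_bigr => l _ /=.
    by rewrite mderivD mulrDl.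
  - rewrite tM IH1 IH2 mulr_sumr mulr_suml -big_split; apply: eq_bigr => l _ /=.
    by rewrite mderivM; ring.
rewrite tE; apply: S_sum => l _; rewrite tphi_comb mulr_sumr; apply: S_sum => j _.
have -> : i + k = (i - 1) + ((k + 1 - (e j)%:Z) + (e j)%:Z) by lia.
apply: S_M; last by apply: S_M; [apply: ak | apply: phi_homog].
case: i pi => [[|d]|d] pi.
- have -> : p^`M(l) = 0; last exact: S_0.
  apply/mpolyP=> k'; rewrite mcoeff_deriv mcoeff0 (dhomog_nemf_coeff pi) ?mul0rn //.
  by rewrite /= mdegD mdeg1 addn1.
- rewrite -[d.+1%:Z]/(1 + d%:Z) addrC addKr /=; apply/dhomogP => k'.
  rewrite mcoeff_msupp mcoeff_deriv => kp.
  have : (k' + U_(l))%MM \in msupp p.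
    by rewrite mcoeff_msupp; apply: contraNneq kp => ->; rewrite mul0rn.
  by move/(dhomog_mf pi); rewrite /= mdegD mdeg1 addn1 => -[].
- by rewrite [p]pi mderiv0; apply: S_0.
Qed.

Let cM := \matrix_(i, j) c i j.

(* The inverse of [cM] intertwines the diagonal matrices of degrees because [cM]
   does. *)
Lemma inverse_degree (B : 'M_(n.+1, m)) i j :
  B *m cM = 1%:M -> cM *m B = 1%:M -> (forall j, ds j <= ds L)%N ->
  B j i != 0 -> (ds j + e i = (ds L).+1)%N.
Proof.
move=> Bc cB ds_bound Bji.
pose X := diag_mx (\row_i (e i)%:R) : 'M[C]_m.
pose Y := diag_mx (\row_j ((ds L).+1 - ds j)%:R) : 'M[C]_n.+1.
have XcY : X *m cM = cM *m Y.
  apply/matrixP=> k l; rewrite mul_diag_mx mul_mx_diag !mxE.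
  have [->|ckl] := eqVneq (c k l) 0; first by rewrite mulr0 mul0r.
  have := dualityD_degree sigma_basis sigma_homog W_faithful phi_homog ckl.
  by move=> <-; rewrite addKn mulrC.
have BX : B *m X = Y *m B.
  by rewrite -[LHS]mulmx1 -cB mulmxA -(mulmxA B X) XcY mulmxA Bc mul1mx.
have := congr1 (fun M : 'M_(n.+1, m) => M j i) BX.
rewrite mul_diag_mx mul_mx_diag !mxE mulrC => /(mulIf Bji)/eqP.
by rewrite eqr_nat => /eqP->; rewrite subnKC // ltnW // ltnS.
Qed.

Definition dualityPsi (B : 'M_(n.+1, m)) (u : der (invS W)) : invDer W :=
  \sum_i (\sum_j B j i *: u (tilde (sigma j))) *: tphi i.

Lemma dualityPsi_linear B : linear (dualityPsi B).
Proof.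
move=> a u v; rewrite scaler_sumr -big_split; apply: eq_bigr => i _ /=.
rewrite scalerA -scalerDl; congr (_ *: _).
rewrite mulr_sumr -big_split; apply: eq_bigr => j _ /=.
by rewrite -scalerAr -scalerDr.
Qed.

HB.instance Definition _ B :=
  GRing.isLinear.Build (invS W) (der (invS W)) (invDer W) _ (dualityPsi B)
    (dualityPsi_linear B).

Lemma graded_iso_of_inverse B :
  B *m cM = 1%:M -> cM *m B = 1%:M -> (forall j, ds j <= ds L)%N ->
  graded_iso (ds L).+1%:Z dualityPhi.
Proof.
move=> Bc cB ds_bound; split; first exact: dualityPhi_degree.
exists (dualityPsi B); split=> [t|u|k u uk].
- rewrite [RHS](invDer_coordE t); apply: eq_bigr => i _; congr (_ *: _).
  under eq_bigr do rewrite dualityPhi_tilde scaler_sumr.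
  rewrite exchange_big /= (bigD1 i) //= [X in _ + X]big1 ?addr0 => [|l li].
    under eq_bigr do rewrite scalerA.
    rewrite -scaler_suml -[RHS]scale1r; congr (_ *: _).
    have /matrixP/(_ i i) := cB; rewrite !mxE eqxx => one; rewrite -[RHS]one.
    by apply: eq_bigr => j _; rewrite !mxE mulrC.
  under eq_bigr do rewrite scalerA.
  rewrite -scaler_suml; have /matrixP/(_ l i) := cB.
  rewrite !mxE (negPf li) => cBli.
  suff -> : \sum_j B j i * c l j = 0 by rewrite scale0r.
  by rewrite -[RHS]cBli; apply: eq_bigr => j _; rewrite !mxE mulrC.
- apply: derInv_ext => k; rewrite dualityPhi_tilde.
  under eq_bigr do rewrite coord_comb scaler_sumr.
  rewrite exchange_big /= (bigD1 k) //= [X in _ + X]big1 ?addr0 => [|l lk].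
    under eq_bigr do rewrite scalerA.
    rewrite -scaler_suml -[RHS]scale1r; congr (_ *: _).
    have /matrixP/(_ k k) := Bc; rewrite !mxE eqxx => one; rewrite -[RHS]one.
    by apply: eq_bigr => j _; rewrite !mxE mulrC.
  under eq_bigr do rewrite scalerA.
  rewrite -scaler_suml; have /matrixP/(_ l k) := Bc.
  rewrite !mxE (negPf lk) => Bclk.
  suff -> : \sum_i c i k * B l i = 0 by rewrite scale0r.
  by rewrite -[RHS]Bclk; apply: eq_bigr => j _; rewrite !mxE mulrC.
- apply: tphi_comb_degree => i.
  rewrite (linear_comb _ _ _ (@invS_val_linear _ _ _ _ W)); apply: S_sum => j _.
  have [->|Bji] := eqVneq (B j i) 0; first by rewrite scale0r; apply: S_0.
  apply: S_Z; have := inverse_degree Bc cB ds_bound Bji => ed.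
  have -> : k + 1 - (e i)%:Z = (ds j).+1%:Z + (k - (ds L).+1%:Z) by lia.
  by apply: uk; rewrite -tnth_basic; apply: tilde_homog.
Qed.

Lemma scalar_invS_inj (x : C) : x%:A = 0 :> invS W -> x = 0.
Proof.
move/(congr1 (fun p => (invS_val p)@_0%MM)); rewrite mcoeff0 => <-.
by rewrite /= mcoeffZ mcoeff1 eqxx mulr1.
Qed.

Lemma inverse_of_iso (Psi : {linear der (invS W) -> invDer W}) :
  cancel dualityPhi Psi -> cancel Psi dualityPhi ->
  exists2 B : 'M_(n.+1, m), B *m cM = 1%:M & cM *m B = 1%:M.
Proof.
(* The preimages of the d/df_j have invariants as coordinates, while [cM] is scalar; constant terms
   therefore already give a left inverse. *)
move=> PhiK PsiK; pose B := \matrix_(j, i) (invS_val (coord (Psi (dpart j)) i))@_0%MM.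
have Bc : B *m cM = 1%:M.
  apply/matrixP=> j k; rewrite !mxE.
  have := dualityPhi_tilde (Psi (dpart j)) k; rewrite PsiK dpart_tilde.
  move/(congr1 (fun p => (invS_val p)@_0%MM)).
  rewrite (linear_comb _ _ _ (@invS_val_linear _ _ _ _ W)).
  rewrite (linear_comb _ _ _ (mcoeff_linear 0%MM)) => E.
  transitivity ((invS_val ((k == j)%:R : invS W))@_0%MM).
    by rewrite E; apply: eq_bigr => i _; rewrite !mxE mulrC.
  by rewrite eq_sym; case: (j == k); rewrite ?mcoeff1 ?mcoeff0 ?eqxx.
(* [m] and n + 1 are not known to agree, so the other identity needs injectivity: rows of
   [cM *m B - 1%:M] are killed by [cM] and so give derivations in the kernel of [dualityPhi]. *)
exists B => //; apply/eqP; rewrite -subr_eq0; apply/eqP/row_matrixP => i.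
set x := row i _; rewrite row0.
have xc : x *m cM = 0 by rewrite -row_mul mulmxBl mul1mx -mulmxA Bc mulmx1 subrr row0.
pose t := \sum_i (x 0 i)%:A *: tphi i.
have Pt : dualityPhi t = 0.
  apply: derInv_ext => k; rewrite dualityPhi_tilde.
  transitivity ((x *m cM) 0 k *: (1 : invS W)); last by rewrite xc mxE scale0r.
  rewrite mxE scaler_suml; apply: eq_bigr => l _.
  by rewrite /t coord_comb scalerA [cM l k]mxE mulrC.
have t0 : t = 0 by rewrite -(PhiK t) Pt raddf0.
apply/rowP=> k; rewrite [RHS]mxE; apply: scalar_invS_inj.
rewrite -[LHS](coord_comb (fun i => (x 0 i)%:A)) -/t t0.
have := coord_linear 0 0 0 k; rewrite scale0r addr0 mul0r add0r.
by have := coord_linear (-1) 0 0 k; rewrite scaler0 addr0 mulN1r addNr.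
Qed.

Lemma duality_map : (forall j, ds j <= ds L)%N ->
  exists Phi : {linear invDer W -> der (invS W)},
    [/\ extends_D sigma Phi,
        (forall Phi' : {linear invDer W -> der (invS W)},
           extends_D sigma Phi' -> Phi' =1 Phi),
        degree_preserving (ds L).+1%:Z Phi
      & graded_iso (ds L).+1%:Z Phi <->
        exists2 B : 'M_(n.+1, m), B *m cM = 1%:M & cM *m B = 1%:M].
Proof.
move=> ds_bound; exists (dualityPhi : {linear invDer W -> der (invS W)}).
split; [exact: dualityPhi_extends | exact: dualityPhi_unique
       | exact: dualityPhi_degree | split].
  by case=> _ [Psi [PhiK PsiK _]]; apply: inverse_of_iso PhiK PsiK.
by case=> B Bc cB; apply: graded_iso_of_inverse Bc cB ds_bound.
Qed.

End Assembly.

(** * Codegrees and the duality condition *)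

Section GradedDimension.

Variables (C : numClosedFieldType) (gT : finGroupType) (G : {group gT}).
Variables (n : nat) (W : mx_representation C G n.+1).
Variables (l : nat) (psi : 'I_l -> homVd W) (ed : 'I_l -> nat).
Hypothesis psi_basis : is_basis (fun _ => True) psi.
Hypothesis psi_homog : forall i x, psi i x \is (ed i).-homog.

(** Projecting to polynomial degree k + 1 drops the coordinates on the [psi i] of other degrees
    without changing a map of degree [k], so these coordinates vanish. *)
Lemma homVd_deg_dim (k : int) :
  has_dim (@homVd_deg _ _ _ _ W k) (count_mem k [seq (ed i)%:Z - 1 | i <- enum 'I_l]).
Proof.
pose A := [set i | (ed i)%:Z - 1 == k].
have -> : count_mem k [seq (ed i)%:Z - 1 | i <- enum 'I_l] = #|A|.
  rewrite -sum1_count big_map big_enum_cond -sum1_card.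
  by apply: eq_bigl => i; rewrite !inE.
exists (fun i => psi (enum_val i)); split=> [i x|s sk].
  have := enum_valP i; rewrite inE => /eqP <-; rewrite subrK.
  exact: psi_homog.
have [x [sE xU]] := psi_basis.2 s I.
have x0 i : i \notin A -> x 0 i = 0.
  rewrite inE => iA.
  pose y := \row_j (if j \in A then x 0 j else 0).
  have /rowP/(_ i) : x = y; last by rewrite mxE inE (negPf iA).
  apply: xU; apply: homWH_ext => v; rewrite homWH_comb.
  have := sk v; case kE : (k + 1) => [N|N] sv.
    have pL : linear (@pihomog n.+1 C mdeg N) by move=> b p q; rewrite linearP.
    rewrite -[LHS](pihomog_dE (sv : _ \is N.-homog)) [in LHS]sE homWH_comb.
    rewrite (linear_comb _ _ _ pL); apply: eq_bigr => j _; rewrite mxE inE.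
    have -> : ((ed j)%:Z - 1 == k) = (ed j == N).
      by rewrite -(inj_eq (addIr (1 : int))) subrK kE.
    case: eqP => [<-|/eqP ne]; first by rewrite (pihomog_dE (psi_homog j v)).
    by rewrite (pihomog_ne0 ne (psi_homog j v)) scaler0 scale0r.
  rewrite [LHS]sv big1 // => j _; rewrite mxE inE.
  case: eqP => [jk|_]; last by rewrite scale0r.
  by move: kE; rewrite -jk subrK.
have sumA (y : 'rV[C]_l) : (forall i, i \notin A -> y 0 i = 0) ->
    \sum_(i < l) y 0 i *: psi i =
    \sum_(j < #|A|) y 0 (enum_val j) *: psi (enum_val j).
  move=> y0; rewrite -(big_enum_val (fun i => y 0 i *: psi i)) [RHS]big_mkcond /=.
  by apply: eq_bigr => i _; case: ifPn => // /y0->; rewrite scale0r.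
exists (\row_j x 0 (enum_val j)); split=> [|c cE].
  by rewrite {1}sE (sumA _ x0); apply: eq_bigr => j _; rewrite mxE.
pose y := \row_(i < l) \sum_(j < #|A|) c 0 j * (enum_val j == i)%:R.
have yE j : y 0 (enum_val j) = c 0 j.
  rewrite mxE (bigD1 j) //= eqxx mulr1 big1 ?addr0 // => j' jj'.
  by rewrite (inj_eq enum_val_inj) (negPf jj') mulr0.
have xy : x = y.
  apply: xU; rewrite cE (sumA y) => [|i iA].
    by apply: eq_bigr => j _; rewrite yE.
  rewrite mxE big1 // => j _; case: eqP => [ji|_]; last by rewrite mulr0.
  by rewrite -ji enum_valP in iA.
by apply/rowP=> j; rewrite mxE xy yE.
Qed.

End GradedDimension.

Lemma change_basis (F : fieldType) (E : lmodType F) k m (phi : 'I_m -> E)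
    (A : 'M_(m, k)) (B : 'M_(k, m)) :
  is_basis (fun _ => True) phi -> B *m A = 1%:M -> A *m B = 1%:M ->
  is_basis (fun _ => True) (fun j => \sum_i B j i *: phi i).
Proof.
move=> [_ phiB] BA AB; split=> // x _; have [b [bE bU]] := phiB x I.
have combE (y : 'rV_k) :
    \sum_j y 0 j *: (\sum_i B j i *: phi i) = \sum_i (y *m B) 0 i *: phi i.
  under eq_bigr do rewrite scaler_sumr.
  rewrite exchange_big; apply: eq_bigr => i _ /=; rewrite mxE scaler_suml.
  by apply: eq_bigr => j _; rewrite scalerA.
exists (b *m A); split=> [|y]; first by rewrite combE -mulmxA AB mulmx1.
by rewrite combE => /bU->; rewrite -mulmxA BA mulmx1.
Qed.

Section DualityGroups.

Variables (C : numClosedFieldType) (gT : finGroupType) (G : {group gT}).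
Variables (n : nat) (W : mx_representation C G n.+1).
Hypothesis W_faithful : mx_faithful W.
Variables (sigma : 'I_n.+1 -> homV W) (ds : 'I_n.+1 -> nat).
Hypothesis sigma_basis : is_basis (fun _ => True) sigma.
Hypothesis sigma_homog : forall j v, sigma j v \is (ds j).-homog.
Variable d : n.+1.-tuple int.
Hypothesis dE : forall j, tnth d j = (ds j).+1%:Z.
Hypothesis d_degrees : degrees W d.
Variables (m : nat) (phi : 'I_m -> homVd W) (e : 'I_m -> nat).
Hypothesis phi_basis : is_basis (fun _ => True) phi.
Hypothesis phi_homog : forall i x, phi i x \is (e i).-homog.

Let cM := \matrix_(i, j) dualityD sigma (phi i) (sigma j).

Lemma degrees_le (i j : 'I_n.+1) : (i <= j)%N -> tnth d i <= tnth d j.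
Proof.
move=> ij; rewrite !(tnth_nth 0).
by by apply: (le_sorted_leq_nth 0 d_degrees.1 _ _ ij); rewrite inE size_tuple.
Qed.

Lemma degrees_max j : (ds j <= ds ord_max)%N.
Proof. by have := @degrees_le j ord_max (leq_ord j); rewrite !dE lez_nat ltnS. Qed.

(** [B] turns [phi] into the basis [psi] dual to [sigma] under the pairing. The entries of [B]
    respect degrees, so [psi j] has codegree d - d_j, that is polynomial degree [ed j]. *)
Lemma duality_group_of_inverse (B : 'M_(n.+1, m)) :
  B *m cM = 1%:M -> cM *m B = 1%:M -> duality_group W.
Proof.
move=> Bc cB; pose psi j := \sum_i B j i *: phi i.
have psi_basis : is_basis (fun _ => True) psi by apply: change_basis Bc cB.
pose ed j := ((ds ord_max).+1 - ds j)%N.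
have psi_homog j x : psi j x \is (ed j).-homog.
  rewrite homWH_comb rpred_sum // => i _.
  have [->|Bji] := eqVneq (B j i) 0; first by rewrite scale0r rpred0.
  apply: rpredZ; rewrite /ed -(inverse_degree sigma_basis sigma_homog W_faithful
    phi_homog Bc cB degrees_max Bji) addKn.
  exact: phi_homog.
pose dd := [tuple tnth d ord_max - tnth d i | i < n.+1].
exists d, dd; split=> // [|i]; last by rewrite tnth_mktuple addrC subrK.
split=> [|k].
  apply/(sortedP 0) => i; rewrite size_tuple => i1; have i0 := ltnW i1.
  have ddE j (jn : (j < n.+1)%N) : dd`_j = tnth d ord_max - tnth d (Ordinal jn).
    by rewrite -(tnth_mktuple (fun i => tnth d ord_max - tnth d i)) (tnth_nth 0).
  rewrite (ddE _ i0) (ddE _ i1) /= lerD2l lerN2; exact: degrees_le.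
have -> : tval dd = [seq (ed j)%:Z - 1 | j <- enum 'I_n.+1].
  apply: eq_map => j; rewrite !dE /ed; have := degrees_max j; lia.
exact: homVd_deg_dim psi_basis psi_homog k.
Qed.

Lemma inverse_of_duality_group : mx_irreducible W -> duality_group W ->
  exists2 B : 'M_(n.+1, m), B *m cM = 1%:M & cM *m B = 1%:M.
Proof.
move=> Wirr [d' [dd [[d'_sorted d'_dim] [_ dd_dim] d'dd]]].
have d'd : d' = d.
  apply: val_inj; apply: le_sorted_eq => //; first exact: d_degrees.1.
  apply/allP=> k _; apply/eqP.
  exact: has_dim_uniq (d'_dim k) (d_degrees.2 k).
rewrite {}d'd {d' d'_sorted d'_dim} in d'dd.
have e_dd : perm_eq [seq (e i)%:Z - 1 | i <- enum 'I_m] dd.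
  apply/allP=> k _; apply/eqP.
  exact: has_dim_uniq (homVd_deg_dim phi_basis phi_homog k) (dd_dim k).
(* The homogeneous basis and the tuple [dd] count the same codegrees, which makes the pairing matrix
   square. *)
have mn : m = n.+1 by have := perm_size e_dd; rewrite size_map size_enum_ord size_tuple.
(* e_i - 1 is a codegree d - d_j, and 0 < d_j <= d. *)
have e_bound i : (0 < e i <= (ds ord_max).+1)%N.
  have : (e i)%:Z - 1 \in dd.
    by rewrite -(perm_mem e_dd); apply/map_f/mem_enum.
  case/tnthP=> j eE; have := d'dd j; rewrite -eE !dE; have := degrees_max j; lia.
have [B Bc] := dualityD_nondegenerate sigma_basis sigma_homog W_faithful phi_basis
  phi_homog Wirr e_bound degrees_max.
by exists B => //; apply: mulmx1C_eq Bc.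
Qed.

End DualityGroups.

Lemma duality_iso_iff (C : numClosedFieldType) (gT : finGroupType) (G : {group gT})
    (n : nat) (W : mx_representation C G n.+1) (d : n.+1.-tuple int)
    (sigma : 'I_n.+1 -> homV W) :
  complex_reflection_group W -> mx_irreducible W -> degrees W d ->
  is_basis (fun _ : homV W => True) sigma ->
  (forall i, homV_deg (tnth d i) (sigma i)) ->
  exists Phi : {linear invDer W -> der (invS W)},
    [/\ extends_D sigma Phi,
        (forall Phi' : {linear invDer W -> der (invS W)},
           extends_D sigma Phi' -> Phi' =1 Phi),
        degree_preserving (tnth d ord_max) Phi
      & graded_iso (tnth d ord_max) Phi <-> duality_group W].
Proof.
move=> [Wf Wr] Wirr d_degrees sigma_basis sigma_deg.
(* [ds j] is the polynomial degree of [sigma j], one less than d_j. Were d_j - 1 negative, [sigma j]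
   would be 0, against uniqueness of coordinates. *)
have [ds dE] : exists ds : 'I_n.+1 -> nat, forall j, tnth d j = (ds j).+1%:Z.
  have dex j : exists k, tnth d j = k.+1%:Z.
    case dj: (tnth d j - 1) => [k|k].
      by exists k; rewrite -[LHS](subrK 1) dj -PoszD addn1.
    have s0 : sigma j = 0.
      by apply: homWH_ext => v; have := sigma_deg j v; rewrite dj.
    have [c [_ cU]] := sigma_basis.2 0 I.
    have c1 := cU 0; have c2 := cU (delta_mx 0 j).
    suff /rowP/(_ j) : delta_mx 0 j = 0 :> 'rV[C]_n.+1.
      by rewrite !mxE !eqxx => /eqP; rewrite oner_eq0.
    rewrite -c1; last by rewrite big1 // => i _; rewrite mxE scale0r.
    rewrite c2 // big1 // => i _; rewrite mxE eqxx /=.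
    by case: eqP => [->|_]; rewrite ?s0 ?scaler0 // scale0r.
  by have [ds dE] := choice dex; exists ds.
have sigma_homog j v : sigma j v \is (ds j).-homog.
  have := sigma_deg j v; have -> : tnth d j - 1 = (ds j)%:Z; last by [].
  by rewrite dE; lia.
have ds_bound := degrees_max dE d_degrees.
have [m [phi [e [phi_homog phi_basis]]]] := homVd_graded_basis W.
have [dpart dpartE] := choice (partial_exists sigma_basis sigma_homog Wf).
have coordex (t : invDer W) : exists a : 'I_m -> invS W,
    forall x, t (linform x) = \sum_i invS_val (a i) * phi i x.
  exact: homVd_span phi_basis (invDer_equivariant t).
have [coord coordE] := choice coordex.
have [tphi tphiE] := choice (fun i => equivariant_invDer (homWH_equivariant (phi i))).
have [Phi [PhiD PhiU Phideg Phiiso]] := duality_map sigma_basis sigma_homog Wf Wr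
  phi_basis phi_homog dpartE coordE tphiE ds_bound.
exists Phi; rewrite dE; split=> //; rewrite Phiiso; split.
  by case=> B; apply: (duality_group_of_inverse Wf sigma_basis sigma_homog dE).
exact: inverse_of_duality_group.
Qed.

Local Open Scope complex_scope.

Theorem theorem2 (R : realType) (gT : finGroupType) (G : {group gT}) (n : nat)
    (W : mx_representation R[i] G n.+1) (d : n.+1.-tuple int)
    (sigma : 'I_n.+1 -> homV W) :
  complex_reflection_group W ->
  mx_irreducible W ->
  degrees W d ->
  is_basis (fun _ : homV W => True) sigma ->
  (forall i, homV_deg (tnth d i) (sigma i)) ->
  exists Phi : {linear invDer W -> der (invS W)},
    [/\ extends_D sigma Phi,
        (forall Phi' : {linear invDer W -> der (invS W)},
           extends_D sigma Phi' -> Phi' =1 Phi),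
        degree_preserving (tnth d ord_max) Phi
      & graded_iso (tnth d ord_max) Phi <-> duality_group W].
Proof. exact: duality_iso_iff. Qed.
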